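(* Let $d\ge1$, $\alpha\in[-1/2,\infty)^d$, $\sigma>0$, $1\le p<\infty$, $1\le q<\infty$. If $\sigma\ge|\alpha|+d$, then there is a constant $C$ such that $$\|\mathcal{I}_D^{\alpha,\sigma}f\|_{L^q(dw_\alpha)}\le C\|f\|_{L^p(dw_\alpha)},\qquad f\in L^p(\mathbb{R}^d,dw_\alpha).\qquad( * )$$ If $0<\sigma<|\alpha|+d$, then $( * )$ holds under the additional condition $$\frac1p-\frac{\sigma}{|\alpha|+d}\le\frac1q<\frac1p+\frac{\sigma}{|\alpha|+d},$$ with exclusion of the case when $p=1$ and $q=\frac{|\alpha|+d}{|\alpha|+d-\sigma}$. Moreover, if either $\sigma\ge|\alpha|+d$, or $0<\sigma<|\alpha|+d$ and $\frac1p-\frac{\sigma}{|\alpha|+d}\le\frac1q<\frac1p+\frac{\sigma}{|\alpha|+d}$ with $(p,q)\ne\big(1,\frac{|\alpha|+d}{|\alpha|+d-\sigma}\big)$ (so that $( * )$ holds), then for every $k\in\mathbb{N}^d$, $$\langle\mathcal{I}_D^{\alpha,\sigma}f,h_k^\alpha\rangle_{dw_\alpha}=(2|k|+2|\alpha|+2d)^{-\sigma}\langle f,h_k^\alpha\rangle_{dw_\alpha},\qquad f\in L^p(\mathbb{R}^d,dw_\alpha).$$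
   Context: $\mathbb{N}=\{0,1,\ldots\}$, $|k|=\sum k_i$, $|\alpha|=\sum\alpha_i$ (possibly negative). For $\alpha\in[-1/2,\infty)^d$ let $w_\alpha(x)=\prod_{j=1}^d|x_j|^{2\alpha_j+1}$ on $\mathbb{R}^d$, $dw_\alpha(x)=w_\alpha(x)\,dx$, and $\langle f,g\rangle_{dw_\alpha}=\int_{\mathbb{R}^d}f\overline{g}\,dw_\alpha$ whenever it makes sense. The generalized Hermite functions are $h_k^\alpha(x)=\prod_{i=1}^dh_{k_i}^{\alpha_i}(x_i)$, $x\in\mathbb{R}^d$, $k\in\mathbb{N}^d$, where for $m\in\mathbb{N}$, $\nu\ge-1/2$, $s\in\mathbb{R}$, $$h_{2m}^{\nu}(s)=(-1)^m\Big(\frac{\Gamma(m+1)}{\Gamma(m+\nu+1)}\Big)^{1/2}e^{-s^2/2}L_m^\nu(s^2),\qquad h_{2m+1}^{\nu}(s)=(-1)^m\Big(\frac{\Gamma(m+1)}{\Gamma(m+\nu+2)}\Big)^{1/2}e^{-s^2/2}sL_m^{\nu+1}(s^2),$$ with $L_m^\nu$ the Laguerre polynomial of degree $m$ and order $\nu$. They form an orthonormal basis of $L^2(\mathbb{R}^d,w_\alpha)$ and are eigenfunctions, with eigenvalues $2|k|+2|\alpha|+2d$, of the Dunkl harmonic oscillator $-\Delta_\alpha+\|x\|^2$ ($\Delta_\alpha$ being the Dunkl Laplacian for the reflection group $\mathbb{Z}_2^d$). Define $$G_t^{\alpha,D}(x,y)=\sum_{n=0}^\infty e^{-t(2n+2|\alpha|+2d)}\sum_{|k|=n}h_k^\alpha(x)h_k^\alpha(y),\qquad\mathcal{K}_D^{\alpha,\sigma}(x,y)=\frac1{\Gamma(\sigma)}\int_0^\infty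 G_t^{\alpha,D}(x,y)t^{\sigma-1}\,dt,$$ $$\mathcal{I}_D^{\alpha,\sigma}f(x)=\int_{\mathbb{R}^d}\mathcal{K}_D^{\alpha,\sigma}(x,y)f(y)\,dw_\alpha(y),$$ the last one on the natural domain of functions $f$ for which the integral converges for a.e. $x\in\mathbb{R}^d$. The kernel $\mathcal{K}_D^{\alpha,\sigma}(x,y)$ is well defined at least when $(|x_1|,\ldots,|x_d|)\ne(|y_1|,\ldots,|y_d|)$. The estimate $( * )$ implicitly includes the assertion that $L^p(\mathbb{R}^d,dw_\alpha)$ is contained in the natural domain. *)

(* Defs.v *)
From HB Require Import structures.
From mathcomp Require Import all_boot all_order all_algebra.
From mathcomp Require Import all_classical all_reals all_analysis.
From mathcomp Require Import measurable_realfun.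
From mathcomp Require Import complex.

Set Implicit Arguments.
Unset Strict Implicit.
Unset Printing Implicit Defensive.

Import Order.TTheory GRing.Theory Num.Theory.
Import numFieldNormedType.Exports.

Local Open Scope classical_set_scope.
Local Open Scope ring_scope.
Local Open Scope complex_scope.

(* R^d is modelled by d.-tuple (measurableTypeR R), whose sigma-algebra is the product of the   *)
(* Borel sigma-algebras.  Lebesgue measure on it is obtained by iterating the *)
(* product measure along the identification of R * R^n with R^n.+1.           *)
Section lebesgue_cons.
Context {R : realType} {n : nat}.
Variable m : {sigma_finite_measure set (n.-tuple (measurableTypeR R)) -> \bar R}.

Definition cons_point (x : measurableTypeR R * n.-tuple (measurableTypeR R)) : n.+1.-tuple (measurableTypeR R) :=
  [tuple of x.1 :: x.2].

Lemma measurable_cons_point : measurable_fun [set: measurableTypeR R * n.-tuple (measurableTypeR R)] cons_point.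
Proof. exact: measurable_cons. Qed.

Definition lebesgue_cons : set (n.+1.-tuple (measurableTypeR R)) -> \bar R :=
  pushforward ((@lebesgue_measure R) \x m)%E cons_point.

Let lebesgue_cons0 : lebesgue_cons set0 = 0%E.
Proof. by rewrite /lebesgue_cons /pushforward preimage_set0 measure0. Qed.

Let lebesgue_cons_ge0 A : (0 <= lebesgue_cons A)%E.
Proof. by rewrite /lebesgue_cons /pushforward measure_ge0. Qed.

Let lebesgue_cons_semi_sigma_additive : semi_sigma_additive lebesgue_cons.
Proof.
move=> F mF tF mUF; rewrite /lebesgue_cons /pushforward preimage_bigcup.
apply: measure_semi_sigma_additive.
- by move=> i; rewrite -[X in measurable X]setTI; exact: measurable_cons_point.
- apply/trivIsetP => /= i j _ _ ij; rewrite -preimage_setI.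
  by move/trivIsetP : tF => /(_ _ _ _ _ ij) ->//; rewrite preimage_set0.
- rewrite -preimage_bigcup -[X in measurable X]setTI.
  exact: measurable_cons_point.
Qed.

HB.instance Definition _ := isMeasure.Build _ _ _ lebesgue_cons
  lebesgue_cons0 lebesgue_cons_ge0 lebesgue_cons_semi_sigma_additive.

Let lebesgue_cons_sigma_finite : sigma_finite setT lebesgue_cons.
Proof.
have /sigma_finiteP[F [FT ndF Foo]] := sigma_finiteT (@lebesgue_measure R).
have /sigma_finiteP[G [GT ndG Goo]] := sigma_finiteT m.
pose g (x : n.+1.-tuple (measurableTypeR R)) := (thead x, [tuple of behead x]).
have gK : cancel cons_point g.
  by move=> [a t]; rewrite /g /= theadE; congr pair; exact: val_inj.
have mg : measurable_fun [set: n.+1.-tuple (measurableTypeR R)] g.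
  apply: measurable_fun_pair; last exact: measurable_behead.
  exact: measurable_tnth.
exists (fun k => g @^-1` (F k `*` G k)).
  apply/esym; rewrite -subTset => x _.
  have [i _ Fi] : (\bigcup_k F k) (g x).1 by rewrite -FT.
  have [j _ Gj] : (\bigcup_k G k) (g x).2 by rewrite -GT.
  exists (maxn i j) => //; split.
  - by move: Fi; exact/subsetPset/ndF/leq_maxl.
  - by move: Gj; exact/subsetPset/ndG/leq_maxr.
move=> k; have [mF Fkoo] := Foo k; have [mG Gkoo] := Goo k; split.
  by rewrite -[X in measurable X]setTI; apply: mg => //; exact: measurableX.
rewrite /lebesgue_cons /pushforward -comp_preimage (_ : g \o _ = id).
  by rewrite preimage_id product_measure1E// lte_mul_pinfty// ge0_fin_numE.
by apply/funext => x /=; rewrite gK.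
Qed.

HB.instance Definition _ := Measure_isSigmaFinite.Build _ _ _ lebesgue_cons
  lebesgue_cons_sigma_finite.

End lebesgue_cons.

Fixpoint lebesgue_tuple (R : realType) (n : nat) :
    {sigma_finite_measure set (n.-tuple (measurableTypeR R)) -> \bar R} :=
  match n with
  | 0 => \d_([tuple] : 0.-tuple (measurableTypeR R))
  | n'.+1 => lebesgue_cons (lebesgue_tuple R n')
  end.

Section dunkl_measure.
Context {R : realType} {d : nat}.
Variable alpha : 'I_d -> R.

Definition dunkl_weight (x : d.-tuple (measurableTypeR R)) : R :=
  \prod_(j < d) `|tnth x j| `^ (2 * alpha j + 1).

Lemma dunkl_weight_ge0 x : 0 <= dunkl_weight x.
Proof. by apply: prodr_ge0 => j _; exact: powR_ge0. Qed.

Lemma measurable_dunkl_weight : measurable_fun [set: d.-tuple (measurableTypeR R)] dunkl_weight.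
Proof.
apply: measurable_prod => j _.
apply: (measurableT_comp (measurable_powR _)).
by apply: measurableT_comp => //; exact: measurable_tnth.
Qed.

Definition dunkl_measure (A : set (d.-tuple (measurableTypeR R))) : \bar R :=
  (\int[lebesgue_tuple R d]_(x in A) (dunkl_weight x)%:E)%E.

Let dunkl_measure0 : dunkl_measure set0 = 0%E.
Proof. exact: integral_set0. Qed.

Let dunkl_measure_ge0 A : (0 <= dunkl_measure A)%E.
Proof. by apply: integral_ge0 => x _; rewrite lee_fin dunkl_weight_ge0. Qed.

Let dunkl_measure_semi_sigma_additive : semi_sigma_additive dunkl_measure.
Proof.
apply: semi_sigma_additive_nng_induced.
  by apply/measurable_EFinP; exact: measurable_dunkl_weight.
by move=> x; rewrite lee_fin dunkl_weight_ge0.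
Qed.

HB.instance Definition _ := isMeasure.Build _ _ _ dunkl_measure
  dunkl_measure0 dunkl_measure_ge0 dunkl_measure_semi_sigma_additive.

End dunkl_measure.

Section complex_valued.
Context {disp : measure_display} {T : measurableType disp} {R : realType}.
Variable mu : {measure set T -> \bar R}.
Implicit Types (f g : T -> R[i]) (p : R).

Definition cmeasurable f : Prop :=
  measurable_fun [set: T] (fun x => complex.Re (f x)) /\
  measurable_fun [set: T] (fun x => complex.Im (f x)).

Definition cintegrable f : Prop :=
  mu.-integrable [set: T] (fun x => (complex.Re (f x))%:E) /\
  mu.-integrable [set: T] (fun x => (complex.Im (f x))%:E).

Definition cintegral f : R[i] :=
  (\int[mu]_x complex.Re (f x)) +i* (\int[mu]_x complex.Im (f x)).

Definition cLnorm p f : \bar R :=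
  Lnorm mu p%:E (fun x => (Normc.normc (f x))%:E).

Definition in_Lp p f : Prop := cmeasurable f /\ (cLnorm p f < +oo)%E.

Definition pairing_defined f g : Prop :=
  cintegrable (fun x => f x * conjc (g x)).

Definition pairing f g : R[i] := cintegral (fun x => f x * conjc (g x)).

End complex_valued.

Section special_functions.
Context {R : realType}.

Definition Gamma (s : R) : R :=
  \int[lebesgue_measure]_(t in `]0, +oo[) (t `^ (s - 1) * expR (- t)).

(* L_m^nu = \sum_j binom(m + nu, m - j) (- X)^j / j!, where the generalized   *)
(* binomial coefficient binom(a, r) is a (a - 1) ... (a - r + 1) / r!.        *)
Definition gbinom (a : R) (r : nat) : R :=
  (\prod_(i < r) (a - i%:R)) / r`!%:R.

Definition laguerre (nu : R) (m : nat) : {poly R} :=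
  \poly_(j < m.+1) ((-1) ^+ j * gbinom (m%:R + nu) (m - j) / j`!%:R).

Definition hermite1 (nu : R) (n : nat) (s : R) : R :=
  let m := n./2 in
  if odd n then
    (-1) ^+ m * Num.sqrt (Gamma (m%:R + 1) / Gamma (m%:R + nu + 2))
      * expR (- (s ^+ 2) / 2) * s * (laguerre (nu + 1) m).[s ^+ 2]
  else
    (-1) ^+ m * Num.sqrt (Gamma (m%:R + 1) / Gamma (m%:R + nu + 1))
      * expR (- (s ^+ 2) / 2) * (laguerre nu m).[s ^+ 2].

End special_functions.

Section dunkl_potential.
Context {R : realType} {d : nat}.
Variable alpha : 'I_d -> R.
Implicit Types (x y : d.-tuple (measurableTypeR R)) (k : 'I_d -> nat) (f : d.-tuple (measurableTypeR R) -> R[i]).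

(* |alpha| + d *)
Definition hom_dim : R := \sum_(i < d) alpha i + d%:R.

Definition hermite k x : R := \prod_(i < d) hermite1 (alpha i) (k i) (tnth x i).

Definition eigenvalue_of (n : nat) : R := 2 * n%:R + 2 * hom_dim.

(* A multi-index k with |k| = n has all its entries in {0, ..., n}.           *)
Definition heat_kernel (t : R) x y : R :=
  limn (series (fun n : nat => expR (- t * eigenvalue_of n) *
    \sum_(k : {ffun 'I_d -> 'I_n.+1} | (\sum_(i < d) k i == n)%N)
      hermite (fun i => k i) x * hermite (fun i => k i) y)).

(* The kernel may be infinite, but only if |x_j| = |y_j| for all j.           *)
Definition potential_kernel (sigma : R) x y : \bar R :=
  ((Gamma sigma)^-1%:E *
   \int[lebesgue_measure]_(t in `]0%R, +oo[)
     (heat_kernel t x y * t `^ (sigma - 1))%:E)%E.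

Definition natural_domain (sigma : R) f : Prop :=
  {ae dunkl_measure alpha, forall x,
    (dunkl_measure alpha).-integrable [set: d.-tuple (measurableTypeR R)]
      (fun y => potential_kernel sigma x y * (complex.Re (f y))%:E)%E /\
    (dunkl_measure alpha).-integrable [set: d.-tuple (measurableTypeR R)]
      (fun y => potential_kernel sigma x y * (complex.Im (f y))%:E)%E}.

Definition potential (sigma : R) f x : R[i] :=
  fine (\int[dunkl_measure alpha]_y
    (potential_kernel sigma x y * (complex.Re (f y))%:E))%E +i*
  fine (\int[dunkl_measure alpha]_y
    (potential_kernel sigma x y * (complex.Im (f y))%:E))%E.

Definition potential_Lp_Lq (sigma p q : R) : Prop :=
  exists C : R, forall f, in_Lp (dunkl_measure alpha) p f ->
    [/\ natural_domain sigma f,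
        in_Lp (dunkl_measure alpha) q (potential sigma f) &
        (cLnorm (dunkl_measure alpha) q (potential sigma f) <=
           C%:E * cLnorm (dunkl_measure alpha) p f)%E].

Definition admissible_exponents (sigma p q : R) : Prop :=
  [/\ p^-1 - sigma / hom_dim <= q^-1,
      q^-1 < p^-1 + sigma / hom_dim &
      ~ (p = 1 /\ q = hom_dim / (hom_dim - sigma))].

Definition potential_spectral (sigma p : R) : Prop :=
  forall k f, in_Lp (dunkl_measure alpha) p f ->
    let h x := (hermite k x)%:C in
    [/\ pairing_defined (dunkl_measure alpha) (potential sigma f) h,
        pairing_defined (dunkl_measure alpha) f h &
        pairing (dunkl_measure alpha) (potential sigma f) h =
          (eigenvalue_of (\sum_(i < d) k i) `^ (- sigma))%:C
            * pairing (dunkl_measure alpha) f h].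

End dunkl_potential.

(* Main.v *)
(* Put D = |alpha| + d and s = exp (- 2 t).  The heat kernel factors over the coordinates.  In     *)
(* dimension one, its even and odd parts are Laguerre series summed by the Hille-Hardy identity,   *)
(* itself a consequence of the Pfaff-Saalschuetz sum and of the generating function of the         *)
(* Laguerre polynomials.  Hence |G_t| <= H_t for an explicit symmetric kernel H_t >= 0 with        *)
(* H_t <= c t^-D e^(-Dt), int H_t(x, y) dw(y) <= c e^(-Dt) and int int H_t <= c t^-D e^(-Dt).      *)
(* By Hoelder's inequality the operator with kernel H_t maps L^p to L^q with norm at most          *)
(* c t^(-D|1/p-1/q|) e^(-Dt), which is integrable against t^(sigma-1) when D|1/p-1/q| < sigma.     *)
(* At the endpoint 1/q = 1/p - sigma/D, p > 1, one estimates the measure of {I f > l} for each l:  *)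
(* the time integral is cut where its tail is at most l/2, f is cut at the height l^(q/p), and     *)
(* Chebyshev's inequality in L^1 and in L^(2p) handles the two pieces.  As q = p is always         *)
(* admissible, the spectral identity follows from Fubini's theorem and from the orthonormality of  *)
(* the Hermite functions, for every p.                                                             *)

From HB Require Import structures.
Require Import Defs.
From mathcomp Require Import all_boot all_order all_algebra.
From mathcomp Require Import all_classical all_reals all_analysis.
From mathcomp Require Import measurable_realfun complex ring lra zify.

Set Implicit Arguments.
Unset Strict Implicit.
Unset Printing Implicit Defensive.

Import Order.TTheory GRing.Theory Num.Theory.
Import numFieldNormedType.Exports.

Local Open Scope classical_set_scope.
Local Open Scope ring_scope.

(** * Gamma function and Gaussian integrals *)

(** The potential is an integral in time of the heat semigroup against t^(sigma-1) / Gamma(sigma),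
    so everything follows from estimates at a fixed time t, with D = |alpha| + d and s = exp(-2t).

    In one dimension the series of Hermite products splits by parity into two Laguerre series.
    [laguerre_valM] expands a product of two Laguerre polynomials, [hille_hardy] then sums both
    series in terms of [bessel], and [sqrt_bessel_le] absorbs the odd part into the even one: this
    is [mehler]. The resulting bound is a multiple of [laguerre_kernel], whose integrals are
    explicit ([integral_laguerre_kernel], [integral2_laguerre_kernel]). Absolute convergence lets
    the d-dimensional series factor over the coordinates ([cvg_series_prod], [heat_kernelE]), and
    [heat_majorant_bounds] collects what the L^p theory uses: a uniform bound c t^(-D) e^(-Dt), a
    Schur bound c e^(-Dt), and a bound c t^(-D) e^(-Dt) of the total mass over the product space.
    The third one gives access to q < p although the measure is infinite.

    For any symmetric nonnegative kernel with these bounds, [integral_kernel_op_unit] shows that the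
    operator at time t maps L^p to L^q with norm at most a constant times t^(-D|1/p-1/q|) e^(-Dt).
    The exponential makes the time integral converge at infinity, and it converges at 0 when
    D|1/p-1/q| < sigma ([integral_potential_op_strict]). If sigma >= D this inequality is automatic,
    as |1/p-1/q| < 1. If sigma < D, only the endpoint 1/q = 1/p - sigma/D remains. There the time
    integral is logarithmically divergent, and a real-interpolation argument on level sets takes
    over ([measure_potential_op_level], [integral_potential_op_endpoint]); it needs p > 1, whence
    the excluded pair.

    For the spectral identity, [exponents_self] places the case q = p among the admissible ones, so
    the potential of |f| lies in L^p and pairs absolutely with the Hermite function, which is
    bounded and integrable. Fubini's theorem moves the kernel onto the Hermite function. By
    orthonormality ([hermite1_orthonormal], [heat_eigen]) the heat kernel multiplies it by exp(-t
    lambda), with lambda its eigenvalue, and the time integral of this factor is Gamma(sigma)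
    lambda^(-sigma) ([integral_potential_kernel_hermite]). *)

Section calculus.
Context {R : realType}.
Local Notation mu := (@lebesgue_measure R).

Lemma integral_powR_cc (s a b : R) : s != 0 -> 0 < a -> a < b ->
  (\int[mu]_(x in `[a, b]) (x `^ (s - 1))%:E = ((b `^ s - a `^ s) / s)%:E)%E.
Proof.
move=> s0 a0 ab.
have dp (c x : R) : 0 < x -> derivable (fun x : R => x `^ c) x 1.
  by move=> x0; apply: derivable_powR; rewrite in_itv/= andbT.
have cp (c x : R) : 0 < x -> {for x, continuous (fun x : R => x `^ c)}.
  by move=> x0; apply/differentiable_continuous/derivable1_diffP/dp.
have dps (c x : R) : 0 < x -> derivable (fun y : R => s^-1 * y `^ c) x 1.
  by move=> x0; apply: derivableM => //; exact: dp.
have cps (c x : R) : 0 < x -> {for x, continuous (fun y : R => s^-1 * y `^ c)}.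
  by move=> x0; apply/differentiable_continuous/derivable1_diffP/dps.
rewrite (@continuous_FTC2 _ _ (fun x => s^-1 * x `^ s)) //.
- by rewrite -EFinB -mulrBr mulrC.
- apply: derivable_within_continuous => x; rewrite in_itv/= => /andP[ax _].
  by apply: dp; exact: lt_le_trans ax.
- split.
  + by move=> x; rewrite in_itv/= => /andP[ax _]; apply: dps; exact: lt_trans ax.
  + by apply: cvg_at_right_filter; exact: cps.
  + by apply: cvg_at_left_filter; apply: cps; exact: lt_trans ab.
- move=> x; rewrite in_itv/= => /andP[ax _].
  have x0 : 0 < x by exact: lt_trans ax.
  have xin : x \in `]0, +oo[ by rewrite in_itv/= x0.
  rewrite derive1E deriveM//; last exact: dp.
  rewrite derive_cst scaler0 addr0 -derive1E powR_derive1//.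
  by rewrite -[LHS]/(s^-1 * (s * _)) mulKf.
Qed.

Lemma measurable_powR_comp (s : R) (D : set R) : measurable_fun D (fun x : R => (x `^ s)%:E).
Proof. by apply/measurable_EFinP; apply: measurable_funTS; exact: measurable_powR. Qed.

Lemma cvg_sub_powR (a b : R ^nat) (s l l' : R) :
  a n @[n --> \oo] --> l -> b n @[n --> \oo] --> l' ->
  ((b n - a n) / s)%:E @[n --> \oo] --> ((l' - l) / s)%:E.
Proof.
move=> al bl; apply: cvg_EFin; first exact: nearW.
by apply: cvgMr_tmp; exact: cvgB.
Qed.

Lemma cvg_powR0 (s : R) (u : R ^nat) : 0 < s -> u n @[n --> \oo] --> 0 ->
  (forall n, 0 < u n) -> (u n) `^ s @[n --> \oo] --> 0.
Proof.
move=> s0 u0 up.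
by have /cvg_at_rightP := @powR_cvg0 R s s0; apply; split.
Qed.

(** For s < 1 the integrand is singular at 0, so the fundamental theorem of calculus is used away
    from 0 and combined with monotone convergence. *)
Lemma integral_powR_bounded (s a : R) : 0 < s -> 0 <= a ->
  (\int[mu]_(x in `]0%R, a[) (x `^ (s - 1))%:E = (a `^ s / s)%:E)%E.
Proof.
move=> s0; rewrite le_eqVlt => /predU1P[<-|a0].
  by rewrite set_itvoo0 integral_set0 powR0 ?gt_eqF// mul0r.
(* The divisor n + 2 keeps the left end strictly below a, as [integral_powR_cc] requires. *)
pose F n := `[a / n.+2%:R, a]%classic.
have an n : 0 < a / n.+2%:R by rewrite divr_gt0.
have anl n : a / n.+2%:R < a.
  by rewrite ltr_pdivrMr// ltr_pMr// ltr1n.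
transitivity (\int[mu]_(x in \bigcup_i F i) (x `^ (s - 1))%:E)%E.
  rewrite (_ : \bigcup_i F i = `]0, a]%classic).
    by rewrite [RHS]integral_itv_bndoo//; exact: measurable_powR_comp.
  apply/seteqP; split => x /=.
    by move=> [n _]; rewrite /F /= !in_itv/= => /andP[nx ->]; rewrite andbT; exact: lt_le_trans nx.
  rewrite in_itv/= => /andP[x0 xa].
  exists (Num.truncn (a / x)) => //; rewrite /F/= in_itv/= xa andbT.
  rewrite ler_pdivrMr// mulrC -ler_pdivrMr//.
  apply: ltW; apply: lt_trans (truncnS_gt _) _; rewrite ltr_nat.
  exact: ltnSn.
have := (@ge0_nondecreasing_set_cvg_integral _ (measurableTypeR R) R F (fun x : R => (x `^ (s - 1))%:E) lebesgue_measure); move=> /(_ _ _ _ _)/cvg_lim <-//; first last.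
  - by move=> n x _; rewrite lee_fin powR_ge0.
  - by move=> n; exact: measurable_powR_comp.
  - by move=> n; exact: measurable_itv.
  - apply/nondecreasing_seqP => n; rewrite subsetEset => x; rewrite /F/=.
    rewrite !in_itv/= => /andP[+ ->]; rewrite andbT; apply: le_trans.
    by rewrite ler_pM2l// lef_pV2 ?posrE// ler_nat.
have -> : (fun i => \int[mu]_(x in F i) (x `^ (s - 1))%:E)%E =
    EFin \o (fun i => (a `^ s - (a / i.+2%:R) `^ s) / s).
  by apply/funext => n /=; rewrite integral_powR_cc// gt_eqF.
apply/cvg_lim => //; rewrite -[X in X / s]subr0; apply: cvg_sub_powR; last exact: cvg_cst.
apply: cvg_powR0 => //; rewrite -[X in _ --> X](mulr0 a).
apply: cvgMl_tmp.
have := @cvg_harmonic R; rewrite -cvg_shiftS; exact.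
Qed.

Lemma integral_powR_tail (s a : R) : 0 < s -> 0 < a ->
  (\int[mu]_(x in `]a, +oo[) (x `^ (- s - 1))%:E = (a `^ (- s) / s)%:E)%E.
Proof.
move=> s0 a0.
pose F n := `[a, a + n.+1%:R]%classic.
transitivity (\int[mu]_(x in \bigcup_i F i) (x `^ (- s - 1))%:E)%E.
  rewrite (_ : \bigcup_i F i = `[a, +oo[%classic).
    by rewrite integral_itv_obnd_cbnd//; exact: measurable_powR_comp.
  apply/seteqP; split => x /=.
    by move=> [n _]; rewrite /F /= !in_itv/= => /andP[->].
  rewrite in_itv/= => /andP[x0 xa].
  exists (Num.truncn (x - a)) => //; rewrite /F/= in_itv/= x0 /=.
  by rewrite -lerBlDl; apply/ltW/truncnS_gt.
have := (@ge0_nondecreasing_set_cvg_integral _ (measurableTypeR R) R F (fun x : R => (x `^ (- s - 1))%:E) lebesgue_measure); move=> /(_ _ _ _ _)/cvg_lim <-//; first last.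
  - by move=> n x _; rewrite lee_fin powR_ge0.
  - by move=> n; exact: measurable_powR_comp.
  - by move=> n; exact: measurable_itv.
  - apply/nondecreasing_seqP => n; rewrite subsetEset => x; rewrite /F/=.
    rewrite !in_itv/= => /andP[->]/= /le_trans; apply.
    by rewrite lerD2l ler_nat.
have -> : (fun i => \int[mu]_(x in F i) (x `^ (- s - 1))%:E)%E =
    EFin \o (fun i => ((a + i.+1%:R) `^ (- s) - a `^ (- s)) / (- s)).
  apply/funext => n /=; rewrite integral_powR_cc// ?oppr_eq0 ?gt_eqF//.
  by rewrite ltrDl.
apply/cvg_lim => //; rewrite -[X in X / s]opprK -[X in - X / s]sub0r mulNr -mulrN -invrN.
apply: cvg_sub_powR; first exact: cvg_cst.
have h n : (a + n.+1%:R) `^ (- s) = ((a + n.+1%:R)^-1) `^ s.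
  by rewrite -powR_inv1 ?addr_ge0 ?(ltW a0)// -powRrM mulN1r.
under eq_fun do rewrite h.
apply: cvg_powR0 => //; last by move=> n; rewrite invr_gt0 addr_gt0.
apply: (@squeeze_cvgr _ _ _ _ (fun=> 0) harmonic).
- near=> n; rewrite invr_ge0 addr_ge0 ?(ltW a0)//= /harmonic lef_pV2 ?posrE//.
    by rewrite lerDr ltW.
  by rewrite addr_gt0.
- exact: cvg_cst.
- exact: cvg_harmonic.
Unshelve. all: by end_near. Qed.

Lemma integral_expR_tail (a : R) : 0 <= a ->
  (\int[mu]_(x in `]a, +oo[) (expR (- x))%:E = (expR (- a))%:E)%E.
Proof.
move=> a0.
have cN : continuous (fun x : R => expR (- x)).
  move=> z; apply: continuous_comp; last exact: continuous_expR.
  exact: (@continuousN _ R^o).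
have me D : measurable_fun D (EFin \o (fun x : R => expR (- x))).
  apply/measurable_EFinP; apply: measurable_funTS.
  exact: continuous_measurable_fun.
rewrite integral_itv_obnd_cbnd; last exact: me.
rewrite (@ge0_continuous_FTC2y _ _ (fun x => - expR (- x)) _ 0)//.
- by rewrite EFinN oppeK add0e.
- exact: continuous_subspaceT.
- by rewrite -oppr0; apply: cvgN; exact: cvgr_expR.
- by apply: cvgN; apply/cvg_at_right_filter; exact: cN.
- move=> z _; rewrite derive1E derive_val.
  by rewrite -[LHS]/(- (expR (- z) * -1)) mulrN1 opprK.
Qed.

Lemma lebesgue_measure_scale (c : R) (A : set R) : 0 < c -> measurable A ->
  mu A = (c%:E * mu ( *%R c @^-1` A))%E.
Proof.
move=> c0.
have mf : measurable_fun setT (( *%R c : R -> R) : measurableTypeR R -> measurableTypeR R).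
  exact: measurable_funM.
pose f : {mfun _ >-> _} := HB.pack (( *%R c : R -> R) : measurableTypeR R -> measurableTypeR R) (isMeasurableFun.Build _ _ _ _ _ mf).
move=> mA; apply: (@lebesgue_measure_unique _ (mscale ((PosNum c0)%:num%:nng) (pushforward lebesgue_measure f))) => // _ [[a b]] _ <-.
rewrite /= /mscale /pushforward/=.
transitivity (c%:E * mu `](a / c)%R, (b / c)%R]%classic)%E; last first.
  by congr (_ * mu _)%E; apply/esym; apply/seteqP; split=> x /=; rewrite !in_itv/= ltr_pdivrMr// ler_pdivlMr// mulrC.
rewrite !lebesgue_measure_itv/= !lte_fin ltr_pM2r ?invr_gt0//; case: ifPn => _; last by rewrite mule0.
by rewrite -!EFinB -EFinM -mulrBl mulrCA divff ?gt_eqF// mulr1.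
Qed.

Lemma ge0_integral_scale (c : R) (f : R -> \bar R) : 0 < c ->
  measurable_fun [set: R] f -> (forall x, 0 <= f x)%E ->
  (\int[mu]_x f x = c%:E * \int[mu]_x f (c * x)%R)%E.
Proof.
move=> c0 mf f0.
have mg : measurable_fun setT (( *%R c : R -> R) : measurableTypeR R -> measurableTypeR R).
  exact: measurable_funM.
pose g : {mfun _ >-> _} := HB.pack (( *%R c : R -> R) : measurableTypeR R -> measurableTypeR R) (isMeasurableFun.Build _ _ _ _ _ mg).
rewrite (@eq_measure_integral _ _ _ setT (mscale ((PosNum c0)%:num%:nng) (pushforward lebesgue_measure g))); last first.
  by move=> A mA _; exact: lebesgue_measure_scale.
by rewrite ge0_integral_mscale//= ge0_integral_pushforward.
Qed.

Lemma ge0_integral_scale0y (c : R) (f : R -> \bar R) : 0 < c ->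
  measurable_fun [set: R] f -> (forall x, 0 <= f x)%E ->
  (\int[mu]_(x in `]0%R, +oo[) f x = c%:E * \int[mu]_(x in `]0%R, +oo[) f (c * x)%R)%E.
Proof.
move=> c0 mf f0.
rewrite integral_mkcond (ge0_integral_scale c0).
- congr *%E; rewrite [RHS]integral_mkcond; apply: eq_integral => x _.
  rewrite !patchE; congr (if _ then _ else _).
  by apply/idP/idP; rewrite !inE/= !in_itv/= !andbT pmulr_rgt0.
- by apply/(measurable_restrictT _ _).1 => //; exact: measurable_funTS.
- by move=> x; apply: erestrict_ge0.
Qed.
End calculus.

Section tonelli_section.
Local Open Scope ereal_scope.
Context d1 d2 (T1 : measurableType d1) (T2 : measurableType d2) (R : realType).
Variables (m1 : {sigma_finite_measure set T1 -> \bar R}) (m2 : {sigma_finite_measure set T2 -> \bar R}).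

(** Tonelli's theorem for f(x) g(y) on a region A. Applied to planar regions, it does the work of
    the integration by parts in [GammaS] and of the substitution u = y^2 in
    [integral_gauss_moment1]. *)
Lemma tonelli_section (A : set (T1 * T2)) (f : T1 -> R) (g : T2 -> R) :
  measurable A -> measurable_fun setT f -> measurable_fun setT g ->
  (forall x, 0 <= f x)%R -> (forall y, 0 <= g y)%R ->
  \int[m1]_x ((f x)%:E * \int[m2]_(y in [set y | A (x, y)]) (g y)%:E) =
  \int[m2]_y ((g y)%:E * \int[m1]_(x in [set x | A (x, y)]) (f x)%:E).
Proof.
move=> mA mf mg f0 g0.
pose F (z : T1 * T2) := (f z.1 * g z.2 * \1_A z)%:E.
have mF : measurable_fun setT F.
  apply/measurable_EFinP; apply: measurable_funM; last exact: measurable_indic.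
  by apply: measurable_funM; apply: measurableT_comp.
have F0 z : 0 <= F z by rewrite lee_fin !mulr_ge0.
have msec1 x : measurable [set y | A (x, y)].
  by have := measurable_xsection x mA; rewrite /xsection; under eq_set do rewrite inE.
have msec2 y : measurable [set x | A (x, y)].
  by have := measurable_ysection y mA; rewrite /ysection; under eq_set do rewrite inE.
transitivity (\int[m1]_x \int[m2]_y F (x, y)).
  apply: eq_integral => x _.
  rewrite -ge0_integralZl//; last 3 first.
    by apply/measurable_EFinP; exact: measurable_funTS.
    by move=> y _; rewrite lee_fin.
    by rewrite lee_fin.
  rewrite integral_mkcond; apply: eq_integral => y _.
  rewrite /F patchE indicE /= -EFinM.
  have -> : ((x, y) \in A) = (y \in [set y | A (x, y)]) by apply/idP/idP; rewrite !inE.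
  by case: ifPn; rewrite ?mulr1 ?mulr0.
rewrite fubini_tonelli//; apply: eq_integral => y _.
rewrite -ge0_integralZl//; last 3 first.
  by apply/measurable_EFinP; exact: measurable_funTS.
  by move=> x _; rewrite lee_fin.
  by rewrite lee_fin.
rewrite [RHS]integral_mkcond; apply: eq_integral => x _.
rewrite /F patchE indicE /= -EFinM.
have -> : ((x, y) \in A) = (x \in [set x | A (x, y)]) by apply/idP/idP; rewrite !inE.
by case: ifPn; rewrite ?mulr1 ?mulr0// mulrC.
Qed.

End tonelli_section.

(** * The Gamma integral, its functional equation and the moments of Gaussians *)

Section gamma.
Context {R : realType}.
Local Notation mu := (@lebesgue_measure R).

(** The inequality ln u <= u - 1 at u = t/a gives t^a <= a^a e^(t-a) for positive a and t. *)
Lemma powR_le_expR (a t : R) : 0 <= a -> 0 <= t -> t `^ a <= (1 + a `^ a) * expR t.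
Proof.
move=> a0 t0; have [->|tn0] := eqVneq t 0.
  rewrite expR0 mulr1; have [->|an0] := eqVneq a 0; first by rewrite !powRr0; lra.
  by rewrite powR0// addr_ge0// powR_ge0.
have tp : 0 < t by rewrite lt0r tn0.
have [->|an0] := eqVneq a 0.
  by rewrite !powRr0; have := expR_ge1Dx t; lra.
have ap : 0 < a by rewrite lt0r an0.
apply: (@le_trans _ _ (a `^ a * expR t)); last by rewrite ler_wpM2r ?expR_ge0// lerDr.
rewrite /powR (negbTE tn0) (negbTE an0) -expRD ler_expR.
have h : ln (t / a) <= t / a - 1.
  by rewrite -{1}[t / a](subrKC 1) le_ln1Dx// ltrBrDl subrr divr_gt0.
move: h; rewrite ln_div ?posrE// -(ler_pM2l ap) !mulrBr mulr1 mulrCA divff// mulr1; lra.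
Qed.

Lemma measurable_ltr_set d (T : measurableType d) (f g : T -> R) :
  measurable_fun setT f -> measurable_fun setT g -> measurable [set x | f x < g x].
Proof.
move=> mf mg.
have /(_ measurableT [set true]) := measurable_fun_ltr mf mg.
by rewrite setTI; apply.
Qed.

Lemma measurable_fun_gamma (s : R) D : measurable_fun D (fun t : R => t `^ (s - 1) * expR (- t)).
Proof.
apply: measurable_funTS; apply: measurable_funM; first exact: measurable_powR.
by apply: measurableT_comp => //; exact: measurable_expR.
Qed.

Lemma integral_gamma_lty (s : R) : 0 < s ->
  (\int[mu]_(t in `]0%R, +oo[) (t `^ (s - 1) * expR (- t))%:E < +oo)%E.
Proof.
move=> s0.
have -> : `]0%R, +oo[%classic = (`]0%R, 1%R[ `|` `[1%R, +oo[)%classic :> set R.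
  by rewrite -itv_bndbnd_setU// bnd_simp.
have mG D : measurable_fun D (fun t : R => (t `^ (s - 1) * expR (- t))%:E).
  by apply/measurable_EFinP; exact: measurable_fun_gamma.
have ge0 (D : set R) : forall x, D x -> (0 <= (x `^ (s - 1) * expR (- x))%:E)%E.
  by move=> ? _; rewrite lee_fin mulr_ge0 ?powR_ge0 ?expR_ge0.
rewrite ge0_integral_setU//=; last 3 first.
  exact: mG.
  by move=> x _; exact: (ge0 setT).
  apply/disj_setPS => x []/=; rewrite !in_itv/= andbT => /andP[_ x1].
  by rewrite leNgt x1.
apply: lte_add_pinfty.
  apply: (@le_lt_trans _ _ (\int[mu]_(x in `]0%R, 1%R[) (x `^ (s - 1))%:E)%E).
    apply: ge0_le_integral => //; [exact: ge0|exact: mG|exact: measurable_powR_comp|].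
    move=> x /=; rewrite in_itv/= => /andP[x0 _].
    by rewrite lee_fin ler_piMr ?powR_ge0// -expR0 ler_expR oppr_le0 ltW.
  by rewrite integral_powR_bounded// ltry.
apply: (@le_lt_trans _ _ (\int[mu]_(x in `[1%R, +oo[) ((1 + (s + 1) `^ (s + 1))%:E * (x `^ (- 1 - 1))%:E))%E).
  apply: ge0_le_integral => //; [exact: ge0|exact: mG| |].
    by apply: emeasurable_funM => //; exact: measurable_powR_comp.
  move=> x /=; rewrite in_itv/= => /andP[x0 _]; rewrite -EFinM lee_fin.
  have xp : 0 < x by exact: lt_le_trans x0.
  have -> : s - 1 = (s + 1) + (- 1 - 1) by lra.
  rewrite powRD ?(gt_eqF xp) ?implybT// mulrAC ler_wpM2r ?powR_ge0//.
  rewrite expRN ler_pdivrMr ?expR_gt0// powR_le_expR//; lra.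
rewrite ge0_integralZl//.
- rewrite -integral_itv_obnd_cbnd; last exact: measurable_powR_comp.
  by rewrite integral_powR_tail// -EFinM ltry.
- exact: measurable_powR_comp.
- by move=> x _; rewrite lee_fin powR_ge0.
- by rewrite lee_fin addr_ge0 ?powR_ge0.
Qed.

(** [Gamma] is the [fine] part of an extended integral; since that integral is finite, no default
    value intervenes. *)
Lemma integral_gammaE (s : R) : 0 < s ->
  (\int[mu]_(t in `]0%R, +oo[) (t `^ (s - 1) * expR (- t))%:E = (Gamma s)%:E)%E.
Proof.
move=> s0; rewrite /Gamma /Rintegral fineK// ge0_fin_numE ?integral_gamma_lty//.
by apply: integral_ge0 => x _; rewrite lee_fin mulr_ge0 ?powR_ge0 ?expR_ge0.
Qed.

Lemma Gamma_gt0 (s : R) : 0 < s -> 0 < Gamma s.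
Proof.
move=> s0; rewrite -lte_fin -integral_gammaE//.
apply: (@lt_le_trans _ _ (\int[mu]_(x in `]0%R, 1%R[) ((expR (-1))%:E * (x `^ (s - 1))%:E))%E).
  rewrite ge0_integralZl//; last 2 first.
  - exact: measurable_powR_comp.
  - by move=> x _; rewrite lee_fin powR_ge0.
  by rewrite integral_powR_bounded// -EFinM lte_fin mulr_gt0 ?expR_gt0 ?divr_gt0 ?powR_gt0.
apply: (@le_trans _ _ (\int[mu]_(t in `]0%R, 1%R[) (t `^ (s - 1) * expR (- t))%:E)%E).
  apply: ge0_le_integral => //.
  - by move=> x _; rewrite mule_ge0// lee_fin ?expR_ge0 ?powR_ge0.
  - by apply: emeasurable_funM => //; exact: measurable_powR_comp.
  - by apply/measurable_EFinP; exact: measurable_fun_gamma.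
  - move=> x /=; rewrite in_itv/= => /andP[x0 x1]; rewrite -EFinM lee_fin mulrC.
    by rewrite ler_wpM2l ?powR_ge0// ler_expR lerN2 ltW.
apply: ge0_subset_integral => //.
- by apply/measurable_EFinP; exact: measurable_fun_gamma.
- by move=> x _; rewrite lee_fin mulr_ge0 ?powR_ge0 ?expR_ge0.
- by move=> x /=; rewrite !in_itv/= => /andP[->].
Qed.

Lemma tonelli_triangle (P : R -> R -> bool) (f g : R -> R) :
  measurable [set z : R * R | P z.1 z.2] ->
  measurable_fun setT f -> measurable_fun setT g ->
  (forall x, 0 <= f x) -> (forall y, 0 <= g y) ->
  (\int[mu]_x ((f x)%:E * \int[mu]_(y in [set y | P x y]) (g y)%:E) =
  \int[mu]_y ((g y)%:E * \int[mu]_(x in [set x | P x y]) (f x)%:E))%E.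
Proof.
move=> mP mf mg f0 g0.
exact: (@tonelli_section _ _ _ _ R lebesgue_measure lebesgue_measure _ f g mP).
Qed.

Lemma integral_triangle (f g : R -> R) :
  measurable_fun setT f -> measurable_fun setT g ->
  (forall x, 0 <= f x) -> (forall y, 0 <= g y) ->
  (\int[mu]_(x in `]0%R, +oo[) ((f x)%:E * \int[mu]_(y in `]0%R, x[) (g y)%:E) =
  \int[mu]_(y in `]0%R, +oo[) ((g y)%:E * \int[mu]_(x in `]y, +oo[) (f x)%:E))%E.
Proof.
move=> mf mg f0 g0.
pose P (x y : R) := (0 < y < x)%R.
rewrite [LHS]integral_mkcond [RHS]integral_mkcond.
transitivity (\int[mu]_x ((f x)%:E * \int[mu]_(y in [set y | P x y]) (g y)%:E))%E.
  apply: eq_integral => x _; rewrite patchE; case: ifPn => [_|].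
    by congr (_ * integral _ _ _)%E; apply/seteqP; split => y /=; rewrite in_itv.
  rewrite notin_setE/= in_itv/= andbT => /negP; rewrite -leNgt => x0.
  rewrite (_ : [set y | _] = set0) ?integral_set0 ?mule0//.
  by apply/seteqP; split => y //= /andP[y0 /(lt_trans y0)]; rewrite ltNge x0.
rewrite (@tonelli_triangle P f g _ mf mg f0 g0).
  apply: eq_integral => y _; rewrite patchE; case: ifPn.
    rewrite inE/= in_itv/= andbT => y0.
    by congr (_ * integral _ _ _)%E; apply/seteqP; split => x /=; rewrite in_itv/= /P y0/= andbT.
  rewrite notin_setE/= in_itv/= andbT => /negP y0.
  rewrite (_ : [set x | _] = set0) ?integral_set0 ?mule0//.
  by apply/seteqP; split => x //=; rewrite /P (negbTE y0).
rewrite (_ : [set z | _] = [set z : R * R | 0 < z.2] `&` [set z : R * R | z.2 < z.1]); last first.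
  by apply/seteqP; split => z /=; rewrite /P; [move=> /andP[]|move=> [-> ->]].
apply: measurableI; first by apply: measurable_ltr_set.
by apply: measurable_ltr_set.
Qed.

(** Write t^s as the integral of s y^(s-1) over 0 < y < t and exchange the integrals over the
    triangle 0 < y < t. *)
Lemma GammaS (s : R) : 0 < s -> Gamma (s + 1) = s * Gamma s.
Proof.
move=> s0; apply: EFin_inj; rewrite EFinM -!integral_gammaE//; last by rewrite addr_gt0.
rewrite -ge0_integralZl//; last 3 first.
- by apply/measurable_EFinP; exact: measurable_fun_gamma.
- by move=> x _; rewrite lee_fin mulr_ge0 ?powR_ge0 ?expR_ge0.
- by rewrite lee_fin ltW.
rewrite addrK.
transitivity (\int[mu]_(t in `]0%R, +oo[) ((expR (- t))%:E * \int[mu]_(y in `]0%R, t[) (s * y `^ (s - 1))%:E))%E.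
  apply: eq_integral => t; rewrite inE/= in_itv/= andbT => t0.
  under eq_integral do rewrite EFinM.
  rewrite ge0_integralZl//; last 3 first.
  - exact: measurable_powR_comp.
  - by move=> x _; rewrite lee_fin powR_ge0.
  - by rewrite lee_fin ltW.
  rewrite integral_powR_bounded//; last exact: ltW.
  by rewrite -!EFinM [s * _]mulrC divfK ?gt_eqF// mulrC.
rewrite integral_triangle//.
- apply: eq_integral => t; rewrite inE/= in_itv/= andbT => t0.
  by rewrite integral_expR_tail ?ltW// -!EFinM mulrA.
- by apply: measurableT_comp => //; exact: measurable_expR.
- by apply: measurable_funM => //; exact: measurable_powR.
- by move=> x; rewrite mulr_ge0 ?powR_ge0 ?ltW.
Qed.

Lemma integral_gamma_scale (s l : R) : 0 < s -> 0 < l ->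
  (\int[mu]_(t in `]0%R, +oo[) (t `^ (s - 1) * expR (- (l * t)))%:E = (Gamma s * l `^ (- s))%:E)%E.
Proof.
move=> s0 l0; rewrite mulrC EFinM -integral_gammaE//.
rewrite [in RHS](@ge0_integral_scale0y _ l)//; last 2 first.
- by apply/measurable_EFinP; exact: measurable_fun_gamma.
- by move=> x; rewrite lee_fin mulr_ge0 ?powR_ge0 ?expR_ge0.
rewrite muleA -EFinM -ge0_integralZl//; last 3 first.
- apply/measurable_EFinP; apply: (measurable_funS measurableT) => //.
  apply: (@measurableT_comp _ _ _ _ _ _ (fun t : R => t `^ (s - 1) * expR (- t))).
    exact: measurable_fun_gamma.
  exact: measurable_funM.
- by move=> x _; rewrite lee_fin mulr_ge0 ?powR_ge0 ?expR_ge0.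
- by rewrite lee_fin mulr_ge0 ?powR_ge0 ?ltW.
apply: eq_integral => t; rewrite inE/= in_itv/= andbT => t0.
rewrite -EFinM powRM ?ltW// !mulrA; congr (_ * _)%:E.
rewrite -[in RHS](powRr1 (ltW l0)) -mulrA [t `^ _]lock -!mulrA -lock !mulrA.
rewrite powRr1 ?ltW// -[X in _ * X * _ * _](powRr1 (ltW l0)) -!powRD ?(gt_eqF l0) ?implybT//.
by rewrite (_ : - s + 1 + (s - 1) = 0) ?powRr0 ?mul1r//; ring.
Qed.

Lemma ge0_integral_reflect (f : R -> \bar R) :
  measurable_fun [set: R] f -> (forall x, 0 <= f x)%E ->
  (\int[mu]_x f (- x)%R = \int[mu]_x f x)%E.
Proof.
move=> mf f0.
have mg : measurable_fun setT ((-%R : R -> R) : measurableTypeR R -> measurableTypeR R).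
  exact: oppr_measurable.
pose g : {mfun _ >-> _} := HB.pack ((-%R : R -> R) : measurableTypeR R -> measurableTypeR R) (isMeasurableFun.Build _ _ _ _ _ mg).
rewrite [RHS](@eq_measure_integral _ _ _ setT (pushforward lebesgue_measure g)); last first.
  by move=> A mA _; apply/esym/lebesgue_measureN.
by rewrite ge0_integral_pushforward.
Qed.

(** Reflection exchanges the positive and the negative part; finiteness excludes the case where both
    have infinite integral. *)
Lemma integral_odd (f : R -> \bar R) :
  measurable_fun [set: R] f -> (forall x, f (- x)%R = (- f x)%E) ->
  (\int[mu]_x f x \is a fin_num)%E -> (\int[mu]_x f x = 0)%E.
Proof.
move=> mf fN; rewrite integralE.
have -> : (\int[mu]_x f^\- x = \int[mu]_x f^\+ x)%E.
  rewrite -ge0_integral_reflect.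
  - apply: eq_integral => x _; rewrite funenegE funeposE fN oppeK//.
  - exact: measurable_funeneg.
  - by move=> x; exact: funeneg_ge0.
have : (0 <= \int[mu]_x f^\+ x)%E by apply: integral_ge0 => x _; exact: funepos_ge0.
by case: (\int[mu]_x f^\+ x)%E => //= r _ _; rewrite -EFinB subrr.
Qed.

Lemma ge0_integral_even (f : R -> \bar R) :
  measurable_fun [set: R] f -> (forall x, 0 <= f x)%E -> (forall x, f (- x)%R = f x) ->
  (\int[mu]_x f x = 2%:E * \int[mu]_(x in `]0%R, +oo[) f x)%E.
Proof.
move=> mf f0 fN.
rewrite -(itv_setU_setT false (0 : R)) ge0_integral_setU//=; last 2 first.
- by rewrite itv_setU_setT.
- by apply/disj_setPS => x []/=; rewrite !in_itv/= andbT => x0 /(le_lt_trans x0); rewrite ltxx.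
have := ge0_integration_by_substitution0 mf f0.
under [in RHS]eq_integral do rewrite fN.
move=> <-; rewrite -integral_itv_obnd_cbnd; last exact: measurable_funTS.
by rewrite mule_natl mule2n.
Qed.

Lemma measurable_gauss_moment (s c : R) :
  measurable_fun setT (fun y : R => (`|y| `^ (2 * s - 1) * expR (- (c * y ^+ 2)))%:E).
Proof.
apply/measurable_EFinP; apply: measurable_funM.
  apply: (measurableT_comp (measurable_powR _)); exact: normr_measurable.
apply: measurableT_comp; first exact: measurable_expR.
apply: measurableT_comp => //; apply: measurable_funM => //.
Qed.

(** Write e^(-y^2) as the integral of e^(-u) over u > y^2 and exchange over the region 0 < y, y^2 <
    u. The inner integral is u^s / (2s), and Gamma(s+1) = s Gamma(s) concludes. *)
Lemma integral_gauss_moment1 (s : R) : 2^-1 <= s ->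
  (\int[mu]_y (`|y| `^ (2 * s - 1) * expR (- (1 * y ^+ 2)))%:E = (Gamma s)%:E)%E.
Proof.
move=> s2; have s0 : 0 < s by apply: lt_le_trans s2; rewrite invr_gt0.
rewrite ge0_integral_even; last 3 first.
- exact: measurable_gauss_moment.
- by move=> y; rewrite lee_fin mulr_ge0 ?powR_ge0 ?expR_ge0.
- by move=> y; rewrite normrN sqrrN.
pose P (y u : R) := (0 < y) && (y ^+ 2 < u).
have mpow : measurable_fun setT (fun y : R => y `^ (2 * s - 1)) by exact: measurable_powR.
have mexp : measurable_fun setT (fun u : R => expR (- u)).
  by apply: measurableT_comp => //; exact: measurable_expR.
transitivity (2%:E * \int[mu]_x ((x `^ (2 * s - 1))%:E * \int[mu]_(y in [set y | P x y]) (expR (- y))%:E))%E.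
  congr *%E; rewrite integral_mkcond; apply: eq_integral => y _.
  rewrite patchE; case: ifPn.
    rewrite inE/= in_itv/= andbT => y0.
    rewrite (_ : [set u | _] = `]y ^+ 2, +oo[%classic); last first.
      by apply/seteqP; split => u /=; rewrite in_itv/= /P y0/= andbT.
    by rewrite integral_expR_tail ?sqr_ge0// -EFinM gtr0_norm// mul1r.
  rewrite notin_setE/= in_itv/= andbT => /negP y0.
  rewrite (_ : [set u | _] = set0) ?integral_set0 ?mule0//.
  by apply/seteqP; split => u //=; rewrite /P (negbTE y0).
rewrite (@tonelli_triangle P _ _ _ mpow mexp (fun=> powR_ge0 _ _) (fun=> expR_ge0 _)).
  transitivity (2%:E * \int[mu]_(u in `]0%R, +oo[) ((2 * s)^-1%:E * (u `^ (s + 1 - 1) * expR (- u))%:E))%E.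
    congr *%E; rewrite [RHS]integral_mkcond; apply: eq_integral => u _.
    rewrite patchE; case: ifPn.
      rewrite inE/= in_itv/= andbT => u0.
      rewrite (_ : [set y | _] = `]0%R, Num.sqrt u[%classic); last first.
        apply/seteqP; split => y /=; rewrite in_itv/= /P.
          by move=> /andP[y0 yu]; rewrite y0/= -(ger0_norm (ltW y0)) -sqrtr_sqr ltr_sqrt.
        move=> /andP[y0 yu]; rewrite y0/= -[ltRHS](sqr_sqrtr (ltW u0)).
        by rewrite ltr_pXn2r// ?nnegrE ?sqrtr_ge0// ltW.
      rewrite integral_powR_bounded ?sqrtr_ge0 ?mulr_gt0//.
      rewrite -!EFinM; congr EFin.
      rewrite powRrM powR_mulrn ?sqrtr_ge0// sqr_sqrtr ?(ltW u0)// addrK.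
      by rewrite mulrA mulrC [_ * expR _]mulrC.
    rewrite notin_setE/= in_itv/= andbT => /negP; rewrite -leNgt => u0.
    rewrite (_ : [set y | _] = set0) ?integral_set0 ?mule0//.
    apply/seteqP; split => y //=; rewrite /P => /andP[_] /lt_le_trans/(_ u0).
    by rewrite ltNge sqr_ge0.
  rewrite ge0_integralZl//; last 3 first.
  - by apply/measurable_EFinP; exact: measurable_fun_gamma.
  - by move=> x _; rewrite lee_fin mulr_ge0 ?powR_ge0 ?expR_ge0.
  - by rewrite lee_fin invr_ge0 mulr_ge0// ltW.
  rewrite integral_gammaE ?addr_gt0// GammaS// -!EFinM; congr EFin.
  by field; rewrite gt_eqF.
rewrite (_ : [set z | _] = [set z : R * R | 0 < z.1] `&` [set z : R * R | z.1 ^+ 2 < z.2]); last first.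
  by apply/seteqP; split => z /=; rewrite /P; [move=> /andP[]|move=> [-> ->]].
apply: measurableI; first by apply: measurable_ltr_set.
by apply: measurable_ltr_set => //; exact: measurable_funX.
Qed.

Lemma integral_gauss_moment (s c : R) : 2^-1 <= s -> 0 < c ->
  (\int[mu]_y (`|y| `^ (2 * s - 1) * expR (- (c * y ^+ 2)))%:E = (Gamma s * c `^ (- s))%:E)%E.
Proof.
move=> s2 c0.
have cc : 0 < Num.sqrt c by rewrite sqrtr_gt0.
have ge0 k y : (0 <= (`|y| `^ (2 * s - 1) * expR (- (k * y ^+ 2)))%:E :> \bar R)%E.
  by rewrite lee_fin mulr_ge0 ?powR_ge0 ?expR_ge0.
have := integral_gauss_moment1 s2.
rewrite (ge0_integral_scale cc); [|exact: measurable_gauss_moment|exact: ge0].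
have -> : (\int[mu]_x (`|Num.sqrt c * x| `^ (2 * s - 1) * expR (- (1 * (Num.sqrt c * x) ^+ 2)))%:E =
    (c `^ (s - 2^-1))%:E * \int[mu]_y (`|y| `^ (2 * s - 1) * expR (- (c * y ^+ 2)))%:E)%E.
  rewrite -ge0_integralZl//; last 2 first.
  - exact: measurable_gauss_moment.
  - by rewrite lee_fin powR_ge0.
  apply: eq_integral => y _; rewrite -EFinM; congr EFin.
  rewrite normrM gtr0_norm// powRM ?(ltW cc)// exprMn sqr_sqrtr ?(ltW c0)// mul1r [RHS]mulrA.
  congr (_ * _ * _); rewrite -powR12_sqrt ?(ltW c0)// -powRrM; congr (_ `^ _); by field.
rewrite muleA -EFinM -powR12_sqrt ?(ltW c0)// -powRD ?(gt_eqF c0) ?implybT//.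
rewrite (_ : 2^-1 + (s - 2^-1) = s); last by ring.
move=> h; rewrite [Gamma s * _]mulrC [RHS]EFinM -h muleA -EFinM -powRD ?(gt_eqF c0) ?implybT//.
by rewrite addNr powRr0 mul1e.
Qed.

End gamma.

(** * Laguerre polynomials and the Hille-Hardy identity *)

Section pochhammer.
Context {F : numFieldType}.
Implicit Types (x y A B E : F) (n j : nat).

Definition pochhammer x n : F := \prod_(i < n) (x + i%:R).

Lemma pochhammer0 x : pochhammer x 0 = 1.
Proof. by rewrite /pochhammer big_ord0. Qed.

Lemma pochhammerS x n : pochhammer x n.+1 = pochhammer x n * (x + n%:R).
Proof. by rewrite /pochhammer big_ord_recr. Qed.

Lemma pochhammerSl x n : pochhammer x n.+1 = x * pochhammer (x + 1) n.
Proof.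
rewrite /pochhammer big_ord_recl addr0; congr (_ * _).
by apply: eq_bigr => i _; rewrite /= /bump /= natrD addrA.
Qed.

Lemma pochhammerD x n m : pochhammer x (n + m) = pochhammer x n * pochhammer (x + n%:R) m.
Proof.
elim: m => [|m IH]; first by rewrite addn0 pochhammer0 mulr1.
by rewrite addnS !pochhammerS IH natrD !mulrA addrA.
Qed.

Lemma pochhammer_gt0 x n : 0 < x -> 0 < pochhammer x n.
Proof. by move=> x0; apply: prodr_gt0 => i _; rewrite ltr_wpDr. Qed.

Lemma pochhammer_fact n : pochhammer 1 n = n`!%:R.
Proof.
elim: n => [|n IH]; first by rewrite pochhammer0 fact0.
by rewrite pochhammerS IH factS natrM mulrC -natr1 addrC.
Qed.

(** The terminating balanced 3F2 series at 1 with upper parameters -n, A, B and lower parameter A +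
    B + E, multiplied by its denominators: its evaluation becomes a polynomial identity without side
    conditions. *)
Definition saal n A B E : F :=
  \sum_(j < n.+1) 'C(n, j)%:R * pochhammer A j * pochhammer B j
    * pochhammer (A + B + E + j%:R) (n - j) * pochhammer E (n - j).

(* Telescoping: with t_j the j-th term of saal n A B (E + 1), the difference of the two sides *)
(* is the sum over j of G_j - G_(j + 1) where G_j = j (A + B + E + j) t_j. *)
Lemma saalS n A B E : saal n.+1 A B E = (A + E) * (B + E) * saal n A B (E + 1).
Proof.
pose t j := 'C(n, j)%:R * pochhammer A j * pochhammer B j
    * pochhammer (A + B + E + 1 + j%:R) (n - j) * pochhammer (E + 1) (n - j).
pose u j := 'C(n, j)%:R * pochhammer A j.+1 * pochhammer B j.+1
    * pochhammer (A + B + E + 1 + j%:R) (n - j) * pochhammer E (n - j).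
pose G j := j%:R * (A + B + E + j%:R) * t j.
have tE : saal n A B (E + 1) = \sum_(j < n.+1) t j.
  by apply: eq_bigr => j _; rewrite /t !addrA.
(* Pascal's rule splits each binomial coefficient in two; after a shift of the index, one half
   recombines into multiples of the t_j and the other is the sum of the u_j. *)
have sE : saal n.+1 A B E =
    \sum_(j < n.+1) E * (A + B + E + j%:R) * t j + \sum_(j < n.+1) u j.
  rewrite /saal big_ord_recl /= !bin0 !pochhammer0 !addr0 subn0 !mul1r.
  transitivity (pochhammer (A + B + E) n.+1 * pochhammer E n.+1 +
     (\sum_(j < n.+1) 'C(n, j.+1)%:R * pochhammer A j.+1 * pochhammer B j.+1
       * pochhammer (A + B + E + j.+1%:R) (n - j) * pochhammer E (n - j) + \sum_(j < n.+1) u j)).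
    congr (_ + _); rewrite -big_split /=; apply: eq_bigr => j _.
    rewrite /bump /= add1n binS natrD !mulrDl subSS /u.
    by congr (_ + (_ * pochhammer _ _ * _)); rewrite -natr1; ring.
  rewrite addrA; congr (_ + _).
  rewrite [in LHS]big_ord_recr /= bin_small// !mul0r addr0.
  rewrite [RHS]big_ord_recl /t /= bin0 !pochhammer0 subn0 !addr0 !mul1r; congr (_ + _).
    by rewrite !pochhammerSl; ring.
  apply: eq_bigr => j _; rewrite /bump /= add1n.
  have jn : (n - j = (n - j.+1).+1)%N by rewrite subnSK.
  rewrite jn !pochhammerSl -natr1.
  have -> : A + B + E + 1 + (j%:R + 1) = A + B + E + (j%:R + 1) + 1 by ring.
  by ring.
have key j : (j <= n)%N -> (A + E) * (B + E) * t j = E * (A + B + E + j%:R) * t j + u j + G j.+1 - G j.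
  move=> jn.
  have GS : G j.+1 = (n - j)%:R * (A + j%:R) * (B + j%:R) * ('C(n, j)%:R * pochhammer A j * pochhammer B j
    * pochhammer (A + B + E + 1 + j%:R) (n - j)) * (pochhammer (E + 1) (n - j.+1)).
    rewrite /G /t.
    have := jn; rewrite leq_eqVlt => /predU1P[->|jln].
      by rewrite bin_small// subnn !mul0r mulr0.
    have -> : (n - j = (n - j.+1).+1)%N by rewrite subnSK.
    have hb : j.+1%:R * 'C(n, j.+1)%:R = (n - j.+1).+1%:R * 'C(n, j)%:R :> F.
      by rewrite -!natrM mul_bin_left subnSK.
    rewrite [in RHS](pochhammerSl (A + B + E + 1 + j%:R)) (pochhammerS A) (pochhammerS B).
    have -> : A + B + E + 1 + j.+1%:R = A + B + E + 1 + j%:R + 1 by rewrite -natr1; ring.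
    transitivity ((j.+1%:R * 'C(n, j.+1)%:R) * (A + B + E + j.+1%:R) * (pochhammer A j * (A + j%:R) * (pochhammer B j * (B + j%:R)) * pochhammer (A + B + E + 1 + j%:R + 1) (n - j.+1) * pochhammer (E + 1) (n - j.+1))).
      by ring.
    by rewrite hb -[j.+1%:R]natr1; ring.
  have EE : pochhammer E (n - j) + (n - j)%:R * pochhammer (E + 1) (n - j.+1) = pochhammer (E + 1) (n - j).
    have := jn; rewrite leq_eqVlt => /predU1P[->|jln].
      by rewrite subnn !pochhammer0 mul0r addr0.
    have -> : (n - j = (n - j.+1).+1)%N by rewrite subnSK.
    by rewrite pochhammerSl pochhammerS -natr1; ring.
  rewrite GS /u /G /t !pochhammerS -EE; ring.
rewrite sE tE mulr_sumr -big_split /=.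
transitivity (\sum_(j < n.+1) ((A + E) * (B + E) * t j) - \sum_(j < n.+1) (G j.+1 - G j)).
  rewrite -sumrB; apply: eq_bigr => j _; rewrite key ?(leq_ord j)//; ring.
rewrite -(big_mkord predT (fun j => G j.+1 - G j)) telescope_sumr//.
rewrite /G /t bin_small// mul0r !mul0r mulr0 subr0.
by rewrite subr0.
Qed.

Lemma saalschutz n A B E : saal n A B E = pochhammer (A + E) n * pochhammer (B + E) n.
Proof.
elim: n E => [|n IH] E.
  by rewrite /saal big_ord1 bin0 !pochhammer0 !mulr1.
by rewrite saalS IH !pochhammerSl !addrA; ring.
Qed.

End pochhammer.

(** * The product of two Laguerre polynomials *)

Section laguerre_algebra.
Context {F : numFieldType}.
Implicit Types (x y z nu : F) (m n i j k a b : nat).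

Lemma pochhammer_opp_nat n k : (k <= n)%N ->
  pochhammer (- n%:R : F) k * (n - k)`!%:R = (-1) ^+ k * n`!%:R.
Proof.
elim: k => [|k IH] kn; first by rewrite pochhammer0 expr0 subn0.
rewrite pochhammerS exprS -mulrA -[in RHS]mulrA -IH ?(ltnW kn)//.
by rewrite -[in RHS](subnSK kn) factS natrM subnSK// natrB ?(ltnW kn)//; ring.
Qed.

Lemma pochhammer_opp_nat0 n k : (n < k)%N -> pochhammer (- n%:R : F) k = 0.
Proof.
move=> nk; rewrite -(subnKC nk) addSn -addnS pochhammerD pochhammerSl.
by rewrite addrC subrr mul0r mulr0.
Qed.

Lemma sum_triangle N (f : nat -> nat -> F) :
  \sum_(i < N) \sum_(a < i.+1) f a (i - a)%N = \sum_(a < N) \sum_(b < N - a) f a b.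
Proof.
elim: N => [|N IH]; first by rewrite !big_ord0.
rewrite big_ord_recr /= IH [RHS]big_ord_recr /= subSn// subnn big_ord1.
transitivity (\sum_(i < N) (\sum_(b < N - i) f i b + f i (N - i)%N) + f N 0%N).
  by rewrite big_split /= -addrA; congr (_ + _); rewrite big_ord_recr /= subnn.
congr (_ + _); apply: eq_bigr => a _.
by rewrite subSn ?(ltnW (ltn_ord a))// big_ord_recr.
Qed.

(** The generalized binomial coefficient of [laguerre] is rewritten as a Pochhammer symbol over a
    factorial; [laguerreE] identifies the two polynomials. *)
Definition laguerre_coef nu m j : F :=
  (-1) ^+ j * pochhammer (nu + 1 + j%:R) (m - j) / ((m - j)`!%:R * j`!%:R).

Definition laguerre_val nu m x : F := \sum_(j < m.+1) laguerre_coef nu m j * x ^+ j.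

Lemma factr_neq0 n : n`!%:R != 0 :> F.
Proof. by rewrite pnatr_eq0 -lt0n fact_gt0. Qed.

Lemma laguerre_valD nu m x y : laguerre_val nu m (x + y) =
  \sum_(a < m.+1) \sum_(b < m.+1 - a)
    laguerre_coef nu m (a + b) * (a + b)`!%:R / (a`!%:R * b`!%:R) * x ^+ a * y ^+ b.
Proof.
rewrite -(@sum_triangle _ (fun a b => laguerre_coef nu m (a + b) * (a + b)`!%:R / (a`!%:R * b`!%:R) * x ^+ a * y ^+ b)).
apply: eq_bigr => i _; rewrite addrC exprDn mulr_sumr; apply: eq_bigr => a _.
have ai : (a <= i)%N by rewrite -ltnS.
rewrite subnKC// -mulr_natr.
have -> : 'C(i, a)%:R = i`!%:R / (a`!%:R * (i - a)`!%:R) :> F.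
  by rewrite -(bin_fact ai) !natrM mulfK// mulf_neq0 ?factr_neq0.
ring.
Qed.

(** A prefactor that does not involve j, times the j-th term of [saal a (- b) (m + nu + 1) (b - m)].
    It is the share of the j-th summand of [laguerre_valM] in the coefficient of x^a y^b. *)
Definition saal_term nu m (a b j : nat) : F :=
  (-1) ^+ b * pochhammer (nu + 1 + b%:R) (m - b)
    / (pochhammer (nu + 1 + b%:R) a * pochhammer (nu + 1) a * a`!%:R * (m - b)`!%:R * b`!%:R)
  * ('C(a, j)%:R * pochhammer (- b%:R) j * pochhammer (m%:R + nu + 1) j
     * pochhammer (nu + 1 + j%:R) (a - j) * pochhammer (b%:R - m%:R) (a - j)).

Lemma laguerre_coefM nu m a b : 0 < nu + 1 -> (a <= m)%N -> (b <= m)%N ->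
  m`!%:R / pochhammer (nu + 1) m * (laguerre_coef nu m a * laguerre_coef nu m b) =
  \sum_(j < a.+1) saal_term nu m a b j.
Proof.
move=> nu0 am bm; rewrite -mulr_sumr.
have := saalschutz a (- b%:R) (m%:R + nu + 1) (b%:R - m%:R).
rewrite /saal.
have -> : - b%:R + (m%:R + nu + 1) + (b%:R - m%:R) = nu + 1 by ring.
move=> ->.
have -> : - b%:R + (b%:R - m%:R) = - m%:R :> F by ring.
have -> : m%:R + nu + 1 + (b%:R - m%:R) = nu + 1 + b%:R :> F by ring.
have pp c k : pochhammer (nu + 1 + c%:R) k != 0.
  by rewrite gt_eqF// pochhammer_gt0// ltr_wpDr.
have p1 k : pochhammer (nu + 1) k != 0 by rewrite gt_eqF// pochhammer_gt0.
have hm := pochhammer_opp_nat am.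
have -> : pochhammer (nu + 1) m = pochhammer (nu + 1) a * pochhammer (nu + 1 + a%:R) (m - a).
  by rewrite -pochhammerD subnKC.
have -> : pochhammer (- m%:R) a = (-1) ^+ a * m`!%:R / (m - a)`!%:R :> F.
  by rewrite -hm mulfK// factr_neq0.
rewrite /laguerre_coef; field.
by rewrite !pp !p1 !factr_neq0.
Qed.

(** Once (x y)^j is factored out, the Saalschuetz term is, up to 1 / (j! (nu + 1)_j), the
    coefficient of x^a y^b in the Laguerre polynomial of degree m - j and order nu + 2j at x + y, as
    given by [laguerre_valD]. *)
Lemma saal_term_shift nu m j a b : 0 < nu + 1 -> (j + a + b <= m)%N ->
  saal_term nu m (j + a) (j + b) j =
  (j`!%:R * pochhammer (nu + 1) j)^-1 * (laguerre_coef (nu + j.*2%:R) (m - j) (a + b) * (a + b)`!%:R / (a`!%:R * b`!%:R)).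
Proof.
move=> nu0 jabm; rewrite /saal_term /laguerre_coef.
set s := (m - (j + a + b))%N.
have pp c k : pochhammer (nu + 1 + c%:R) k != 0.
  by rewrite gt_eqF// pochhammer_gt0// ltr_wpDr.
have p1 k : pochhammer (nu + 1) k != 0 by rewrite gt_eqF// pochhammer_gt0.
have -> : (m - j - (a + b) = s)%N by rewrite /s; lia.
have -> : (j + a - j = a)%N by lia.
have -> : ((j + b)%:R - m%:R = - (m - (j + b))%:R :> F) by rewrite natrB ?opprB//; lia.
have h1 : pochhammer (- (m - (j + b))%:R : F) a = (-1) ^+ a * (m - (j + b))`!%:R / s`!%:R.
  rewrite -(@pochhammer_opp_nat (m - (j + b)) a); last by lia.
  have -> : (m - (j + b) - a = s)%N by rewrite /s; lia.
  by rewrite mulfK// factr_neq0.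
have h2 : pochhammer (- (j + b)%:R : F) j = (-1) ^+ j * (j + b)`!%:R / b`!%:R.
  rewrite -(@pochhammer_opp_nat (j + b) j); last by lia.
  have -> : (j + b - j = b)%N by lia.
  by rewrite mulfK// factr_neq0.
have h3 : 'C(j + a, j)%:R = (j + a)`!%:R / (j`!%:R * a`!%:R) :> F.
  have ja : (j <= j + a)%N by lia.
  rewrite -(bin_fact ja) (_ : (j + a - j = a)%N); last by lia.
  by rewrite !natrM mulfK// mulf_neq0 ?factr_neq0.
have h4 : pochhammer (nu + 1 + (j + b)%:R) (m - (j + b)) * pochhammer (m%:R + nu + 1) j =
    pochhammer (nu + 1 + (j + b)%:R) (j + a) * pochhammer (nu + j.*2%:R + 1 + (a + b)%:R) s.
  have -> : m%:R + nu + 1 = nu + 1 + (j + b)%:R + (m - (j + b))%:R :> F.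
    by rewrite natrB; [ring|lia].
  have -> : nu + j.*2%:R + 1 + (a + b)%:R = nu + 1 + (j + b)%:R + (j + a)%:R :> F.
    by rewrite -addnn !natrD; ring.
  by rewrite -!pochhammerD; congr pochhammer; rewrite /s; lia.
have h5 : pochhammer (nu + 1) (j + a) = pochhammer (nu + 1) j * pochhammer (nu + 1 + j%:R) a.
  by rewrite pochhammerD.
rewrite h1 h2 h3 h5 !exprD.
transitivity ((pochhammer (nu + 1 + (j + b)%:R) (m - (j + b)) * pochhammer (m%:R + nu + 1) j) *
  ((-1) ^+ j * (-1) ^+ b * (-1) ^+ a * (-1) ^+ j / (pochhammer (nu + 1 + (j + b)%:R) (j + a) * pochhammer (nu + 1) j * (j`!%:R * a`!%:R * b`!%:R * s`!%:R)))).
  by field; rewrite !pp !p1 !factr_neq0.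
rewrite h4.
have sg : (-1) ^+ j * (-1) ^+ j = 1 :> F by rewrite -expr2 sqrr_sign.
transitivity (((-1) ^+ j * (-1) ^+ j) * (-1) ^+ a * (-1) ^+ b * pochhammer (nu + j.*2%:R + 1 + (a + b)%:R) s / (pochhammer (nu + 1) j * (j`!%:R * a`!%:R * b`!%:R * s`!%:R))).
  by field; rewrite !pp !p1 !factr_neq0.
by rewrite sg mul1r; field; rewrite !p1 !factr_neq0.
Qed.

(** The Pochhammer symbol of -n vanishes beyond length n. This trims the square of pairs (a, b) to
    the range of [saal_term_shift]. *)
Lemma saal_term_eq0 nu m j a b : (j <= a)%N -> (a <= m)%N -> (b <= m)%N -> (b < j)%N || (m < a + b - j)%N ->
  saal_term nu m a b j = 0.
Proof.
move=> ja am bm /orP[bj|h]; rewrite /saal_term.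
  by rewrite (pochhammer_opp_nat0 bj) mulr0 !mul0r mulr0.
have -> : (b%:R - m%:R = - (m - b)%:R :> F) by rewrite natrB ?opprB//.
by rewrite [X in _ * X]mulrC (@pochhammer_opp_nat0 (m - b) (a - j)) ?mul0r ?mulr0//; lia.
Qed.

(* Comparing the coefficients of x^a y^b on the two sides gives the Pfaff-Saalschuetz sum. *)
Lemma laguerre_valM nu m x y : 0 < nu + 1 ->
  m`!%:R / pochhammer (nu + 1) m * (laguerre_val nu m x * laguerre_val nu m y) =
  \sum_(j < m.+1) (x * y) ^+ j / (j`!%:R * pochhammer (nu + 1) j) * laguerre_val (nu + j.*2%:R) (m - j) (x + y).
Proof.
move=> nu0.
transitivity (\sum_(a < m.+1) \sum_(j < a.+1) \sum_(b < m.+1) saal_term nu m a b j * x ^+ a * y ^+ b).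
  rewrite /laguerre_val mulr_suml mulr_sumr; apply: eq_bigr => a _.
  rewrite exchange_big /= !mulr_sumr; apply: eq_bigr => b _.
  rewrite -!mulr_suml -(laguerre_coefM nu0 (leq_ord a) (leq_ord b)); ring.
pose f j a := \sum_(b < m.+1) saal_term nu m (j + a) b j * x ^+ (j + a) * y ^+ b.
transitivity (\sum_(i < m.+1) \sum_(j < i.+1) f j (i - j)%N).
  by apply: eq_bigr => i _; apply: eq_bigr => j _; rewrite /f subnKC// -ltnS.
rewrite sum_triangle; apply: eq_bigr => -[j /= jm] _.
rewrite laguerre_valD mulr_sumr -subSn//; apply: eq_bigr => -[a /= ajm] _.
rewrite /f mulr_sumr.
rewrite -(big_mkord predT (fun b => saal_term nu m (j + a) b j * x ^+ (j + a) * y ^+ b)).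
rewrite (@big_cat_nat _ _ _ j)//=; last by lia.
rewrite [X in X + _]big_nat_cond big1 ?add0r; last first.
  by move=> b /andP[/andP[_ bj] _]; rewrite saal_term_eq0 ?mul0r//; lia.
rewrite (@big_cat_nat _ _ _ (m.+1 - a))//=; [|lia|lia].
rewrite [X in _ + X]big_nat_cond [X in _ + X]big1 ?addr0; last first.
  by move=> b /andP[/andP[b1 b2] _]; rewrite saal_term_eq0 ?mul0r//; lia.
rewrite -{1}[j]add0n big_addn.
rewrite (_ : (m.+1 - a - j = m.+1 - j - a)%N); last by lia.
rewrite big_mkord; apply: eq_bigr => -[b /= bjm] _.
rewrite [(b + j)%N]addnC saal_term_shift//; last by lia.
by rewrite exprMn !exprD; ring.
Qed.

End laguerre_algebra.

(** * Diagonal summation of double series *)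

Section diagonal_sum.
Context {R : realType}.
Implicit Types (b : nat -> nat -> R) (S B : nat -> R).

Lemma eq_cvgn (u v : R ^nat) (l : R) : u =1 v -> u n @[n --> \oo] --> l -> v n @[n --> \oo] --> l.
Proof. by move=> uv; rewrite (_ : u = v)//; apply/funext. Qed.

Lemma cvg_seriesZ (c : R) (u : R ^nat) (l : R) :
  series u n @[n --> \oo] --> l -> series (fun n => c * u n) n @[n --> \oo] --> c * l.
Proof.
move=> ul; apply: (@eq_cvgn (fun n => c * series u n)) => [n|].
  by rewrite /series /= mulr_sumr.
exact: cvgMl_tmp.
Qed.

(** The sum over the first N diagonals is the N-th partial sum of S plus the row errors r N j for j
    < N. Each error tends to 0 as N grows and is at most 2 B_j, so dominated convergence for series
    applies. *)
Lemma diag_sum b S B :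
  (forall j, series (b j) n @[n --> \oo] --> S j) ->
  (forall j n, \sum_(i < n) `|b j i| <= B j) ->
  cvgn (series B) ->
  [/\ cvgn (series S),
      series (fun m => \sum_(j < m.+1) b j (m - j)%N) n @[n --> \oo] --> limn (series S) &
      forall N, \sum_(m < N) `|\sum_(j < m.+1) b j (m - j)%N| <= limn (series B)].
Proof.
move=> bS bB cB.
have B0 j : 0 <= B j by apply: le_trans (bB j 0%N); rewrite big_ord0.
have ndB : nondecreasing_seq (series B).
  by apply/nondecreasing_seqP => n; rewrite /series /= big_nat_recr//= lerDl.
have serB n : series B n <= limn (series B) by apply: nondecreasing_cvgn_le.
have SB j : `|S j| <= B j.
  have hn : `|series (b j) n| @[n --> \oo] --> `|S j| by apply: cvg_norm; exact: bS.
rewrite -(cvg_lim _ hn)//.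
  apply: limr_le; first by apply/cvg_ex; exists `|S j|; exact: cvg_norm.
  near=> n; rewrite /series /= big_mkord; apply: le_trans (bB j n).
  exact: ler_norm_sum.
have cS : cvgn (series S).
  apply: normed_cvg; apply: (series_le_cvg _ _ SB cB) => //.
split => //; last first.
  move=> N; apply: (@le_trans _ _ (\sum_(m < N) \sum_(j < m.+1) `|b j (m - j)%N|)).
    by apply: ler_sum => m _; exact: ler_norm_sum.
  rewrite (sum_triangle N (fun j i => `|b j i|)).
  apply: le_trans (serB N); rewrite /series /= big_mkord.
  by apply: ler_sum => j _; exact: bB.
pose r N j := \sum_(i < N - j) b j i - S j.
have rB N j : `|r N j| <= 2 * B j.
  rewrite mulr_natl mulr2n; apply: le_trans (ler_normB _ _) _.
  by rewrite lerD//; apply: le_trans (ler_norm_sum _ _ _) _.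
have r0 j : r N j @[N --> \oo] --> 0.
  rewrite -(subrr (S j)); apply: cvgB; last exact: cvg_cst.
  rewrite -(cvg_shiftn j).
  by under eq_fun do rewrite addnK -(big_mkord predT (b j)); exact: bS.
have h N : series (fun m => \sum_(j < m.+1) b j (m - j)%N) N = series S N + \sum_(0 <= j < N) r N j.
  rewrite /series /= !big_mkord (sum_triangle N b) -big_split /=.
  by apply: eq_bigr => j _; rewrite addrC subrK.
have -> : series (fun m => \sum_(j < m.+1) b j (m - j)%N) =
    (fun N => series S N + \sum_(0 <= j < N) r N j) by apply/funext.
rewrite -[X in _ --> X]addr0; apply: cvgD; first exact: cS.
apply/cvgr0Pnorm_le => e e0.
(* The rows from J on contribute at most twice the tail of B, that is e / 2; the finitely many rows
   below J supply the other half. *)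
have e4 : 0 < e / 4 by rewrite divr_gt0.
have /cvgrPdist_le /(_ _ e4) [J _ HJ] := cB.
have fin0 : \sum_(0 <= j < J) `|r N j| @[N --> \oo] --> 0.
  elim: (J) => [|k IH].
    by apply: (@eq_cvgn (fun=> 0)) => [n|]; [rewrite big_geq|exact: cvg_cst].
  apply: (@eq_cvgn (fun N => \sum_(0 <= j < k) `|r N j| + `|r N k|)) => [n|].
    by rewrite big_nat_recr.
  rewrite -[X in _ --> X]addr0; apply: cvgD => //.
  by rewrite -(@normr0 R R); apply: cvg_norm.
have e2 : 0 < e / 2 by rewrite divr_gt0.
move/cvgr0Pnorm_le : fin0 => /(_ _ e2) hfin.
near=> N.
have JN : (J <= N)%N by near: N; exists J.
rewrite (@big_cat_nat _ _ _ J)//=.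
apply: le_trans (ler_normD _ _) _; rewrite [leRHS]splitr; apply: lerD.
  apply: le_trans (ler_norm_sum _ _ _) _.
  apply: le_trans (ler_norm _) _; near: N; exact: hfin.
apply: le_trans (ler_norm_sum _ _ _) _.
apply: (@le_trans _ _ (\sum_(J <= j < N) 2 * B j)); first by apply: ler_sum => j _; exact: rB.
rewrite -mulr_sumr -ler_pdivlMl//.
have -> : \sum_(J <= j < N) B j = series B N - series B J.
  by rewrite /series /= [X in _ = X - _](@big_cat_nat _ _ _ J)//= addrAC subrr add0r.
have := HJ J (leqnn J); have := serB N.
rewrite ger0_norm ?subr_ge0//; lra.
Unshelve. all: by end_near. Qed.

End diagonal_sum.

(** * Generating functions and the Hille-Hardy identity *)

Section generating_function.
Context {R : realType}.
Local Notation mu := (@lebesgue_measure R).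

Lemma cvg_series_nneseries (u : R ^nat) (l : R) : (forall n, 0 <= u n) ->
  series u n @[n --> \oo] --> l <-> (\sum_(n <oo) (u n)%:E = l%:E)%E.
Proof.
move=> u0; have cu : cvgn (fun n => \sum_(0 <= i < n) (u i)%:E)%E.
  by apply: is_cvg_nneseries => n _ _; rewrite lee_fin.
split => [ul|h].
  apply/cvg_lim => //; rewrite (_ : (fun n => _) = EFin \o series u); last first.
    by apply/funext => n /=; rewrite sumEFin.
  by apply: cvg_EFin => //; exact: nearW.
have : (fun n => \sum_(0 <= i < n) (u i)%:E)%E @ \oo --> l%:E by rewrite -h.
move/fine_cvgP => [_]; apply: eq_cvgn => n /=.
by rewrite sumEFin.
Qed.

Lemma expR_nneseries (x : R) : 0 <= x -> (\sum_(n <oo) (x ^+ n / n`!%:R)%:E = (expR x)%:E)%E.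
Proof.
move=> x0; apply/cvg_series_nneseries; last exact: is_cvg_series_exp_coeff.
by move=> n; rewrite divr_ge0// exprn_ge0.
Qed.

Lemma Gamma_pochhammer (b : R) n : 0 < b -> Gamma (b + n%:R) = Gamma b * pochhammer b n.
Proof.
move=> b0; elim: n => [|n IH]; first by rewrite addr0 pochhammer0 mulr1.
by rewrite pochhammerS -natr1 addrA GammaS ?ltr_wpDr// IH [LHS]mulrC mulrA.
Qed.

(** Expand e^(rt) in the Gamma integral of t^(b-1) e^(-(1-r)t), which equals Gamma(b) (1-r)^(-b),
    and integrate term by term; all the terms are nonnegative. *)
Lemma binomial_series (b r : R) : 0 < b -> 0 <= r < 1 ->
  series (fun n => pochhammer b n / n`!%:R * r ^+ n) n @[n --> \oo] --> (1 - r) `^ (- b).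
Proof.
move=> b0 /andP[r0 r1].
have t0 n : 0 <= pochhammer b n / n`!%:R * r ^+ n.
  by rewrite mulr_ge0 ?exprn_ge0// divr_ge0// ltW// pochhammer_gt0.
apply/cvg_series_nneseries => //.
have G0 := Gamma_gt0 b0.
have := @integral_gamma_scale _ b (1 - r) b0; rewrite subr_gt0 => /(_ r1).
have -> : (\int[mu]_(t in `]0%R, +oo[) (t `^ (b - 1) * expR (- ((1 - r) * t)))%:E =
   \int[mu]_(t in `]0%R, +oo[) \sum_(n <oo) (r ^+ n / n`!%:R * (t `^ (b + n%:R - 1) * expR (- t)))%:E)%E.
  apply: eq_integral => t; rewrite inE/= in_itv/= andbT => t0'.
  transitivity ((t `^ (b - 1) * expR (- t))%:E * \sum_(n <oo) ((r * t) ^+ n / n`!%:R)%:E)%E.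
    rewrite expR_nneseries ?mulr_ge0// ?(ltW t0')// -EFinM -mulrA -expRD; congr (_ * expR _)%:E; ring.
  rewrite -nneseriesZl//; last by move=> n _; rewrite lee_fin divr_ge0// exprn_ge0// mulr_ge0// ltW.
  apply: eq_eseriesr => n _; rewrite -EFinM; congr EFin.
  have -> : b + n%:R - 1 = b - 1 + n%:R by ring.
  rewrite (@powRD _ t (b - 1) n%:R) ?(gt_eqF t0') ?implybT// powR_mulrn ?(ltW t0')// exprMn; ring.
rewrite integral_nneseries//; last 2 first.
- move=> n; apply/measurable_EFinP; apply: measurable_funM => //.
  exact: measurable_fun_gamma.
- by move=> n t _; rewrite lee_fin !mulr_ge0 ?invr_ge0 ?exprn_ge0 ?powR_ge0 ?expR_ge0.
have -> : (\sum_(n <oo) \int[mu]_(t in `]0%R, +oo[) (r ^+ n / n`!%:R * (t `^ (b + n%:R - 1) * expR (- t)))%:E =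
  \sum_(n <oo) ((Gamma b)%:E * (pochhammer b n / n`!%:R * r ^+ n)%:E))%E.
  apply: eq_eseriesr => n _; under eq_integral do rewrite EFinM.
  rewrite ge0_integralZl//; last 3 first.
  - by apply/measurable_EFinP; exact: measurable_fun_gamma.
  - by move=> t _; rewrite lee_fin mulr_ge0 ?powR_ge0 ?expR_ge0.
  - by rewrite lee_fin divr_ge0// exprn_ge0.
  rewrite integral_gammaE ?ltr_wpDr// Gamma_pochhammer// -!EFinM; congr EFin; ring.
rewrite nneseriesZl//; last by move=> n _; rewrite lee_fin.
move/(congr1 (fun z => (Gamma b)^-1%:E * z)%E).
by rewrite muleA -!EFinM mulrA mulVf ?gt_eqF// mul1r mul1e.
Qed.

Lemma sum_le_lim (u : R ^nat) (l : R) : (forall n, 0 <= u n) ->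
  series u n @[n --> \oo] --> l -> forall n, \sum_(i < n) u i <= l.
Proof.
move=> u0 ul n; rewrite -(cvg_lim _ ul)// -(big_mkord predT u).
apply: (nondecreasing_cvgn_le _ (cvgP _ ul) n).
by apply/nondecreasing_seqP => k; rewrite /series /= big_nat_recr//= lerDl.
Qed.

(** The series is a diagonal sum: collecting the power z^j leaves a binomial series with sum
    (1-r)^(-(a+1+j)), and the sum over j is exponential. The absolute bound, obtained with |z| in
    place of -z, provides the domination for [hille_hardy]. *)
Lemma laguerre_generating (a z r : R) : 0 < a + 1 -> 0 <= r < 1 ->
  series (fun m => laguerre_val a m z * r ^+ m) n @[n --> \oo] -->
    (1 - r) `^ (- (a + 1)) * expR (- (z * (r / (1 - r)))) /\
  forall N, \sum_(m < N) `|laguerre_val a m z * r ^+ m| <=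
    (1 - r) `^ (- (a + 1)) * expR (`|z| * (r / (1 - r))).
Proof.
move=> a0 /andP[r0 r1]; have r01 : 0 <= r < 1 by rewrite r0.
have rp : 0 < 1 - r by rewrite subr_gt0.
pose b j n := ((- z) ^+ j / j`!%:R * r ^+ j) * (pochhammer (a + 1 + j%:R) n / n`!%:R * r ^+ n).
pose S w j := (1 - r) `^ (- (a + 1)) * exp_coeff (w * (r / (1 - r))) j.
have SE w j : (w ^+ j / j`!%:R * r ^+ j) * (1 - r) `^ (- (a + 1 + j%:R)) = S w j.
  rewrite /S /exp_coeff /= opprD powRD ?(gt_eqF rp) ?implybT//.
  rewrite powR_invn ?(ltW rp)// exprMn expr_div_n; field.
  by rewrite factr_neq0 expf_neq0// gt_eqF.
have pj j : 0 < a + 1 + j%:R by rewrite ltr_wpDr.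
have bS j : series (b j) n @[n --> \oo] --> S (- z) j.
  by rewrite -SE; apply: cvg_seriesZ; exact: binomial_series.
have cS w : series (S w) n @[n --> \oo] --> (1 - r) `^ (- (a + 1)) * expR (w * (r / (1 - r))).
  by apply: cvg_seriesZ; exact: is_cvg_series_exp_coeff.
have bB j n : \sum_(i < n) `|b j i| <= S `|z| j.
  rewrite -SE; under eq_bigr do rewrite normrM.
  rewrite -mulr_sumr !normrM normrX normrN normfV (ger0_norm (exprn_ge0 j r0)) (ger0_norm (ler0n _ _)).
  rewrite ler_wpM2l//; first by rewrite mulr_ge0 ?exprn_ge0// divr_ge0// exprn_ge0.
  have t0 i : 0 <= pochhammer (a + 1 + j%:R) i / i`!%:R * r ^+ i.
    by rewrite mulr_ge0 ?exprn_ge0// divr_ge0// ltW// pochhammer_gt0.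
  under eq_bigr do rewrite ger0_norm//.
  exact: (sum_le_lim t0 (binomial_series (pj j) r01)).
have [_ h1 h2] := diag_sum bS bB (cvgP _ (cS _)).
have E m : \sum_(j < m.+1) b j (m - j)%N = laguerre_val a m z * r ^+ m.
  rewrite /laguerre_val mulr_suml; apply: eq_bigr => -[j /= jm] _.
  rewrite /b /laguerre_coef.
  have -> : r ^+ m = r ^+ j * r ^+ (m - j) by rewrite -exprD subnKC.
  rewrite (exprNn z); field.
  by rewrite !factr_neq0.
split.
  rewrite -mulNr -(cvg_lim _ (cS _))//; apply: eq_cvgn h1 => n.
  by apply: eq_bigr => i _; rewrite E.
by move=> N; rewrite -(cvg_lim _ (cS _))//; under eq_bigr do rewrite -E; exact: h2.
Qed.

Definition bessel_coef (nu z : R) (j : nat) : R := z ^+ j / (j`!%:R * pochhammer (nu + 1) j).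

(** For z > 0 this is Gamma(nu+1) z^(-nu/2) I_nu(2 sqrt z), with I_nu the modified Bessel function;
    in this normalization it is an entire series in z. *)
Definition bessel (nu z : R) : R := limn (series (bessel_coef nu z)).

Lemma pochhammer_ge_half (nu : R) j : - 2^-1 <= nu -> 2^-1 <= pochhammer (nu + 1) j.
Proof.
move=> nu2; elim: j => [|[|j] IH]; first by rewrite pochhammer0; lra.
  by rewrite pochhammerS pochhammer0 addr0; lra.
rewrite pochhammerS; apply: le_trans IH _.
rewrite ler_peMr ?ltW// ?pochhammer_gt0//; first by lra.
by rewrite -natr1; have : 0 <= j%:R :> R by []; lra.
Qed.

Lemma bessel_coef_ge0 (nu z : R) j : - 2^-1 <= nu -> 0 <= z -> 0 <= bessel_coef nu z j.
Proof.
move=> nu2 z0; rewrite /bessel_coef divr_ge0 ?exprn_ge0// mulr_ge0// ltW//.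
by apply: pochhammer_gt0; lra.
Qed.

Lemma cvg_bessel (nu z : R) : - 2^-1 <= nu -> 0 <= z ->
  series (bessel_coef nu z) n @[n --> \oo] --> bessel nu z.
Proof.
move=> nu2 z0; have c : cvgn (series (fun j => 2 * exp_coeff z j)).
  apply/cvg_ex; exists (2 * expR z).
  by apply: cvg_seriesZ; exact: is_cvg_series_exp_coeff.
apply: (series_le_cvg _ _ _ c) => j; first exact: bessel_coef_ge0.
  by rewrite mulr_ge0// divr_ge0// exprn_ge0.
have h := pochhammer_ge_half j nu2.
apply: (@le_trans _ _ ((pochhammer (nu + 1) j)^-1 * (z ^+ j / j`!%:R))).
  by rewrite /bessel_coef invfM mulrA mulrC.
rewrite ler_wpM2r ?divr_ge0 ?exprn_ge0//.
rewrite -[leRHS]invrK lef_pV2 ?posrE//; lra.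
Qed.

Lemma bessel_ge0 (nu z : R) : - 2^-1 <= nu -> 0 <= z -> 0 <= bessel nu z.
Proof.
move=> nu2 z0; apply: (le_trans _ (sum_le_lim _ (cvg_bessel nu2 z0) 0)) => [|j].
  by rewrite big_ord0.
exact: bessel_coef_ge0.
Qed.

(** By [laguerre_valM] the m-th term is a sum over j <= m, that is, a diagonal of a double series.
    Its j-th row is the generating function of order nu + 2j at x + y, and the additional factors
    (1-r)^(-2j) turn the sum over j into the series of [bessel]. *)
Lemma hille_hardy (nu x y r : R) : - 2^-1 <= nu -> 0 <= x -> 0 <= y -> 0 <= r < 1 ->
  let a m := m`!%:R / pochhammer (nu + 1) m * (laguerre_val nu m x * laguerre_val nu m y) * r ^+ m in
  series a n @[n --> \oo] -->
    (1 - r) `^ (- (nu + 1)) * expR (- ((x + y) * (r / (1 - r)))) * bessel nu (x * y * r / (1 - r) ^+ 2) /\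
  cvgn (series (fun m => `|a m|)).
Proof.
move=> nu2 x0 y0 /andP[r0 r1] a; have r01 : 0 <= r < 1 by rewrite r0.
have rp : 0 < 1 - r by rewrite subr_gt0.
have nu0 : 0 < nu + 1 by lra.
pose c j := (x * y * r) ^+ j / (j`!%:R * pochhammer (nu + 1) j).
have c0 j : 0 <= c j.
  by rewrite /c divr_ge0// ?exprn_ge0 ?mulr_ge0// ltW// pochhammer_gt0.
pose b j n := c j * (laguerre_val (nu + j.*2%:R) n (x + y) * r ^+ n).
pose w := x * y * r / (1 - r) ^+ 2.
have w0 : 0 <= w by rewrite divr_ge0 ?mulr_ge0 ?exprn_ge0// ltW.
pose S e j := (1 - r) `^ (- (nu + 1)) * e * bessel_coef nu w j.
have SE e j : c j * ((1 - r) `^ (- (nu + j.*2%:R + 1)) * e) = S e j.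
  rewrite /S /bessel_coef /c /w.
  have -> : - (nu + j.*2%:R + 1) = - (nu + 1) + - j.*2%:R by ring.
  rewrite powRD ?(gt_eqF rp) ?implybT// powR_invn ?(ltW rp)// -mul2n exprM.
  by rewrite [in RHS]expr_div_n; ring.
have nuj j : 0 < nu + j.*2%:R + 1 by rewrite addrAC ltr_wpDr.
have cS e : series (S e) n @[n --> \oo] --> (1 - r) `^ (- (nu + 1)) * e * bessel nu w.
  by apply: cvg_seriesZ; exact: cvg_bessel.
have bS j : series (b j) n @[n --> \oo] --> S (expR (- ((x + y) * (r / (1 - r))))) j.
  have [h _] := laguerre_generating (x + y) (nuj j) r01.
  by rewrite -SE; exact: cvg_seriesZ.
have bB j n : \sum_(i < n) `|b j i| <= S (expR (`|x + y| * (r / (1 - r)))) j.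
  have [_ h] := laguerre_generating (x + y) (nuj j) r01.
  rewrite -SE; under eq_bigr do rewrite normrM (ger0_norm (c0 _)).
  by rewrite -mulr_sumr ler_wpM2l.
have [_ h1 h2] := diag_sum bS bB (cvgP _ (cS _)).
have E m : \sum_(j < m.+1) b j (m - j)%N = a m.
  rewrite /a laguerre_valM// mulr_suml; apply: eq_bigr => -[j /= jm] _.
  rewrite /b /c exprMn.
  have -> : r ^+ m = r ^+ j * r ^+ (m - j) by rewrite -exprD subnKC.
  ring.
split.
  rewrite -(cvg_lim _ (cS _))//; apply: eq_cvgn h1 => n.
  by apply: eq_bigr => i _; rewrite E.
apply: nondecreasing_is_cvgn.
  by apply/nondecreasing_seqP => n; rewrite /series /= big_nat_recr//= lerDl.
eexists => _ [N _ <-]; rewrite /series /= big_mkord.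
under eq_bigr do rewrite -E; exact: h2.
Qed.

End generating_function.

(** * The one-dimensional heat kernel *)

Section laguerre_kernel.
Context {R : realType}.
Implicit Types (nu s x y z : R).
Local Notation mu := (@lebesgue_measure R).

Lemma laguerreE nu m x : (laguerre nu m).[x] = laguerre_val nu m x.
Proof.
rewrite /laguerre /laguerre_val horner_poly; apply: eq_bigr => -[j /= jm] _.
congr (_ * _); rewrite /laguerre_coef /gbinom.
have -> : \prod_(i < m - j) (m%:R + nu - i%:R) = pochhammer (nu + 1 + j%:R) (m - j).
  rewrite /pochhammer (reindex_inj rev_ord_inj) /=; apply: eq_bigr => -[i /= ij] _.
  have -> : (m = (m - j - i.+1) + i + j + 1)%N by lia.
  rewrite !natrD.
  have -> : (m - j - i.+1 + i + j + 1 - j - i.+1 = m - j - i.+1)%N by lia.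
  by rewrite -!natr1; ring.
by rewrite invfM !mulrA.
Qed.

(* Both prefactors are written with Pochhammer symbols so that the Hille-Hardy identity applies. *)
Lemma hermite1_evenM nu m x y : - 2^-1 <= nu ->
  hermite1 nu m.*2 x * hermite1 nu m.*2 y = (Gamma (nu + 1))^-1 * expR (- ((x ^+ 2 + y ^+ 2) / 2)) *
    (m`!%:R / pochhammer (nu + 1) m * (laguerre_val nu m (x ^+ 2) * laguerre_val nu m (y ^+ 2))).
Proof.
move=> nu2; rewrite /hermite1 odd_double doubleK !laguerreE.
have n1 : 0 < nu + 1 by lra.
have G0 := Gamma_gt0 n1; have P0 := pochhammer_gt0 m n1.
have -> : m%:R + nu + 1 = nu + 1 + m%:R by ring.
have -> : m%:R + 1 = 1 + m%:R :> R by ring.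
rewrite !Gamma_pochhammer// pochhammer_fact.
have G1 : Gamma 1 = 1 :> R.
  apply: EFin_inj; rewrite -integral_gammaE//.
  have := @integral_expR_tail R 0 (lexx 0); rewrite oppr0 expR0 => <-.
  by apply: eq_integral => t _; rewrite subrr powRr0 mul1r.
rewrite G1 mul1r.
set q := m`!%:R / (Gamma (nu + 1) * _).
have q0 : 0 <= q by rewrite divr_ge0 ?mulr_ge0 ?(ltW G0) ?(ltW P0).
have -> : - ((x ^+ 2 + y ^+ 2) / 2) = - x ^+ 2 / 2 + - y ^+ 2 / 2 by ring.
rewrite expRD.
transitivity (((-1) ^+ m * (-1) ^+ m) * (Num.sqrt q * Num.sqrt q) * (expR (- x ^+ 2 / 2) * expR (- y ^+ 2 / 2)) *
   (laguerre_val nu m (x ^+ 2) * laguerre_val nu m (y ^+ 2))); first by ring.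
rewrite -!expr2 sqrr_sign sqr_sqrtr// /q; field.
by rewrite !gt_eqF.
Qed.

Lemma hermite1_oddM nu m x y : - 2^-1 <= nu ->
  hermite1 nu m.*2.+1 x * hermite1 nu m.*2.+1 y = (Gamma (nu + 1))^-1 * expR (- ((x ^+ 2 + y ^+ 2) / 2)) * (x * y / (nu + 1)) *
    (m`!%:R / pochhammer (nu + 1 + 1) m * (laguerre_val (nu + 1) m (x ^+ 2) * laguerre_val (nu + 1) m (y ^+ 2))).
Proof.
move=> nu2; rewrite /hermite1 /= odd_double uphalf_double /= !laguerreE.
have n1 : 0 < nu + 1 by lra.
have n2 : 0 < nu + 1 + 1 by lra.
have G0 := Gamma_gt0 n1; have P0 := pochhammer_gt0 m n2.
have -> : m%:R + nu + 2 = nu + 1 + 1 + m%:R by ring.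
have -> : m%:R + 1 = 1 + m%:R :> R by ring.
rewrite !Gamma_pochhammer// pochhammer_fact GammaS//.
have G1 : Gamma 1 = 1 :> R.
  apply: EFin_inj; rewrite -integral_gammaE//.
  have := @integral_expR_tail R 0 (lexx 0); rewrite oppr0 expR0 => <-.
  by apply: eq_integral => t _; rewrite subrr powRr0 mul1r.
rewrite G1 mul1r.
set q := m`!%:R / ((nu + 1) * Gamma (nu + 1) * _).
have q0 : 0 <= q by rewrite divr_ge0 ?mulr_ge0 ?(ltW G0) ?(ltW P0) ?(ltW n1).
have -> : - ((x ^+ 2 + y ^+ 2) / 2) = - x ^+ 2 / 2 + - y ^+ 2 / 2 by ring.
rewrite expRD.
transitivity (((-1) ^+ m * (-1) ^+ m) * (Num.sqrt q * Num.sqrt q) * (expR (- x ^+ 2 / 2) * expR (- y ^+ 2 / 2)) *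
   (x * y) * (laguerre_val (nu + 1) m (x ^+ 2) * laguerre_val (nu + 1) m (y ^+ 2))); first by ring.
rewrite -!expr2 sqrr_sign sqr_sqrtr// /q; field.
by rewrite !gt_eqF.
Qed.

(** With s = exp(-2t) this is coth(2t) / 2, the Gaussian rate of Mehler's formula. *)
Definition gauss_rate s : R := (1 + s ^+ 2) / (2 * (1 - s ^+ 2)).

(* In closed form, the even part of the one-dimensional heat kernel at time t, with s = exp (- 2 t). *)
Definition laguerre_kernel nu s x y : R :=
  (s / (1 - s ^+ 2)) `^ (nu + 1) / Gamma (nu + 1) * expR (- (gauss_rate s * (x ^+ 2 + y ^+ 2)))
    * bessel nu (x ^+ 2 * y ^+ 2 * s ^+ 2 / (1 - s ^+ 2) ^+ 2).

Lemma sum_even_odd (f : R ^nat) n :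
  \sum_(i < n.*2) f i = \sum_(m < n) (f m.*2 + f m.*2.+1).
Proof.
elim: n => [|n IH]; first by rewrite !big_ord0.
by rewrite doubleS !big_ord_recr /= IH addrA.
Qed.

(** A comparison term by term: the j-th term on the left is at most (nu + 1) times the j-th term of
    [bessel nu] plus half the next one. This amounts to z <= nu + 1 + j + z^2 / (2(j+1)), which
    holds by the arithmetic-geometric inequality because (j+1)/2 <= nu + 1 + j. The factor 3/2 is 1
    + 1/2. *)
Lemma sqrt_bessel_le nu z : - 2^-1 <= nu -> 0 <= z ->
  z * bessel (nu + 1) (z ^+ 2) <= 3 / 2 * (nu + 1) * bessel nu (z ^+ 2).
Proof.
move=> nu2 z0; have n1 : 0 < nu + 1 by lra.
have nu3 : - 2^-1 <= nu + 1 by lra.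
have zz : 0 <= z ^+ 2 by rewrite exprn_ge0.
have h := cvg_seriesZ (c := z) (cvg_bessel nu3 zz).
rewrite -(cvg_lim _ h)//; apply: limr_le; first by apply/cvg_ex; eexists; exact: h.
near=> n; rewrite /series /= big_mkord.
have le1 := sum_le_lim (fun j => bessel_coef_ge0 j nu2 zz) (cvg_bessel nu2 zz).
apply: (@le_trans _ _ (\sum_(j < n) (nu + 1) * (bessel_coef nu (z ^+ 2) j + 2^-1 * bessel_coef nu (z ^+ 2) j.+1))).
  apply: ler_sum => -[j /= _] _; rewrite /bessel_coef.
  have -> : pochhammer (nu + 1 + 1) j = pochhammer (nu + 1) j * (nu + 1 + j%:R) / (nu + 1).
    by rewrite -pochhammerS pochhammerSl; field; rewrite gt_eqF.
  have pj := pochhammer_gt0 j n1; have fj : 0 < j`!%:R :> R by rewrite ltr0n fact_gt0.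
  have nj : 0 < nu + 1 + j%:R by rewrite ltr_wpDr.
  rewrite pochhammerS factS natrM [z ^+ 2 ^+ j.+1]exprS -[j.+1%:R]natr1.
  have j0 : 0 <= j%:R :> R by [].
  rewrite -subr_ge0.
  set k := j%:R in j0 nj *; set Z := z ^+ 2 ^+ j; set P := pochhammer _ _; set f := j`!%:R.
  have Z0 : 0 <= Z by rewrite exprn_ge0.
  have -> : (nu + 1) * (Z / (f * P) + 2^-1 * (z ^+ 2 * Z / ((k + 1) * f * (P * (nu + 1 + k))))) -
     z * (Z / (f * (P * (nu + 1 + k) / (nu + 1)))) =
     (nu + 1) * Z / (f * P * (nu + 1 + k)) * ((nu + 1 + k) + z ^+ 2 / (2 * (k + 1)) - z).
    by field; rewrite !gt_eqF// addr_gt0.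
  rewrite mulr_ge0 ?divr_ge0 ?mulr_ge0 ?(ltW nj) ?(ltW n1) ?(ltW pj)//.
  have -> : nu + 1 + k + z ^+ 2 / (2 * (k + 1)) - z = (nu + 1 + k - (k + 1) / 2) + (z - (k + 1)) ^+ 2 / (2 * (k + 1)).
    by field; rewrite gt_eqF// ltr_wpDl.
  rewrite addr_ge0//; first by lra.
  by rewrite divr_ge0 ?sqr_ge0// mulr_ge0// addr_ge0.
rewrite -mulr_sumr big_split /= -mulr_sumr.
have l1 := le1 n.
have l2 := le1 n.+1; rewrite big_ord_recl /= in l2.
have c0 := bessel_coef_ge0 0 nu2 zz.
have -> : 3 / 2 * (nu + 1) * bessel nu (z ^+ 2) = (nu + 1) * (bessel nu (z ^+ 2) + 2^-1 * bessel nu (z ^+ 2)).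
  by field.
rewrite ler_wpM2l ?(ltW n1)// lerD// ler_wpM2l ?invr_ge0//.
rewrite (le_trans _ l2)//.
rewrite [leLHS](_ : _ = \sum_(i < n) bessel_coef nu (z ^+ 2) (bump 0 i)) ?lerDr//.
Unshelve. all: by end_near. Qed.

(** Since (2j)! = 4^j j! (1/2)_j, the even terms of the exponential series of 2z are those of
    [bessel (- 1/2) (z ^ 2)], and (1/2)_j <= (nu + 1)_j. *)
Lemma bessel_le_expR nu z : - 2^-1 <= nu -> 0 <= z -> bessel nu (z ^+ 2) <= expR (2 * z).
Proof.
move=> nu2 z0.
have n1 : 0 < nu + 1 by lra.
have zz : 0 <= z ^+ 2 by rewrite exprn_ge0.
have h := cvg_bessel nu2 zz.
apply: limr_le; first by apply/cvg_ex; eexists; exact: h.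
near=> n; rewrite /series /= big_mkord.
have e0 i : 0 <= exp_coeff (2 * z) i by rewrite exp_coeff_ge0// mulr_ge0.
apply: le_trans (sum_le_lim e0 (is_cvg_series_exp_coeff (2 * z)) n.*2).
rewrite sum_even_odd; apply: ler_sum => -[j /= _] _.
apply: (@le_trans _ _ (exp_coeff (2 * z) j.*2)); last by rewrite lerDl.
rewrite /bessel_coef /exp_coeff /= -mul2n.
have F j' : (2 * j')`!%:R = 2 ^+ (2 * j') * j'`!%:R * pochhammer (2^-1) j' :> R.
  elim: j' => [|i IH]; first by rewrite muln0 expr0 pochhammer0 !mul1r.
  rewrite mulnS !addSn add0n !factS !natrM IH pochhammerS !exprS -!natr1 !natrM; by field.
rewrite F [(2 * z) ^+ _]exprMn [z ^+ (2 * j)]exprM.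
have pn := pochhammer_gt0 j n1.
have ph : 0 < pochhammer (2^-1 : R) j by apply: pochhammer_gt0.
have phn : pochhammer (2^-1 : R) j <= pochhammer (nu + 1) j.
  rewrite /pochhammer; apply: ler_prod => i _; rewrite addr_ge0//=.
  by rewrite lerD2r; lra.
have f0 : 0 < j`!%:R :> R by rewrite ltr0n fact_gt0.
rewrite [leRHS](_ : _ = (z ^+ 2) ^+ j / (j`!%:R * pochhammer 2^-1 j)).
  by rewrite ler_wpM2l ?exprn_ge0// lef_pV2 ?posrE ?mulr_gt0// ler_pM2l.
by field; rewrite !gt_eqF//.
Unshelve. all: by end_near. Qed.

Lemma laguerre_kernel_ge0 nu s x y : - 2^-1 <= nu -> 0 <= laguerre_kernel nu s x y.
Proof.
move=> nu2; have n1 : 0 < nu + 1 by lra.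
have G0 := Gamma_gt0 n1.
rewrite /laguerre_kernel !mulr_ge0 ?powR_ge0 ?expR_ge0 ?invr_ge0 ?(ltW G0)//.
apply: bessel_ge0 => //; apply: divr_ge0; last exact: sqr_ge0.
by apply: mulr_ge0; [apply: mulr_ge0|]; exact: sqr_ge0.
Qed.

Lemma laguerre_kernelC nu s x y : laguerre_kernel nu s x y = laguerre_kernel nu s y x.
Proof. by rewrite /laguerre_kernel [x ^+ 2 + _]addrC [x ^+ 2 * _]mulrC. Qed.

(** After [bessel_le_expR] the exponents of the two sides differ by s / (1 - s^2) (|x| - |y|)^2,
    which is nonnegative. *)
Lemma laguerre_kernel_le nu s x y : - 2^-1 <= nu -> 0 < s < 1 ->
  laguerre_kernel nu s x y <= (s / (1 - s ^+ 2)) `^ (nu + 1) / Gamma (nu + 1) *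
    expR (- ((1 - s) ^+ 2 / (2 * (1 - s ^+ 2)) * (x ^+ 2 + y ^+ 2))).
Proof.
move=> nu2 /andP[s0 s1]; have n1 : 0 < nu + 1 by lra.
have s2 : 0 < 1 - s ^+ 2 by rewrite subr_gt0 expr_lt1// ltW.
have G0 := Gamma_gt0 n1.
rewrite /laguerre_kernel -mulrA ler_wpM2l ?divr_ge0 ?powR_ge0 ?(ltW G0)//.
have z0 : 0 <= `|x * y| * s / (1 - s ^+ 2) by rewrite divr_ge0 ?mulr_ge0// ltW.
have -> : x ^+ 2 * y ^+ 2 * s ^+ 2 / (1 - s ^+ 2) ^+ 2 = (`|x * y| * s / (1 - s ^+ 2)) ^+ 2.
  by rewrite expr_div_n !exprMn real_normK ?num_real// exprMn.
apply: le_trans (ler_wpM2l (expR_ge0 _) (bessel_le_expR nu2 z0)) _.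
rewrite -expRD ler_expR /gauss_rate -subr_ge0.
have -> : - ((1 - s) ^+ 2 / (2 * (1 - s ^+ 2)) * (x ^+ 2 + y ^+ 2)) -
  (- ((1 + s ^+ 2) / (2 * (1 - s ^+ 2)) * (x ^+ 2 + y ^+ 2)) +
   2 * (`|x * y| * s / (1 - s ^+ 2))) = s / (1 - s ^+ 2) * (`|x| - `|y|) ^+ 2.
  rewrite normrM -(real_normK (num_real x)) -(real_normK (num_real y)); field.
  by rewrite gt_eqF.
by rewrite mulr_ge0 ?sqr_ge0// divr_ge0// ltW.
Qed.

End laguerre_kernel.

(** * Summation of the one-dimensional heat series *)

Section mehler.
Context {R : realType}.
Implicit Types (nu s x y z : R).
Local Notation mu := (@lebesgue_measure R).

(** The term of index n of the one-dimensional heat kernel at s = exp(-2t), without the common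
    factor s^(nu+1), which accounts for the constant part 2 nu + 2 of the eigenvalue. *)
Definition heat_term nu s x y (n : nat) : R := s ^+ n * (hermite1 nu n x * hermite1 nu n y).

Lemma cvgn_double (u : R ^nat) (l : R) : u n @[n --> \oo] --> l -> u n.*2 @[n --> \oo] --> l.
Proof.
move=> ul; apply: cvg_comp ul => /= A [N _ NA]; exists N => // n /= Nn.
by apply: NA => /=; rewrite (leq_trans Nn)// -addnn leq_addr.
Qed.

Lemma cvgn_norm_bounded (u : R ^nat) (M : R) : (forall n, \sum_(i < n) `|u i| <= M) ->
  cvgn (series (fun n => `|u n|)).
Proof.
move=> uM; apply: nondecreasing_is_cvgn.
  by apply/nondecreasing_seqP => n; rewrite /series /= big_nat_recr//= lerDl.
by exists M => _ [N _ <-]; rewrite /series /= big_mkord.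
Qed.

Lemma heat_term_even nu s x y m : - 2^-1 <= nu -> heat_term nu s x y m.*2 =
  (Gamma (nu + 1))^-1 * expR (- ((x ^+ 2 + y ^+ 2) / 2)) *
    (m`!%:R / pochhammer (nu + 1) m * (laguerre_val nu m (x ^+ 2) * laguerre_val nu m (y ^+ 2)) * (s ^+ 2) ^+ m).
Proof. by move=> nu2; rewrite /heat_term hermite1_evenM// -exprM mul2n; ring. Qed.

Lemma heat_term_odd nu s x y m : - 2^-1 <= nu -> heat_term nu s x y m.*2.+1 =
  (Gamma (nu + 1))^-1 * expR (- ((x ^+ 2 + y ^+ 2) / 2)) * (x * y / (nu + 1)) * s *
    (m`!%:R / pochhammer (nu + 1 + 1) m * (laguerre_val (nu + 1) m (x ^+ 2) * laguerre_val (nu + 1) m (y ^+ 2)) * (s ^+ 2) ^+ m).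
Proof. by move=> nu2; rewrite /heat_term hermite1_oddM// exprS -exprM mul2n; ring. Qed.

(** [hille_hardy] with r = s^2 sums the even terms at order nu and the odd ones at order nu + 1. The
    even part is exactly [laguerre_kernel], the odd part is at most 3/2 times it, and 1 + 3/2 =
    5/2. *)
Lemma mehler nu s x y : - 2^-1 <= nu -> 0 < s < 1 ->
  cvgn (series (fun n => `|heat_term nu s x y n|)) /\
  `|s `^ (nu + 1) * limn (series (heat_term nu s x y))| <= 5 / 2 * laguerre_kernel nu s x y.
Proof.
move=> nu2 /andP[s0 s1]; have n1 : 0 < nu + 1 by lra.
have nu3 : - 2^-1 <= nu + 1 by lra.
have s2 : 0 < 1 - s ^+ 2 by rewrite subr_gt0 expr_lt1// ltW.
have r01 : 0 <= s ^+ 2 < 1 by rewrite sqr_ge0/= -subr_gt0.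
have G0 := Gamma_gt0 n1.
have [e1 e2] := hille_hardy nu2 (sqr_ge0 x) (sqr_ge0 y) r01.
have [oa ob] := hille_hardy nu3 (sqr_ge0 x) (sqr_ge0 y) r01.
set ae := (X in series X) in e1; set ao := (X in series X) in oa.
set le := (X in _ --> X) in e1; set lo := (X in _ --> X) in oa.
pose ce := (Gamma (nu + 1))^-1 * expR (- ((x ^+ 2 + y ^+ 2) / 2)).
pose co := ce * (x * y / (nu + 1)) * s.
have te m : heat_term nu s x y m.*2 = ce * ae m by rewrite heat_term_even.
have to m : heat_term nu s x y m.*2.+1 = co * ao m by rewrite heat_term_odd.
have cabs : cvgn (series (fun n => `|heat_term nu s x y n|)).
  apply: (@cvgn_norm_bounded _ (`|ce| * limn (series (fun m => `|ae m|)) + `|co| * limn (series (fun m => `|ao m|)))) => n.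
  apply: (@le_trans _ _ (\sum_(i < n.*2) `|heat_term nu s x y i|)).
    rewrite -!(big_mkord predT (fun i => `|heat_term nu s x y i|)).
    rewrite [leRHS](@big_cat_nat _ _ _ n)//=; last by rewrite -addnn leq_addr.
    by rewrite lerDl sumr_ge0.
  rewrite (sum_even_odd (fun i => `|heat_term nu s x y i|)) big_split /=; apply: lerD.
    under eq_bigr do rewrite te normrM.
    by rewrite -mulr_sumr ler_wpM2l//; exact: (sum_le_lim (fun=> normr_ge0 _) e2).
  under eq_bigr do rewrite to normrM.
  by rewrite -mulr_sumr ler_wpM2l//; exact: (sum_le_lim (fun=> normr_ge0 _) ob).
split => //.
have clim : cvgn (series (heat_term nu s x y)) by exact: normed_cvg.
have lim2 := cvgn_double clim.
have lim3 : series (heat_term nu s x y) n.*2 @[n --> \oo] --> ce * le + co * lo.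
  apply: (@eq_cvgn _ (fun n => series (fun m => ce * ae m) n + series (fun m => co * ao m) n)) => [n|].
    rewrite /series /= !big_mkord sum_even_odd big_split /=; congr (_ + _); apply: eq_bigr => i _.
      by rewrite te.
    by rewrite to.
  by apply: cvgD; apply: cvg_seriesZ.
have -> : limn (series (heat_term nu s x y)) = ce * le + co * lo.
  by rewrite -(cvg_lim _ lim3)//; apply/esym/cvg_lim.
have kE : s `^ (nu + 1) * (ce * le) = laguerre_kernel nu s x y.
  rewrite /ce /le /laguerre_kernel powRM ?invr_ge0 ?(ltW s0) ?(ltW s2)//.
  have -> : (1 - s ^+ 2)^-1 `^ (nu + 1) = (1 - s ^+ 2) `^ (- (nu + 1)).
    by rewrite -(powR_inv1 (ltW s2)) -powRrM mulN1r.
  have -> : expR (- (gauss_rate s * (x ^+ 2 + y ^+ 2))) = expR (- ((x ^+ 2 + y ^+ 2) / 2)) *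
      expR (- ((x ^+ 2 + y ^+ 2) * (s ^+ 2 / (1 - s ^+ 2)))).
    by rewrite -expRD /gauss_rate; congr expR; field; rewrite gt_eqF.
  ring.
rewrite mulrDr kE; apply: le_trans (ler_normD _ _) _.
have k0 := laguerre_kernel_ge0 s x y nu2.
rewrite (ger0_norm k0).
suff : `|s `^ (nu + 1) * (co * lo)| <= 3 / 2 * laguerre_kernel nu s x y by lra.
(* The square root of the Bessel argument: up to sign, the odd part is P z [bessel (nu + 1) (z ^ 2)]
   / (nu + 1), to which [sqrt_bessel_le] applies. *)
set z := `|x * y| * s / (1 - s ^+ 2).
have z0 : 0 <= z by rewrite divr_ge0 ?(ltW s2)// mulr_ge0// ltW.
have wE : x ^+ 2 * y ^+ 2 * s ^+ 2 / (1 - s ^+ 2) ^+ 2 = z ^+ 2.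
  by rewrite /z expr_div_n !exprMn real_normK ?num_real// exprMn.
pose P := s `^ (nu + 1) * ce * ((1 - s ^+ 2) `^ (- (nu + 1)) * expR (- ((x ^+ 2 + y ^+ 2) * (s ^+ 2 / (1 - s ^+ 2))))).
have P0 : 0 <= P by rewrite /P /ce !mulr_ge0 ?powR_ge0 ?expR_ge0 ?invr_ge0// ltW.
have -> : laguerre_kernel nu s x y = P * bessel nu (z ^+ 2).
  by rewrite -kE /P /le wE; ring.
have b0 : 0 <= bessel (nu + 1) (z ^+ 2) by rewrite bessel_ge0// exprn_ge0.
have loE : s `^ (nu + 1) * (co * lo) = P * (x * y * s / (1 - s ^+ 2) * bessel (nu + 1) (z ^+ 2) / (nu + 1)).
  have pE : (1 - s ^+ 2) `^ (- (nu + 1 + 1)) = (1 - s ^+ 2) `^ (- (nu + 1)) / (1 - s ^+ 2).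
    by rewrite opprD powRD ?(gt_eqF s2) ?implybT// powR_inv1 ?(ltW s2).
  rewrite /P /co /lo wE pE.
  by field; rewrite !gt_eqF.
rewrite loE normrM (ger0_norm P0) [leRHS]mulrCA ler_wpM2l//.
rewrite !normrM !normfV (gtr0_norm s0) (gtr0_norm s2) (gtr0_norm n1) (ger0_norm b0) -normrM -/z.
by rewrite ler_pdivrMr//; have := sqrt_bessel_le nu2 z0; lra.
Qed.

(** On the diagonal x = y the heat series has nonnegative terms, so a single term is at most the
    sum, which [mehler] and [laguerre_kernel_le] bound by a Gaussian. At s = 1/2 this bounds the
    square by M e^(-y^2/3), hence the rate 1/6; adding 1 to sqrt M makes the constant positive. *)
Lemma hermite1_bound nu n : - 2^-1 <= nu ->
  exists2 C, 0 < C & forall y, `|hermite1 nu n y| <= C * expR (- (6^-1 * y ^+ 2)).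
Proof.
move=> nu2; have n1 : 0 < nu + 1 by lra.
pose s : R := 2^-1.
have s01 : 0 < s < 1 by rewrite /s; lra.
have G0 := Gamma_gt0 n1.
pose M := 5 / 2 * ((s / (1 - s ^+ 2)) `^ (nu + 1) / Gamma (nu + 1)) / (s `^ (nu + 1) * s ^+ n).
have sp : 0 < s `^ (nu + 1) * s ^+ n by rewrite mulr_gt0 ?powR_gt0 ?exprn_gt0//; case/andP: s01.
have M0 : 0 <= M by rewrite !mulr_ge0 ?powR_ge0 ?invr_ge0 ?(ltW G0) ?(ltW sp).
exists (Num.sqrt M + 1) => [|y]; first by rewrite ltr_wpDl ?sqrtr_ge0.
have [ca kb] := mehler y y nu2 s01.
have t0 m : 0 <= heat_term nu s y y m.
  by rewrite /heat_term -expr2 mulr_ge0 ?sqr_ge0// exprn_ge0//; case/andP: s01 => /ltW.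
have hn : heat_term nu s y y n <= limn (series (heat_term nu s y y)).
  apply: le_trans (sum_le_lim t0 (normed_cvg ca) n.+1).
  by rewrite big_ord_recr /= lerDr sumr_ge0.
have hM : hermite1 nu n y ^+ 2 <= M * expR (- (6^-1 * y ^+ 2)) ^+ 2.
  have l0 : 0 <= limn (series (heat_term nu s y y)) by apply: le_trans hn.
  rewrite ger0_norm ?mulr_ge0 ?powR_ge0// in kb.
  have kb2 := le_trans kb (ler_wpM2l (_ : 0 <= 5 / 2) (laguerre_kernel_le y y nu2 s01)).
  have {}kb2 := kb2 ltac:(lra).
  rewrite -(ler_pM2l sp); apply: (@le_trans _ _ (s `^ (nu + 1) * limn (series (heat_term nu s y y)))).
    rewrite -mulrA ler_wpM2l ?powR_ge0//.
  apply: le_trans kb2 _; have -> : expR (- (6^-1 * y ^+ 2)) ^+ 2 = expR (- (6^-1 * y ^+ 2) *+ 2).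
    by rewrite -expRM_natl mulr_natl.
  rewrite /M [leRHS](_ : _ = 5 / 2 * ((s / (1 - s ^+ 2)) `^ (nu + 1) / Gamma (nu + 1) * expR (- (6^-1 * y ^+ 2) *+ 2))).
    by rewrite /s (_ : - (_ * (_ + _)) = - (6^-1 * y ^+ 2) *+ 2)//; field.
  by set u := s `^ (nu + 1) * s ^+ n; field; rewrite !gt_eqF.
rewrite -ler_sqr ?nnegrE ?mulr_ge0 ?addr_ge0 ?sqrtr_ge0 ?expR_ge0//.
rewrite real_normK ?num_real// exprMn; apply: le_trans hM _.
rewrite ler_wpM2r ?exprn_ge0 ?expR_ge0//.
have := sqr_sqrtr M0; have := sqrtr_ge0 M; nra.
Qed.

Lemma measurable_hermite1 nu n : measurable_fun [set: R] (hermite1 nu n).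
Proof.
have mg : measurable_fun [set: R] (fun y : R => expR (- y ^+ 2 / 2)).
  apply: measurableT_comp; first exact: measurable_expR.
  apply: measurable_funM => //.
  by apply: measurableT_comp => //; exact: measurable_funX.
have mp a m : measurable_fun [set: R] (fun y : R => (laguerre a m).[y ^+ 2]).
  under eq_fun do rewrite horner_coef.
  apply: measurable_sum => i; apply: measurable_funM => //.
  by apply: measurable_funX; exact: measurable_funX.
rewrite /hermite1; case: (odd n); repeat apply: measurable_funM => //.
Qed.

End mehler.

(** * Integrals of the one-dimensional kernel *)

Section kernel_integrals.
Context {R : realType}.
Implicit Types (nu s x y : R).
Local Notation mu := (@lebesgue_measure R).

Lemma gauss_rate_gt0 s : 0 < s < 1 -> 0 < gauss_rate s.
Proof.
move=> /andP[s0 s1]; rewrite /gauss_rate divr_gt0 ?mulr_gt0 ?subr_gt0 ?expr_lt1 ?(ltW s0)//.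
by rewrite addr_gt0// exprn_gt0.
Qed.

Lemma measurable_inv : measurable_fun [set: R] (@GRing.inv R).
Proof.
rewrite (_ : @GRing.inv R = fun x : R => x * (x ^+ 2) `^ (-1)).
  apply: measurable_funM => //.
  apply: (@measurableT_comp _ _ _ _ _ _ (fun x : R => x `^ (-1)) _ (fun x => x ^+ 2)).
    exact: measurable_powR.
  exact: measurable_funX.
apply/funext => x; rewrite powR_inv1 ?sqr_ge0//.
have [->|x0] := eqVneq x 0; first by rewrite invr0 mul0r.
by rewrite expr2 invfM mulrA divff// mul1r.
Qed.

Lemma measurable_fun_powR d (T : measurableType d) (f : T -> R) (p : R) :
  measurable_fun setT f -> measurable_fun setT (fun z => f z `^ p).
Proof. by move=> mf; exact: (@measurableT_comp _ _ _ _ _ _ (fun x : R => x `^ p)). Qed.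

Lemma measurable_fun_expR d (T : measurableType d) (f : T -> R) :
  measurable_fun setT f -> measurable_fun setT (fun z => expR (f z)).
Proof. by move=> mf; exact: (@measurableT_comp _ _ _ _ _ _ (@expR R)). Qed.

Lemma measurable_fun_inv d (T : measurableType d) (f : T -> R) :
  measurable_fun setT f -> measurable_fun setT (fun z => (f z)^-1).
Proof.
move=> mf; apply: (@measurableT_comp _ _ _ _ _ _ (@GRing.inv R)) => //.
exact: measurable_inv.
Qed.

Lemma measurable_laguerre_kernel d (T : measurableType d) nu (S X Y : T -> R) :
  - 2^-1 <= nu -> measurable_fun setT S -> measurable_fun setT X -> measurable_fun setT Y ->
  measurable_fun setT (fun z => laguerre_kernel nu (S z) (X z) (Y z)).
Proof.
move=> nu2 mS mX mY.
have mS2 : measurable_fun setT (fun z => S z ^+ 2) by exact: measurable_funX.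
have m1S : measurable_fun setT (fun z => 1 - S z ^+ 2) by exact: measurable_funB.
have mV := @measurable_fun_inv _ T.
rewrite /laguerre_kernel; apply: measurable_funM.
  apply: measurable_funM.
    apply: measurable_funM => //; apply: measurable_fun_powR.
    by apply: measurable_funM => //; exact: mV.
  apply: measurable_fun_expR; apply: measurableT_comp => //; apply: measurable_funM.
    apply: measurable_funM; first exact: measurable_funD.
    by apply: mV; exact: measurable_funM.
  by apply: measurable_funD; exact: measurable_funX.
apply: (measurable_fun_cvg (h := fun n z => series (bessel_coef nu
    (X z ^+ 2 * Y z ^+ 2 * S z ^+ 2 / (1 - S z ^+ 2) ^+ 2)) n)) => [m|z _].
  rewrite /series /=; apply: measurable_sum => i.
  apply: measurable_funM => //; apply: measurable_funX; apply: measurable_funM.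
    apply: measurable_funM => //; apply: measurable_funM; exact: measurable_funX.
  by apply: mV; exact: measurable_funX.
apply: cvg_bessel => //; apply: divr_ge0; last exact: sqr_ge0.
by apply: mulr_ge0; [apply: mulr_ge0|]; exact: sqr_ge0.
Qed.

(** The Bessel series is integrated term by term. Each term is a Gaussian moment whose value
    Gamma(nu+1+j) cancels the Pochhammer symbol in the denominator, so that an exponential series
    remains. *)
Lemma integral_laguerre_kernel nu s x : - 2^-1 <= nu -> 0 < s < 1 ->
  (\int[mu]_y (laguerre_kernel nu s x y * `|y| `^ (2 * nu + 1))%:E =
   ((2 * s / (1 + s ^+ 2)) `^ (nu + 1) * expR (- (x ^+ 2 / (4 * gauss_rate s))))%:E)%E.
Proof.
move=> nu2 s01; have /andP[s0 s1] := s01; have n1 : 0 < nu + 1 by lra.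
have s2 : 0 < 1 - s ^+ 2 by rewrite subr_gt0 expr_lt1// ltW.
have G0 := Gamma_gt0 n1.
set c := gauss_rate s; have c0 : 0 < c by exact: gauss_rate_gt0.
pose P := (s / (1 - s ^+ 2)) `^ (nu + 1).
pose q := x ^+ 2 * s ^+ 2 / (1 - s ^+ 2) ^+ 2.
have q0 : 0 <= q by rewrite /q divr_ge0 ?sqr_ge0// mulr_ge0 ?sqr_ge0.
pose A j := P / Gamma (nu + 1) * expR (- (c * x ^+ 2)) * bessel_coef nu q j.
have A0 j : 0 <= A j.
  by rewrite /A mulr_ge0 ?bessel_coef_ge0// mulr_ge0 ?expR_ge0// divr_ge0 ?powR_ge0 ?ltW.
pose g j y := `|y| `^ (2 * (nu + 1 + j%:R) - 1) * expR (- (c * y ^+ 2)).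
have g0 j y : 0 <= g j y by rewrite mulr_ge0 ?powR_ge0 ?expR_ge0.
transitivity (\int[mu]_y \sum_(j <oo) (A j * g j y)%:E)%E.
  apply: eq_integral => y _; apply/esym.
  apply/cvg_series_nneseries; first by move=> j; rewrite mulr_ge0.
  have y0 : 0 <= q * y ^+ 2 by rewrite mulr_ge0 ?sqr_ge0.
  have := cvg_seriesZ (c := P / Gamma (nu + 1) * expR (- (c * (x ^+ 2 + y ^+ 2))) * `|y| `^ (2 * nu + 1)) (cvg_bessel nu2 y0).
  rewrite /laguerre_kernel -/P -/c (_ : x ^+ 2 * y ^+ 2 * s ^+ 2 / (1 - s ^+ 2) ^+ 2 = q * y ^+ 2); last first.
    by rewrite /q; ring.
  rewrite -[_ * bessel _ _ * _]mulrAC; apply: eq_cvgn => n.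
  apply: eq_bigr => j _; rewrite /A /g /bessel_coef exprMn.
  have -> : - (c * (x ^+ 2 + y ^+ 2)) = - (c * x ^+ 2) + - (c * y ^+ 2) by ring.
  rewrite expRD.
  have -> : `|y| `^ (2 * (nu + 1 + j%:R) - 1) = `|y| `^ (2 * nu + 1) * y ^+ 2 ^+ j.
    have -> : 2 * (nu + 1 + j%:R) - 1 = 2 * nu + 1 + (2 * j)%:R by rewrite natrM; ring.
    (* For nu = -1/2 and j = 0 the total exponent is 0, where splitting the power with [powRD] fails
       at y = 0; for j > 0 it is positive. *)
    have [->|j0] := eqVneq j 0%N; first by rewrite muln0 addr0 mulr1.
    have p0 : 0 < 2 * nu + 1 + (2 * j)%:R.
      have : 1 <= (2 * j)%:R :> R by rewrite ler1n muln_gt0 /= lt0n j0.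
      lra.
    rewrite powRD ?(gt_eqF p0)// powR_mulrn// exprM real_normK ?num_real//.
  ring.
rewrite integral_nneseries//; last 2 first.
- move=> j; apply/measurable_EFinP; apply: measurable_funM => //.
  by apply/measurable_EFinP; exact: measurable_gauss_moment.
- by move=> j y _; rewrite lee_fin mulr_ge0.
pose K := P * expR (- (c * x ^+ 2)) * c `^ (- (nu + 1)).
have term j : (\int[mu]_y (A j * g j y)%:E = (K * exp_coeff (q / c) j)%:E)%E.
  under eq_integral do rewrite EFinM.
  rewrite ge0_integralZl//; last 3 first.
  - exact: measurable_gauss_moment.
  - by move=> y _; rewrite lee_fin.
  - by rewrite lee_fin.
  have j0 : 0 <= j%:R :> R by [].
  rewrite integral_gauss_moment//; last by lra.
  rewrite Gamma_pochhammer// opprD powRD ?(gt_eqF c0) ?implybT// powR_invn ?(ltW c0)//.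
  rewrite -EFinM; congr EFin; rewrite /A /K /bessel_coef /exp_coeff /= [(q / c) ^+ j]expr_div_n.
  have pj := pochhammer_gt0 j n1.
  by field; rewrite factr_neq0 !gt_eqF// exprn_gt0.
rewrite (eq_eseriesr (g := fun j => (K * exp_coeff (q / c) j)%:E)); last by move=> j _; exact: term.
have -> : (2 * s / (1 + s ^+ 2)) `^ (nu + 1) * expR (- (x ^+ 2 / (4 * c))) = K * expR (q / c).
  have s3 : 0 < 1 + s ^+ 2 by rewrite ltr_wpDr ?sqr_ge0.
  transitivity (P * c `^ (- (nu + 1)) * (expR (- (c * x ^+ 2)) * expR (q / c))); last by rewrite /K; ring.
  rewrite -expRD.
  have -> : - (c * x ^+ 2) + q / c = - (x ^+ 2 / (4 * c)).
    by rewrite /q /c /gauss_rate; field; rewrite !gt_eqF.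
  congr (_ * _).
  have -> : 2 * s / (1 + s ^+ 2) = s / (1 - s ^+ 2) * c^-1.
    by rewrite /c /gauss_rate; field; rewrite !gt_eqF.
  rewrite powRM ?invr_ge0 ?(ltW c0) ?divr_ge0 ?(ltW s0) ?(ltW s2)//.
  by rewrite -(powR_inv1 (ltW c0)) -powRrM mulN1r.
apply/cvg_series_nneseries.
  move=> j; apply: mulr_ge0; first by rewrite /K !mulr_ge0 ?powR_ge0 ?expR_ge0.
  by apply: exp_coeff_ge0; rewrite divr_ge0// ltW.
by apply: cvg_seriesZ; exact: is_cvg_series_exp_coeff.
Qed.

Lemma integral_laguerre_kernel_le nu s x : - 2^-1 <= nu -> 0 < s < 1 ->
  (\int[mu]_y (laguerre_kernel nu s x y * `|y| `^ (2 * nu + 1))%:E <= ((2 * s) `^ (nu + 1))%:E)%E.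
Proof.
move=> nu2 s01; have /andP[s0 s1] := s01; have n1 : 0 <= nu + 1 by lra.
have c0 := gauss_rate_gt0 s01.
rewrite integral_laguerre_kernel// lee_fin -[leRHS]mulr1 ler_pM ?powR_ge0 ?expR_ge0//.
  have h : 1 <= 1 + s ^+ 2 by rewrite lerDl sqr_ge0.
  have h0 : 0 < 1 + s ^+ 2 by apply: lt_le_trans h.
  rewrite ge0_ler_powR ?nnegrE ?mulr_ge0 ?invr_ge0 ?(ltW s0) ?(ltW h0)//.
  by rewrite ler_pdivrMr// ler_peMr// mulr_ge0// ltW.
by rewrite -expR0 ler_expR oppr_le0 divr_ge0 ?sqr_ge0// mulr_ge0// ltW.
Qed.

(** The Gaussian factor in x of [integral_laguerre_kernel] makes the total mass finite; it is again
    a Gaussian moment. *)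
Lemma integral2_laguerre_kernel nu s : - 2^-1 <= nu -> 0 < s < 1 ->
  (\int[mu]_x ((\int[mu]_y (laguerre_kernel nu s x y * `|y| `^ (2 * nu + 1))%:E) * (`|x| `^ (2 * nu + 1))%:E) =
  (Gamma (nu + 1) * (4 * s / (1 - s ^+ 2)) `^ (nu + 1))%:E)%E.
Proof.
move=> nu2 s01; have /andP[s0 s1] := s01; have n1 : 0 < nu + 1 by lra.
have c0 := gauss_rate_gt0 s01; set c := gauss_rate s in c0 *.
have s2 : 0 < 1 - s ^+ 2 by rewrite subr_gt0 expr_lt1// ltW.
have s3 : 0 < 1 + s ^+ 2 by rewrite ltr_wpDr ?sqr_ge0.
transitivity (\int[mu]_x (((2 * s / (1 + s ^+ 2)) `^ (nu + 1))%:E *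
    (`|x| `^ (2 * (nu + 1) - 1) * expR (- ((4 * c)^-1 * x ^+ 2)))%:E))%E.
  apply: eq_integral => x _; rewrite integral_laguerre_kernel// -!EFinM; congr EFin.
  have -> : 2 * (nu + 1) - 1 = 2 * nu + 1 by ring.
  rewrite -/c [x ^+ 2 / _]mulrC; ring.
rewrite ge0_integralZl//; last 2 first.
- exact: measurable_gauss_moment.
- by rewrite lee_fin powR_ge0.
have c4 : 0 < 4 * c by rewrite mulr_gt0.
rewrite integral_gauss_moment ?invr_gt0//; last by lra.
rewrite -(powR_inv1 (ltW c4)) -powRrM mulrN mulN1r opprK -EFinM; congr EFin.
have h1 : 0 <= 2 * s / (1 + s ^+ 2) by rewrite divr_ge0 ?mulr_ge0 ?ltW.
have h2 : 0 <= 4 * c by rewrite ltW.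
rewrite mulrCA; congr (_ * _); rewrite -powRM//.
by congr (_ `^ _); rewrite /c /gauss_rate; field; rewrite !gt_eqF.
Qed.

End kernel_integrals.

(** * Orthonormality of the Hermite functions and the eigenfunction property *)

Section orthonormality.
Context {R : realType}.
Implicit Types (nu s x y : R).
Local Notation mu := (@lebesgue_measure R).

(** An m-th finite difference in nu of the Pochhammer symbol (nu)_i, a monic polynomial of degree i:
    it vanishes for i < m and is m! up to sign for i = m. *)
Lemma sum_alternating_pochhammer nu m i : (i <= m)%N ->
  \sum_(j < m.+1) (-1) ^+ j * 'C(m, j)%:R * pochhammer (nu + j%:R) i =
  if i == m then (-1) ^+ m * m`!%:R else 0 :> R.
Proof.
elim: m nu i => [|m IH] nu i im.
  by case: i im => // _; rewrite big_ord1 !pochhammer0 bin0 !mulr1.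
pose D n a k := \sum_(j < n.+1) (-1) ^+ j * 'C(n, j)%:R * pochhammer (a + j%:R) k : R.
have rec : D m.+1 nu i = D m nu i - D m (nu + 1) i.
  rewrite /D big_ord_recl /= bin0 addr0.
  transitivity (pochhammer nu i + (\sum_(j < m.+1) (-1) ^+ j.+1 * 'C(m, j.+1)%:R * pochhammer (nu + j.+1%:R) i
     - \sum_(j < m.+1) (-1) ^+ j * 'C(m, j)%:R * pochhammer (nu + 1 + j%:R) i)).
    rewrite expr0 !mul1r -sumrB; congr (_ + _); apply: eq_bigr => j _.
    rewrite /bump /= add1n binS natrD exprS -[j.+1%:R]natr1.
    have -> : nu + (j%:R + 1) = nu + 1 + j%:R by ring.
    ring.
  rewrite addrA; congr (_ - _).
  rewrite big_ord_recr /= bin_small// mulr0 mul0r addr0.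
  by rewrite [RHS]big_ord_recl /= bin0 addr0 expr0 !mul1r; congr (_ + _); apply: eq_bigr.
rewrite -/(D m.+1 nu i) rec; case: i im rec => [|i] im rec.
  rewrite /D; under eq_bigr do rewrite pochhammer0.
  by under [X in _ - X]eq_bigr do rewrite pochhammer0; rewrite subrr.
rewrite /D -sumrB.
transitivity (- i.+1%:R * D m (nu + 1) i).
  rewrite /D mulr_sumr; apply: eq_bigr => j _.
  rewrite -mulrBr.
  have -> : pochhammer (nu + j%:R) i.+1 - pochhammer (nu + 1 + j%:R) i.+1 =
     - i.+1%:R * pochhammer (nu + 1 + j%:R) i.
    rewrite pochhammerSl pochhammerS.
    have -> : nu + j%:R + 1 = nu + 1 + j%:R by ring.
    by rewrite -[i.+1%:R]natr1; ring.
  ring.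
rewrite /D IH// eqSS; case: ifP => [/eqP ->|_]; last by rewrite mulr0.
by rewrite exprS factS natrM; ring.
Qed.

(** The integral of L_m^nu against t^i for the weight t^nu e^(-t), written with the moments of the
    weight. *)
Lemma laguerre_moment nu m i : 0 < nu + 1 -> (i <= m)%N ->
  \sum_(j < m.+1) laguerre_coef nu m j * Gamma (nu + 1 + (i + j)%:R) =
  if i == m then (-1) ^+ m * Gamma (nu + 1 + m%:R) else 0.
Proof.
move=> n1 im.
transitivity (Gamma (nu + 1 + m%:R) / m`!%:R * \sum_(j < m.+1) (-1) ^+ j * 'C(m, j)%:R * pochhammer (nu + 1 + j%:R) i).
  rewrite mulr_sumr; apply: eq_bigr => -[j /= jm] _; rewrite /laguerre_coef.
  have j0 : 0 < nu + 1 + j%:R by rewrite ltr_wpDr.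
  have -> : nu + 1 + (i + j)%:R = nu + 1 + j%:R + i%:R by rewrite natrD; ring.
  have -> : nu + 1 + m%:R = nu + 1 + j%:R + (m - j)%:R by rewrite natrB//; ring.
  rewrite !(Gamma_pochhammer _ j0).
  have -> : 'C(m, j)%:R = m`!%:R / (j`!%:R * (m - j)`!%:R) :> R.
    by rewrite -(bin_fact (_ : j <= m)%N)// !natrM mulfK// mulf_neq0 ?factr_neq0.
  by field; rewrite !factr_neq0.
rewrite sum_alternating_pochhammer//; case: ifP => _; last by rewrite mulr0.
by field; rewrite factr_neq0.
Qed.

Lemma laguerre_orthogonal nu m n : 0 < nu + 1 -> (n <= m)%N ->
  \sum_(i < n.+1) \sum_(j < m.+1) laguerre_coef nu n i * laguerre_coef nu m j * Gamma (nu + 1 + (i + j)%:R) =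
  if n == m then Gamma (nu + 1 + m%:R) / m`!%:R else 0.
Proof.
move=> n1 nm.
transitivity (\sum_(i < n.+1) laguerre_coef nu n i * (if i == m :> nat then (-1) ^+ m * Gamma (nu + 1 + m%:R) else 0)).
  apply: eq_bigr => i _; rewrite -laguerre_moment//; last exact: leq_trans (leq_ord i) nm.
  by rewrite mulr_sumr; apply: eq_bigr => j _; rewrite mulrA.
case: eqVneq nm => [->|nmN] nm; last first.
  apply: big1 => i _; rewrite ifF ?mulr0//; apply/negbTE.
  by rewrite neq_ltn (leq_ltn_trans (leq_ord i))// ltn_neqAle nmN.
rewrite big_ord_recr /= eqxx big1 ?add0r => [|i _]; last first.
  by rewrite ifF ?mulr0//; apply/negbTE; rewrite neq_ltn ltn_ord.
rewrite /laguerre_coef subnn pochhammer0 fact0 mul1r mulr1 mulrAC mulrA -expr2 sqrr_sign mul1r.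
by rewrite mulrC.
Qed.

Lemma weighted_moment nu k : - 2^-1 <= nu ->
  mu.-integrable setT (fun y => (y ^+ 2 ^+ k * expR (- y ^+ 2) * `|y| `^ (2 * nu + 1))%:E) /\
  (\int[mu]_y (y ^+ 2 ^+ k * expR (- y ^+ 2) * `|y| `^ (2 * nu + 1))%:E = (Gamma (nu + 1 + k%:R))%:E)%E.
Proof.
move=> nu2.
have E y : y ^+ 2 ^+ k * expR (- y ^+ 2) * `|y| `^ (2 * nu + 1) =
    `|y| `^ (2 * (nu + 1 + k%:R) - 1) * expR (- (1 * y ^+ 2)).
  have -> : `|y| `^ (2 * (nu + 1 + k%:R) - 1) = `|y| `^ (2 * nu + 1) * y ^+ 2 ^+ k.
    have -> : 2 * (nu + 1 + k%:R) - 1 = 2 * nu + 1 + (2 * k)%:R by rewrite natrM; ring.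
    have [->|k0] := eqVneq k 0%N; first by rewrite muln0 addr0 mulr1.
    have p0 : 0 < 2 * nu + 1 + (2 * k)%:R.
      have : 1 <= (2 * k)%:R :> R by rewrite ler1n muln_gt0 /= lt0n k0.
      lra.
    by rewrite powRD ?(gt_eqF p0)// powR_mulrn// exprM real_normK ?num_real.
  by rewrite mul1r; ring.
have k0 : 0 <= k%:R :> R by [].
have I : (\int[mu]_y (y ^+ 2 ^+ k * expR (- y ^+ 2) * `|y| `^ (2 * nu + 1))%:E = (Gamma (nu + 1 + k%:R))%:E)%E.
  by under eq_integral do rewrite E; apply: integral_gauss_moment1; lra.
split => //; apply/integrableP; split.
  by under eq_fun do rewrite E; exact: measurable_gauss_moment.
have ge0 y : (0 <= (y ^+ 2 ^+ k * expR (- y ^+ 2) * `|y| `^ (2 * nu + 1))%:E)%E.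
  by rewrite lee_fin !mulr_ge0 ?expR_ge0 ?powR_ge0// exprn_ge0 ?sqr_ge0.
by under eq_integral do rewrite gee0_abs//; rewrite I ltry.
Qed.

Lemma integral_laguerreM nu m n : - 2^-1 <= nu ->
  mu.-integrable setT (fun y => (laguerre_val nu m (y ^+ 2) * laguerre_val nu n (y ^+ 2) * expR (- y ^+ 2) * `|y| `^ (2 * nu + 1))%:E) /\
  (\int[mu]_y (laguerre_val nu m (y ^+ 2) * laguerre_val nu n (y ^+ 2) * expR (- y ^+ 2) * `|y| `^ (2 * nu + 1))%:E
   = (if m == n then Gamma (nu + 1 + m%:R) / m`!%:R else 0)%:E)%E.
Proof.
move=> nu2; have n1 : 0 < nu + 1 by lra.
wlog nm : m n / (n <= m)%N => [hw|].
  have [/hw//|/ltnW/hw [h1 h2]] := leqP n m.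
  have E y : laguerre_val nu m (y ^+ 2) * laguerre_val nu n (y ^+ 2) = laguerre_val nu n (y ^+ 2) * laguerre_val nu m (y ^+ 2).
    by rewrite mulrC.
  under eq_fun do rewrite E; split => //.
  rewrite h2 eq_sym; case: eqVneq => // ->//.
pose M k y := (y ^+ 2 ^+ k * expR (- y ^+ 2) * `|y| `^ (2 * nu + 1))%:E.
have E y : (laguerre_val nu m (y ^+ 2) * laguerre_val nu n (y ^+ 2) * expR (- y ^+ 2) * `|y| `^ (2 * nu + 1))%:E =
   (\sum_(i < n.+1) \sum_(j < m.+1) ((laguerre_coef nu n i * laguerre_coef nu m j)%:E * M (i + j)%N y))%E.
  under eq_bigr do rewrite sumEFin; rewrite sumEFin; congr EFin.
  rewrite [laguerre_val nu m _ * _]mulrC -!mulrA /laguerre_val mulr_suml; apply: eq_bigr => i _.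
  rewrite !mulr_suml !mulr_sumr; apply: eq_bigr => j _.
  by rewrite exprD; ring.
have iM k : mu.-integrable setT (M k) by have [] := weighted_moment k nu2.
have iT i j : mu.-integrable setT (fun y => (laguerre_coef nu n i * laguerre_coef nu m j)%:E * M (i + j)%N y)%E.
  by apply: integrableZl.
have iS i : mu.-integrable setT (fun y => \sum_(j < m.+1) ((laguerre_coef nu n i * laguerre_coef nu m j)%:E * M (i + j)%N y))%E.
  by apply: integrable_sum => // j _; exact: iT.
under eq_fun do rewrite E; split; first by apply: integrable_sum => // i _; exact: iS.
rewrite integral_sum//.
under eq_bigr => i _ do rewrite integral_sum//.
under eq_bigr => i _.
  under eq_bigr => j _.
    rewrite integralZl//.
    have [_ ->] := weighted_moment (i + j) nu2.
    over.
  over.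
under eq_bigr => i _ do (under eq_bigr => j _ do rewrite -EFinM; rewrite sumEFin).
by rewrite sumEFin laguerre_orthogonal// eq_sym; case: eqVneq => // ->.
Qed.

Lemma Gamma_nat n : Gamma (n%:R + 1) = n`!%:R :> R.
Proof.
rewrite addrC Gamma_pochhammer// pochhammer_fact -[RHS]mul1r; congr (_ * _).
apply: EFin_inj; rewrite -integral_gammaE//.
have := @integral_expR_tail R 0 (lexx 0); rewrite oppr0 expR0 => <-.
by apply: eq_integral => t _; rewrite subrr powRr0 mul1r.
Qed.

Lemma hermite1N nu n y : hermite1 nu n (- y) = (-1) ^+ n * hermite1 nu n y.
Proof.
rewrite /hermite1 sqrrN -[(-1) ^+ n]signr_odd; case: (odd n) => /=.
  by rewrite expr1; ring.
by rewrite expr0 mul1r.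
Qed.

Lemma integrable_hermite1M nu m n : - 2^-1 <= nu ->
  mu.-integrable setT (fun y => (hermite1 nu m y * hermite1 nu n y * `|y| `^ (2 * nu + 1))%:E).
Proof.
move=> nu2; have [C C0 hC] := hermite1_bound m nu2; have [D D0 hD] := hermite1_bound n nu2.
apply: (@le_integrable _ _ _ mu setT measurableT _
   (fun y : R => ((C * D)%:E * (`|y| `^ (2 * (nu + 1) - 1) * expR (- (3^-1 * y ^+ 2)))%:E)%E)) => //.
- apply/measurable_EFinP; apply: measurable_funM.
    by apply: measurable_funM; exact: measurable_hermite1.
  by apply: (measurableT_comp (measurable_powR _)); exact: normr_measurable.
- move=> y _; rewrite -EFinM !abse_EFin lee_fin.
  have -> : 2 * (nu + 1) - 1 = 2 * nu + 1 by ring.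
  rewrite !normrM (ger0_norm (powR_ge0 _ _)) (gtr0_norm C0) (gtr0_norm D0) (ger0_norm (expR_ge0 _)).
  rewrite [leRHS]mulrCA [leLHS]mulrC ler_wpM2l ?powR_ge0//.
  have -> : expR (- (3^-1 * y ^+ 2)) = expR (- (6^-1 * y ^+ 2)) * expR (- (6^-1 * y ^+ 2)).
    by rewrite -expRD; congr expR; field.
  by rewrite mulrACA ler_pM.
- apply: integrableZl => //; apply/integrableP; split; first exact: measurable_gauss_moment.
  under eq_integral do rewrite gee0_abs ?lee_fin ?mulr_ge0 ?expR_ge0 ?powR_ge0//.
  by rewrite integral_gauss_moment ?ltry//; lra.
Qed.

(** For different parities the integrand is odd. For equal parities it reduces to the orthogonality
    of Laguerre polynomials; in the odd case the factor y^2 is absorbed by the weight, which raises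
    nu to nu + 1. *)
Lemma hermite1_orthonormal nu m n : - 2^-1 <= nu ->
  (\int[mu]_y (hermite1 nu m y * hermite1 nu n y * `|y| `^ (2 * nu + 1))%:E = ((m == n)%:R)%:E)%E.
Proof.
move=> nu2; have n1 : 0 < nu + 1 by lra.
have int := integrable_hermite1M m n nu2.
have [mn|mn] := eqVneq (odd m) (odd n); last first.
  rewrite integral_odd.
  - by have -> : (m == n) = false by apply/negbTE; apply: contraNneq mn => ->.
  - exact: measurable_int int.
  - move=> y; rewrite !hermite1N normrN -EFinN -[(-1) ^+ m]signr_odd -[(-1) ^+ n]signr_odd.
    by move: mn; case: (odd m); case: (odd n) => //= _; congr EFin; rewrite expr0 expr1; ring.
  - exact: integrable_fin_num int.
pose sg k : R := (-1) ^+ k.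
have E a (q c : R) : 0 < q -> 0 < c -> (sg a * Num.sqrt (q / c)) ^+ 2 * (c / q) = 1.
  move=> q0 c0; rewrite exprMn sqrr_sign mul1r sqr_sqrtr; last by rewrite divr_ge0 ?ltW.
  by field; rewrite !gt_eqF.
have HE y : expR (- y ^+ 2 / 2) * expR (- y ^+ 2 / 2) = expR (- y ^+ 2).
  by rewrite -expRD; congr expR; field.
have G a (b : R) : 0 < b -> 0 < Gamma (b + a%:R) by move=> b0; apply: Gamma_gt0; rewrite ltr_wpDr.
have F a : 0 < a`!%:R :> R by rewrite ltr0n fact_gt0.
rewrite -(odd_double_half m) -(odd_double_half n) mn.
have [on|en] := boolP (odd n); rewrite ?add0n ?add1n.
  have nu3 : - 2^-1 <= nu + 1 by lra.
  have n2 : 0 < nu + 1 + 1 by lra.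
  pose c a := sg a * Num.sqrt (a`!%:R / Gamma (nu + 1 + 1 + a%:R)).
  have hE a y : hermite1 nu a.*2.+1 y = c a * (expR (- y ^+ 2 / 2) * y * laguerre_val (nu + 1) a (y ^+ 2)).
    rewrite /hermite1 /= odd_double uphalf_double /= laguerreE Gamma_nat /c.
    have -> : a%:R + nu + 2 = nu + 1 + 1 + a%:R by ring.
    move: (Num.sqrt _) (expR _) (laguerre_val _ _ _) => q e l.
    by rewrite /sg; ring.
  have [_ I] := integral_laguerreM m./2 n./2 nu3.
  have [iL _] := integral_laguerreM m./2 n./2 nu3.
  transitivity ((c m./2 * c n./2)%:E * \int[mu]_y (laguerre_val (nu + 1) m./2 (y ^+ 2) * laguerre_val (nu + 1) n./2 (y ^+ 2) * expR (- y ^+ 2) * `|y| `^ (2 * (nu + 1) + 1))%:E)%E.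
    rewrite -integralZl//; apply: eq_integral => y _; rewrite -EFinM; congr EFin.
    rewrite !hE -HE.
    have -> : `|y| `^ (2 * (nu + 1) + 1) = `|y| `^ (2 * nu + 1) * y ^+ 2.
      have -> : 2 * (nu + 1) + 1 = 2 * nu + 1 + 2%:R by ring.
      have p0 : 0 < 2 * nu + 1 + 2%:R by lra.
      by rewrite powRD ?(gt_eqF p0)// powR_mulrn// real_normK ?num_real.
    move: (c m./2) (c n./2) (expR _) (laguerre_val _ m./2 _) (laguerre_val _ n./2 _) (_ `^ _) => ? ? ? ? ? ?.
    ring.
  rewrite I eqSS -!muln2 eqn_pmul2r//; case: eqVneq => [->|_]; last by rewrite mule0.
  by rewrite -EFinM -expr2 /c E ?G.
pose c a := sg a * Num.sqrt (a`!%:R / Gamma (nu + 1 + a%:R)).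
have hE a y : hermite1 nu a.*2 y = c a * (expR (- y ^+ 2 / 2) * laguerre_val nu a (y ^+ 2)).
  rewrite /hermite1 odd_double doubleK laguerreE Gamma_nat /c.
  have -> : a%:R + nu + 1 = nu + 1 + a%:R by ring.
  move: (Num.sqrt _) (expR _) (laguerre_val _ _ _) => q e l.
  by rewrite /sg; ring.
have [iL I] := integral_laguerreM m./2 n./2 nu2.
transitivity ((c m./2 * c n./2)%:E * \int[mu]_y (laguerre_val nu m./2 (y ^+ 2) * laguerre_val nu n./2 (y ^+ 2) * expR (- y ^+ 2) * `|y| `^ (2 * nu + 1))%:E)%E.
  rewrite -integralZl//; apply: eq_integral => y _; rewrite -EFinM; congr EFin.
  rewrite !hE -HE.
  move: (c m./2) (c n./2) (expR _) (laguerre_val _ m./2 _) (laguerre_val _ n./2 _) (_ `^ _) => ? ? ? ? ? ?.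
  ring.
rewrite I -!muln2 eqn_pmul2r//; case: eqVneq => [->|_]; last by rewrite mule0.
by rewrite -EFinM -expr2 /c E ?G.
Qed.

(** From 2|ab| <= a^2 + b^2. The bound is uniform in m and n, which gives the domination in
    [heat_eigen]. *)
Lemma integral_abs_hermite1M nu m n : - 2^-1 <= nu ->
  (\int[mu]_y (`|hermite1 nu m y * hermite1 nu n y| * `|y| `^ (2 * nu + 1))%:E <= 1)%E.
Proof.
move=> nu2.
pose w y : R := `|y| `^ (2 * nu + 1).
have iM k : mu.-integrable setT (fun y => (2^-1%:E * (hermite1 nu k y * hermite1 nu k y * w y)%:E)%E).
  by apply: integrableZl => //; exact: integrable_hermite1M.
apply: (@le_trans _ _ (\int[mu]_y (2^-1%:E * (hermite1 nu m y * hermite1 nu m y * w y)%:E + 2^-1%:E * (hermite1 nu n y * hermite1 nu n y * w y)%:E)))%E.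
  apply: ge0_le_integral => //.
  - apply/measurable_EFinP; apply: measurable_funM.
      apply: measurableT_comp; first exact: normr_measurable.
      by apply: measurable_funM; exact: measurable_hermite1.
    by apply: (measurableT_comp (measurable_powR _)); exact: normr_measurable.
  - by apply: emeasurable_funD; exact: measurable_int (iM _).
  - move=> y _; rewrite -!EFinM -EFinD lee_fin normrM.
    rewrite -[hermite1 nu m y * hermite1 nu m y]expr2 -[hermite1 nu n y * hermite1 nu n y]expr2.
    rewrite -(real_normK (num_real (hermite1 nu m y))) -(real_normK (num_real (hermite1 nu n y))).
    have w0 : 0 <= w y by exact: powR_ge0.
    rewrite -/(w y) !mulrA -mulrDl ler_wpM2r//.
    by have := sqr_ge0 (`|hermite1 nu m y| - `|hermite1 nu n y|); nra.
rewrite integralD//.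
rewrite !integralZl//; [|exact: integrable_hermite1M|exact: integrable_hermite1M].
rewrite /w !hermite1_orthonormal// !eqxx -!EFinM -EFinD lee_fin /= !mulr1; lra.
Qed.

(** The series is integrated term by term by dominated convergence: the dominating function has
    integral at most the sum of s^i (1 + h_i(y)^2), a geometric series plus the heat series at (y,
    y). Orthonormality keeps only the term i = k. *)
Lemma heat_eigen nu s y k : - 2^-1 <= nu -> 0 < s < 1 ->
  (\int[mu]_x (limn (series (heat_term nu s x y)) * hermite1 nu k x * `|x| `^ (2 * nu + 1))%:E =
   (s ^+ k * hermite1 nu k y)%:E)%E.
Proof.
move=> nu2 s01; have /andP[s0 s1] := s01.
pose w x : R := `|x| `^ (2 * nu + 1).
have w0 x : 0 <= w x by exact: powR_ge0.
have mw : measurable_fun setT w.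
  by apply: (measurableT_comp (measurable_powR _)); exact: normr_measurable.
have mh n : measurable_fun setT (hermite1 nu n) by exact: measurable_hermite1.
have mt i : measurable_fun setT (fun x => heat_term nu s x y i).
  by do 2 apply: measurable_funM => //.
pose f_ n (x : measurableTypeR R) := (series (heat_term nu s x y) n * hermite1 nu k x * w x)%:E.
pose f (x : measurableTypeR R) := (limn (series (heat_term nu s x y)) * hermite1 nu k x * w x)%:E.
pose G i x := ((s ^+ i * `|hermite1 nu i y|)%:E * (`|hermite1 nu i x * hermite1 nu k x| * w x)%:E)%E.
pose g (x : measurableTypeR R) := (\sum_(i <oo) G i x)%E.
have G0 i x : (0 <= G i x)%E by rewrite mule_ge0// lee_fin mulr_ge0// exprn_ge0// ltW.
have mG i : measurable_fun setT (G i).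
  apply: emeasurable_funM => //; apply/measurable_EFinP; apply: measurable_funM => //.
  apply: measurableT_comp; first exact: normr_measurable.
  by apply: measurable_funM; exact: measurable_hermite1.
have mf_ n : measurable_fun setT (f_ n).
  apply/measurable_EFinP; apply: measurable_funM; last exact: mw.
  apply: measurable_funM; last exact: mh.
  by apply: measurable_sum => i; exact: mt.
have f_f x : f_ ^~ x @ \oo --> f x.
  have [/normed_cvg c _] := mehler x y nu2 s01.
  apply: cvg_EFin; first exact: nearW.
  by apply: cvgMr_tmp; apply: cvgMr_tmp; exact: c.
have sumy : cvgn (series (fun i => s ^+ i * (1 + hermite1 nu i y ^+ 2))).
  have [/normed_cvg c _] := mehler y y nu2 s01.
  have c2 : cvgn (series (geometric 1 s)).
    by apply: is_cvg_geometric_series; rewrite gtr0_norm.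
  apply/cvg_ex; exists (limn (series (geometric 1 s)) + limn (series (heat_term nu s y y))).
  apply: (@eq_cvgn _ (fun n => series (geometric 1 s) n + series (heat_term nu s y y) n)) => [j|].
    rewrite /series /= -big_split /=; apply: eq_bigr => i _.
    by rewrite /heat_term mul1r; ring.
  exact: cvgD.
have gfin : (\int[mu]_x g x < +oo)%E.
  rewrite integral_nneseries//.
  apply: (@le_lt_trans _ _ (\sum_(i <oo) (s ^+ i * (1 + hermite1 nu i y ^+ 2))%:E)%E).
    apply: lee_nneseries => // i _; first by move=> _; apply: integral_ge0.
    rewrite /G ge0_integralZl//; last 3 first.
    - apply/measurable_EFinP; apply: measurable_funM => //.
      apply: measurableT_comp; first exact: normr_measurable.
      by apply: measurable_funM; exact: measurable_hermite1.
    - by move=> x _; rewrite lee_fin mulr_ge0.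
    - by rewrite lee_fin mulr_ge0// exprn_ge0// ltW.
    have si : 0 <= s ^+ i by rewrite exprn_ge0// ltW.
    apply: (@le_trans _ _ ((s ^+ i * `|hermite1 nu i y|)%:E * 1)%E).
      by rewrite lee_wpmul2l ?lee_fin ?mulr_ge0//; exact: integral_abs_hermite1M.
    rewrite mule1 lee_fin ler_wpM2l//.
    by rewrite -(real_normK (num_real (hermite1 nu i y))); have := normr_ge0 (hermite1 nu i y); nra.
  have /cvg_ex[l hl] := sumy.
  by rewrite ((cvg_series_nneseries _ _).1 hl) ?ltry// => i; rewrite mulr_ge0 ?exprn_ge0 ?ltW// ltr_wpDr ?sqr_ge0.
have g0 x : (0 <= g x)%E by exact: nneseries_ge0.
have mg : measurable_fun setT g.
  by apply: ge0_emeasurable_sum => [i x _ _|i _]; [exact: G0|exact: mG].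
have ig : mu.-integrable setT g.
  apply/integrableP; split => //.
  by under eq_integral do rewrite gee0_abs//.
have f_g x n : (`|f_ n x| <= g x)%E.
  apply: (@le_trans _ _ (\sum_(0 <= i < n) G i x)%E); last exact: nneseries_lim_ge.
  rewrite /f_ abse_EFin /G; under [leRHS]eq_bigr do rewrite -EFinM.
  rewrite sumEFin lee_fin -mulrA /series /= mulr_suml.
  apply: le_trans (ler_norm_sum _ _ _) _; apply: ler_sum => i _.
  rewrite /heat_term !normrM (ger0_norm (w0 x)) ger0_norm; last by rewrite exprn_ge0// ltW.
  by rewrite [leLHS](_ : _ = s ^+ i * `|hermite1 nu i y| * (`|hermite1 nu i x| * `|hermite1 nu k x| * w x))//; ring.
have mf : measurable_fun setT f by apply: (emeasurable_fun_cvg f_) => // x _; exact: f_f.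
have ae1 : {ae lebesgue_measure, forall x : measurableTypeR R, setT x -> f_ ^~ x @ \oo --> f x}.
  by apply: aeW => x _; exact: f_f.
have ae2 : {ae lebesgue_measure, forall (x : measurableTypeR R) n, setT x -> (`|f_ n x| <= g x)%E}.
  by apply: aeW => x n _; exact: f_g.
have [_ _ lim_f] := dominated_convergence measurableT mf_ mf ae1 ig ae2.
have If n : (\int[mu]_x f_ n x = (\sum_(i < n) s ^+ i * hermite1 nu i y * (i == k :> nat)%:R)%:E)%E.
  have iT i : mu.-integrable setT (fun x => ((s ^+ i * hermite1 nu i y)%:E * (hermite1 nu i x * hermite1 nu k x * w x)%:E)%E).
    by apply: integrableZl => //; exact: integrable_hermite1M.
  transitivity (\int[mu]_x \sum_(i < n) ((s ^+ i * hermite1 nu i y)%:E * (hermite1 nu i x * hermite1 nu k x * w x)%:E))%E.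
    apply: eq_integral => x _; rewrite /f_ /series /= big_mkord !mulr_suml -sumEFin; apply: eq_bigr => i _.
    by rewrite -EFinM /heat_term; congr EFin; ring.
  rewrite integral_sum// -sumEFin; apply: eq_bigr => i _.
  by rewrite integralZl//; [rewrite hermite1_orthonormal|exact: integrable_hermite1M].
have lim_k : (\int[mu]_x f_ n x)%E @[n --> \oo] --> (s ^+ k * hermite1 nu k y)%:E.
  apply: cvg_near_cst; exists k.+1 => // n kn; rewrite If.
  rewrite (bigD1 (Ordinal kn))//= eqxx mulr1 big1 ?addr0// => i ik.
  by rewrite (_ : (i == k :> nat) = false) ?mulr0//; apply: negbTE; apply: contra ik => /eqP ik; apply/eqP/val_inj.
exact: (cvg_unique _ lim_f lim_k).
Qed.

End orthonormality.

(** * Integration against the Dunkl measure *)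

Section density.
Context {d : measure_display} {T : measurableType d} {R : realType}.
Variables (m nu : {measure set T -> \bar R}) (w : T -> R).
Hypotheses (mw : measurable_fun setT w) (w0 : forall x, 0 <= w x).
Hypothesis nuE : forall A, measurable A -> nu A = (\int[m]_(x in A) (w x)%:E)%E.
Local Open Scope ereal_scope.
Import HBNNSimple.

(** [dunkl_measure] is defined by its values on sets; approximation by simple functions turns its
    integrals into weighted Lebesgue integrals. *)
Lemma ge0_integral_density (f : T -> \bar R) : measurable_fun setT f -> (forall x, 0 <= f x) ->
  \int[nu]_x f x = \int[m]_x (f x * (w x)%:E).
Proof.
move=> mf f0.
have mwE : measurable_fun setT (EFin \o w) by exact/measurable_EFinP.
have w0E x : 0 <= (w x)%:E by rewrite lee_fin.
pose h := nnsfun_approx measurableT mf.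
have hf x : (h n x)%:E @[n --> \oo] --> f x by exact: cvg_nnsfun_approx.
have -> : \int[nu]_x f x = limn (fun n => \int[nu]_x (h n x)%:E).
  rewrite -monotone_convergence//.
  - by apply: eq_integral => x _; apply/esym/cvg_lim.
  - by move=> n; exact/measurable_EFinP/measurable_funP.
  - by move=> n y _; rewrite lee_fin.
  - by move=> y _ i j ij; rewrite lee_fin; exact/lefP/nd_nnsfun_approx.
have -> : \int[m]_x (f x * (w x)%:E) = limn (fun n => \int[m]_x ((h n x)%:E * (w x)%:E)).
  rewrite -monotone_convergence//.
  - by apply: eq_integral => x _; apply/esym/cvg_lim => //; apply: cvgeZr.
  - by move=> n; apply: emeasurable_funM => //; exact/measurable_EFinP/measurable_funP.
  - by move=> n y _; rewrite mule_ge0// lee_fin.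
  - by move=> y _ i j ij; rewrite lee_wpmul2r// lee_fin; exact/lefP/nd_nnsfun_approx.
congr (limn _); apply/funext => n.
transitivity (\sum_(k \in range (h n)) k%:E * \int[nu]_x (\1_(h n @^-1` [set k]) x)%:E).
  under eq_integral do rewrite fimfunE -fsumEFin//.
  rewrite ge0_integral_fsum//; last 2 first.
  - by move=> y; exact/measurable_EFinP/measurable_funM.
  - by move=> y x _; rewrite nnfun_muleindic_ge0.
  apply: eq_fsbigr => r _; under eq_integral do rewrite EFinM.
  by rewrite integralZl_indic_nnsfun// integral_indic//= setIT.
transitivity (\sum_(k \in range (h n)) \int[m]_x ((k * \1_(h n @^-1` [set k]) x)%:E * (w x)%:E)); last first.
  rewrite -ge0_integral_fsum//; last 2 first.
  - by move=> y; apply: emeasurable_funM => //; exact/measurable_EFinP/measurable_funM.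
  - by move=> y x _; rewrite mule_ge0// nnfun_muleindic_ge0.
  apply: eq_integral => x _; rewrite [in RHS](fimfunE (h n)) -fsumEFin//.
  by rewrite ge0_mule_fsuml// => r; rewrite nnfun_muleindic_ge0.
apply: eq_fsbigr => k; rewrite inE => -[x0 _ hk].
have k0 : (0 <= k)%R by rewrite -hk.
rewrite integral_indic// setIT nuE// integral_mkcond.
have mr : measurable_fun [set: T] ((EFin \o w) \_ (h n @^-1` [set k])).
  by apply/(measurable_restrictT _ _).1 => //; exact: measurable_funTS.
rewrite -ge0_integralZl//.
- apply: eq_integral => x _; rewrite patchE indicE.
  by case: (x \in _); rewrite /= ?mulr1// mulr0 mul0e mule0.
- by move=> x _; apply: erestrict_ge0.
Qed.

Lemma integrable_density (f : T -> R) : measurable_fun setT f ->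
  m.-integrable setT (fun x => (f x * w x)%:E) <-> nu.-integrable setT (EFin \o f).
Proof.
move=> mf.
have E : \int[m]_x `|(f x * w x)%:E| = \int[nu]_x `|(f x)%:E|.
  rewrite ge0_integral_density//; last by apply/measurable_EFinP; exact: measurableT_comp.
  by apply: eq_integral => x _; rewrite EFinM abseM (gee0_abs (_ : 0 <= (w x)%:E)) ?lee_fin.
split=> /integrableP[_ h]; apply/integrableP; split.
- exact/measurable_EFinP.
- by move: h; rewrite E.
- by apply/measurable_EFinP; exact: measurable_funM.
- by rewrite E.
Qed.

Lemma integral_density (f : T -> R) : measurable_fun setT f ->
  \int[nu]_x (f x)%:E = \int[m]_x (f x * w x)%:E.
Proof.
move=> mf; have mfE : measurable_fun setT (EFin \o f) by exact/measurable_EFinP.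
rewrite integralE [RHS]integralE !ge0_integral_density//.
- congr (_ - _); apply: eq_integral => x _.
    by rewrite !funeposE -!EFin_max -EFinM maxr_pMl// mul0r.
  by rewrite !funenegE -!EFinN -!EFin_max -EFinM maxr_pMl// mul0r mulNr.
- exact: measurable_funeneg.
- exact: measurable_funepos.
Qed.

End density.

Section tuple_integral.
Context {R : realType}.
Local Notation mu := (@lebesgue_measure R).
Local Open Scope ereal_scope.

(** By induction on the dimension, with Fubini's theorem carried along [cons_point]. In dimension 0
    the measure is a Dirac mass and the empty product integrates to 1. *)
Lemma integral_lebesgue_tuple_prod n (f : 'I_n -> R -> R) :
  (forall i, mu.-integrable setT (EFin \o f i)) ->
  (lebesgue_tuple R n).-integrable setT (fun x => (\prod_i f i (tnth x i))%:E) /\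
  \int[lebesgue_tuple R n]_x (\prod_i f i (tnth x i))%:E =
  (\prod_i fine (\int[mu]_x (f i x)%:E))%:E.
Proof.
elim: n f => [f _|n IH f fi].
  have E : (fun x : 0.-tuple (measurableTypeR R) => (\prod_i f i (tnth x i))%:E) = cst 1.
    by apply/funext => x; rewrite big_ord0.
  rewrite E; split.
    apply/integrableP; split => //; under eq_integral do rewrite /= normr1.
    by rewrite /= integral_dirac// diracT mul1e ltry.
  by rewrite /= integral_dirac// diracT mul1e big_ord0.
have mf i : measurable_fun setT (f i).
  by have /integrableP[/measurable_EFinP] := fi i.
pose F (x : n.+1.-tuple (measurableTypeR R)) := (\prod_i f i (tnth x i))%:E.
have mF : measurable_fun setT F.
  apply/measurable_EFinP; apply: measurable_prod => i _.
  by apply: (measurableT_comp (mf i)); exact: measurable_tnth.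
have mc := @measurable_cons_point R n.
have FE z : F (cons_point z) = (f ord0 z.1)%:E * (\prod_(i < n) f (lift ord0 i) (tnth z.2 i))%:E.
  rewrite /F big_ord_recl EFinM /cons_point; congr (_%:E * _%:E).
  by apply: eq_bigr => i _; rewrite tnthS.
have [iP IP] := IH (fun i => f (lift ord0 i)) (fun i => fi _).
pose P (z : n.-tuple (measurableTypeR R)) := (\prod_(i < n) f (lift ord0 i) (tnth z i))%:E.
have iF : (mu \x lebesgue_tuple R n).-integrable setT (F \o cons_point).
  apply/integrable12ltyP; first exact: measurableT_comp.
  rewrite (_ : (fun x => _) = (fun x => `|(f ord0 x)%:E| * \int[lebesgue_tuple R n]_z `|P z|)).
    rewrite ge0_integralZr//.
    - rewrite lte_mul_pinfty ?integral_ge0//; last by case/integrableP : iP.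
      by rewrite ge0_fin_numE ?integral_ge0//; have /integrableP[_] := fi ord0.
    - by have /integrableP[h _] := fi ord0; apply: (measurableT_comp _ h).
    - exact: integral_ge0.
  apply/funext => x; rewrite -ge0_integralZl//.
  - by apply: eq_integral => z _; rewrite -abseM -(FE (x, z)).
  - by apply: measurableT_comp => //; case/integrableP : iP.
have [IF EF] : (lebesgue_tuple R n.+1).-integrable setT F /\
  \int[lebesgue_tuple R n.+1]_x F x = \int[mu \x lebesgue_tuple R n]_z F (cons_point z).
  split; first by apply: integrable_pushforward.
  by rewrite /= /lebesgue_cons integral_pushforward.
split => //; rewrite EF -integral12_prod_meas1//.
rewrite (_ : (fun x => _) = (fun x => (f ord0 x)%:E * \int[lebesgue_tuple R n]_z P z)); last first.
  by apply/funext => x; rewrite -integralZl//; apply: eq_integral => z _; rewrite -(FE (x, z)).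
rewrite /P IP.
rewrite integralZr//; last exact: fi.
rewrite big_ord_recl EFinM fineK//.
by apply: (integrable_fin_num measurableT); exact: fi.
Qed.

End tuple_integral.

Section dunkl_integral.
Context {R : realType} {d : nat}.
Variable alpha : 'I_d -> R.
Local Notation lambda := (@lebesgue_measure R).
Local Notation mu := (dunkl_measure alpha).
Local Open Scope ereal_scope.

Lemma integral_dunkl_prod (f : 'I_d -> R -> R) : (forall i, measurable_fun setT (f i)) ->
  (forall i, lambda.-integrable setT (fun x => (f i x * `|x| `^ (2 * alpha i + 1))%:E)) ->
  mu.-integrable setT (fun x => (\prod_i f i (tnth x i))%:E) /\
  \int[mu]_x (\prod_i f i (tnth x i))%:E =
  (\prod_i fine (\int[lambda]_x (f i x * `|x| `^ (2 * alpha i + 1))%:E))%:E.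
Proof.
move=> mf fi; have [I E] := integral_lebesgue_tuple_prod fi.
have mw := measurable_dunkl_weight alpha.
have mP : measurable_fun setT (fun x : d.-tuple (measurableTypeR R) => \prod_i f i (tnth x i))%R.
  by apply: measurable_prod => i _; apply: (measurableT_comp (mf i)); exact: measurable_tnth.
have PE : (fun x : d.-tuple (measurableTypeR R) =>
    (\prod_i (f i (tnth x i) * `|tnth x i| `^ (2 * alpha i + 1)))%:E) =
    (fun x => ((\prod_i f i (tnth x i)) * dunkl_weight alpha x)%:E).
  by apply/funext => x; rewrite big_split.
rewrite PE in I; split.
  have D A : measurable A -> mu A = \int[lebesgue_tuple R d]_(x in A) (dunkl_weight alpha x)%:E by [].
  by have [h _] := @integrable_density _ _ _ _ mu _ mw (dunkl_weight_ge0 alpha) D _ mP; exact: h.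
rewrite -E; under [RHS]eq_integral do rewrite big_split.
exact: (integral_density mw (dunkl_weight_ge0 alpha) _ mP).
Qed.

End dunkl_integral.

Section dunkl_sigma_finite.
Context {R : realType} {d : nat}.
Variable alpha : 'I_d -> R.
Local Notation mu := (dunkl_measure alpha).
Local Notation w := (dunkl_weight alpha).
Local Open Scope ereal_scope.

(** An exhaustion by sets of finite Lebesgue measure is intersected with the sets where the weight
    is at most n. *)
Lemma dunkl_measure_sigma_finite : sigma_finite setT mu.
Proof.
have mw := measurable_dunkl_weight alpha.
have /sigma_finiteP[F [FT ndF Foo]] := sigma_finiteT (lebesgue_tuple R d).
pose G n := F n `&` [set x | (w x <= n%:R)%R].
have mG n : measurable (G n).
  apply: measurableI; first by have [] := Foo n.
  rewrite (_ : [set x | _] = setT `&` w @^-1` [set` `]-oo, n%:R]]); first exact: mw.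
  by rewrite setTI; apply/seteqP; split => x /=; rewrite in_itv.
exists G.
  apply/esym; rewrite -subTset => x _.
  have [i _ Fi] : (\bigcup_k F k) x by rewrite -FT.
  exists (maxn i (Num.trunc (w x)).+1) => //; split.
    by move: Fi; exact/subsetPset/ndF/leq_maxl.
  rewrite /=; apply: le_trans (ltW (truncnS_gt (w x))) _.
  by rewrite ler_nat leq_maxr.
move=> n; split => //; have [mF Fn] := Foo n.
apply: (@le_lt_trans _ _ (\int[lebesgue_tuple R d]_(x in G n) (n%:R)%:E)).
  apply: ge0_le_integral => //.
  - by move=> x _; rewrite lee_fin dunkl_weight_ge0.
  - by apply/measurable_EFinP; exact: measurable_funTS.
  - by move=> x [_ /=]; rewrite lee_fin.
rewrite integral_cst// lte_mul_pinfty// ?lee_fin//.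
by apply: le_lt_trans Fn; apply: le_measure; rewrite ?inE//; exact: subIsetl.
Qed.

HB.instance Definition _ := Measure_isSigmaFinite.Build _ _ _ mu dunkl_measure_sigma_finite.

End dunkl_sigma_finite.

(** * The heat kernel in dimension d *)

Section series_product.
Context {R : realType}.

(** In [heat_kernel] the type of multi-indices depends on their weight i. Entries are at most the
    weight, so for i < n all these simplices embed in the cube of side n. *)
Lemma sum_multi_index (d n : nat) (a : 'I_d -> nat -> R) :
  \sum_(i < n) \sum_(k : {ffun 'I_d -> 'I_i.+1} | (\sum_j k j == i)%N) \prod_j a j (k j) =
  \sum_(k : {ffun 'I_d -> 'I_n} | (\sum_j k j < n)%N) \prod_j a j (k j).
Proof.
case: n => [|n].
  rewrite big_ord0 big_pred0// => k; apply/negbTE; by rewrite -leqNgt.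
transitivity (\sum_(i < n.+1) \sum_(k : {ffun 'I_d -> 'I_n.+1} | (\sum_j k j == i)%N) \prod_j a j (k j)).
  apply: eq_bigr => i _.
  pose h (k : {ffun 'I_d -> 'I_i.+1}) : {ffun 'I_d -> 'I_n.+1} := [ffun j => inord (k j)].
  pose g (k : {ffun 'I_d -> 'I_n.+1}) : {ffun 'I_d -> 'I_i.+1} := [ffun j => inord (k j)].
  have hE k j : h k j = k j :> nat.
    by rewrite ffunE inordK// (leq_trans (ltn_ord (k j))).
  rewrite [RHS](reindex_onto h g); last first.
    move=> k /eqP ki; apply/ffunP => j; apply: val_inj; rewrite /= hE /g ffunE inordK//.
    by rewrite ltnS -ki (bigD1 j)//= leq_addr.
  apply: eq_big => [k|k _]; last by apply: eq_bigr => j _; rewrite hE.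
  have -> : g (h k) == k.
    by apply/eqP/ffunP => j; apply: val_inj; rewrite /g ffunE /= hE inordK.
  by rewrite andbT; under [in RHS]eq_bigr do rewrite hE.
under eq_bigr do rewrite big_mkcond.
rewrite exchange_big /= [RHS]big_mkcond /=; apply: eq_bigr => k _.
case: ifPn => [kn|]; last first.
  rewrite -leqNgt => nk; apply: big1 => i _; case: ifPn => // /eqP ki.
  by have := ltn_ord i; rewrite -ki ltnNge nk.
rewrite (bigD1 (Ordinal kn))//= eqxx [X in _ + X]big1 ?addr0// => i ik; case: ifPn => // /eqP ki.
by move: ik; rewrite -val_eqE /= ki eqxx.
Qed.

Lemma cvg_prodr (I : finType) (u : I -> R ^nat) (l : I -> R) :
  (forall i, u i n @[n --> \oo] --> l i) -> \prod_i u i n @[n --> \oo] --> \prod_i l i.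
Proof.
move=> ul; move: (index_enum I) => r; elim: r => [|i r IH].
  by rewrite big_nil; under eq_fun do rewrite big_nil; exact: cvg_cst.
by rewrite big_cons; under eq_fun do rewrite big_cons; exact: cvgM.
Qed.

(** The simplex |k| < n lies in the cube of side n and contains the cube of side n/d. Hence its sum
    differs from the product of the n-th partial sums by at most the difference, between these two
    cubes, of the products of absolute partial sums; both products have the same limit. *)
Lemma cvg_series_prod (d : nat) (a : 'I_d -> R ^nat) : (0 < d)%N ->
  (forall i, cvgn (series (fun n => `|a i n|))) ->
  series (fun n => \sum_(k : {ffun 'I_d -> 'I_n.+1} | (\sum_j k j == n)%N) \prod_j a j (k j)) n
    @[n --> \oo] --> \prod_i limn (series (a i)).
Proof.
move=> d0 ca.
pose S i n := series (a i) n; pose S' i n := series (fun n => `|a i n|) n.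
have cS : \prod_i S i n @[n --> \oo] --> \prod_i limn (series (a i)).
  by apply: cvg_prodr => i; have /normed_cvg := ca i.
have cS' : \prod_i S' i n @[n --> \oo] --> \prod_i limn (S' i).
  by apply: cvg_prodr => i; exact: ca.
have cS2 : \prod_i S' i (n %/ d)%N @[n --> \oo] --> \prod_i limn (S' i).
  apply: (cvg_comp (fun n => n %/ d)%N (fun n => \prod_i S' i n) _ cS').
  move=> /= A [N _ NA]; exists (N * d)%N => // n /= Nn; apply: NA => /=.
  by rewrite leq_divRL.
have prodE (b : 'I_d -> R ^nat) n : \prod_i series (b i) n =
    \sum_(k : {ffun 'I_d -> 'I_n}) \prod_j b j (k j).
  by rewrite /series /=; under eq_bigr do rewrite big_mkord; rewrite bigA_distr_bigA.
pose B n := series (fun n => \sum_(k : {ffun 'I_d -> 'I_n.+1} | (\sum_j k j == n)%N) \prod_j a j (k j)) n.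
have le n : `|\prod_i S i n - B n| <= \prod_i S' i n - \prod_i S' i (n %/ d)%N.
  have -> : B n = \sum_(k : {ffun 'I_d -> 'I_n} | (\sum_j k j < n)%N) \prod_j a j (k j).
    by rewrite -sum_multi_index /B /series /= big_mkord.
  rewrite /S prodE (bigID (fun k : {ffun 'I_d -> 'I_n} => (\sum_j k j < n)%N))/= addrAC subrr add0r.
  have -> : \prod_i S' i n = \sum_(k : {ffun 'I_d -> 'I_n}) \prod_j `|a j (k j)| by rewrite /S' prodE.
  rewrite [X in _ <= X - _](bigID (fun k : {ffun 'I_d -> 'I_n} => (\sum_j k j < n)%N))/= addrAC -[leLHS]add0r lerD//.
    rewrite subr_ge0.
    have -> : \prod_i S' i (n %/ d)%N =
        \sum_(k : {ffun 'I_d -> 'I_n} | k \in ffun_on [pred j : 'I_n | (j < n %/ d)%N]) \prod_j `|a j (k j)|.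
      transitivity (\prod_i \sum_(j < n | [pred j : 'I_n | (j < n %/ d)%N] j) `|a i j|); last by rewrite bigA_distr_big.
      apply: eq_bigr => i _.
      by rewrite /S' /series /= big_mkord (big_ord_widen n (fun j => `|a i j|))// leq_div.
    rewrite big_mkcond [leRHS]big_mkcond /=; apply: ler_sum => k _.
    case: ifPn => kon; last by case: ifP => // _; exact: prodr_ge0.
    suff -> : (\sum_j k j < n)%N by [].
    have kj j : (k j < n %/ d)%N by have /ffun_onP/(_ j) := kon.
    apply: leq_trans (leq_trunc_div n d).
    rewrite mulnC -[X in (_ < X * _)%N](card_ord d) -sum_nat_const.
    rewrite (bigD1 (Ordinal d0))//= [ltnRHS](bigD1 (Ordinal d0))//= -addSn leq_add//.
    by apply: leq_sum => j _; exact: ltnW.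
  apply: le_trans (ler_norm_sum _ _ _) _; apply: ler_sum => k _.
  by rewrite normr_prod.
have c0 : \prod_i S' i n - \prod_i S' i (n %/ d)%N @[n --> \oo] --> (0 : R).
  by rewrite -(subrr (\prod_i limn (S' i))); exact: cvgB.
have : \prod_i S i n - B n @[n --> \oo] --> (0 : R).
  apply/norm_cvg0P; apply: (squeeze_cvgr _ (cvg_cst 0) c0).
  by apply: nearW => n; rewrite normr_ge0 le.
move=> /(cvgB cS); rewrite subr0.
rewrite (_ : (_ - _) = B) //.
by apply/funext => n; rewrite /GRing.add /= /GRing.opp /= subKr.
Qed.

End series_product.

Section heat_kernel.
Context {R : realType} {d : nat}.
Variable alpha : 'I_d -> R.
Hypotheses (d0 : (0 < d)%N) (a2 : forall i, - 2^-1 <= alpha i).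
Local Notation D := (hom_dim alpha).

Lemma hom_dimE : D = \sum_i (alpha i + 1).
Proof. by rewrite /hom_dim big_split /= sumr_const card_ord. Qed.

Lemma hom_dim_gt0 : 0 < D.
Proof.
rewrite hom_dimE (bigD1 (Ordinal d0))//= ltr_pwDl//; first by have := a2 (Ordinal d0); lra.
by apply: sumr_ge0 => i _; have := a2 i; lra.
Qed.

Lemma expR_lt01 (t : R) : 0 < t -> 0 < expR (- (2 * t)) < 1.
Proof. by move=> t0; rewrite expR_gt0 -[X in _ < X]expR0 ltr_expR; lra. Qed.

Lemma prod_powR_expR (t : R) : \prod_i expR (- (2 * t)) `^ (alpha i + 1) = expR (- (2 * t * D)).
Proof.
rewrite hom_dimE mulr_sumr -sumrN expR_sum; apply: eq_bigr => i _.
by rewrite -expRM mulNr mulrC -mulrN.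
Qed.

Lemma heat_kernel_term (t : R) x y n :
  expR (- t * eigenvalue_of alpha n) *
    \sum_(k : {ffun 'I_d -> 'I_n.+1} | (\sum_(i < d) k i == n)%N)
      hermite alpha (fun i => k i) x * hermite alpha (fun i => k i) y =
  expR (- (2 * t * D)) *
    \sum_(k : {ffun 'I_d -> 'I_n.+1} | (\sum_(i < d) k i == n)%N)
      \prod_i heat_term (alpha i) (expR (- (2 * t))) (tnth x i) (tnth y i) (k i).
Proof.
rewrite !mulr_sumr; apply: eq_bigr => k /eqP kn.
rewrite /heat_term /hermite big_split big_split /= [RHS]mulrA; congr (_ * _).
rewrite prodrXr kn -expRM_natl -expRD /eigenvalue_of; congr expR.
by rewrite -mulr_natl; ring.
Qed.

Lemma heat_kernel_cvg (t : R) x y : 0 < t ->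
  series (fun n : nat => expR (- t * eigenvalue_of alpha n) *
    \sum_(k : {ffun 'I_d -> 'I_n.+1} | (\sum_(i < d) k i == n)%N)
      hermite alpha (fun i => k i) x * hermite alpha (fun i => k i) y) n @[n --> \oo] -->
  \prod_i (expR (- (2 * t)) `^ (alpha i + 1) *
    limn (series (heat_term (alpha i) (expR (- (2 * t))) (tnth x i) (tnth y i)))).
Proof.
move=> t0; rewrite big_split /= prod_powR_expR.
rewrite (_ : series _ = (fun n => expR (- (2 * t * D)) *
  series (fun n => \sum_(k : {ffun 'I_d -> 'I_n.+1} | (\sum_(i < d) k i == n)%N)
      \prod_i heat_term (alpha i) (expR (- (2 * t))) (tnth x i) (tnth y i) (k i)) n)).
  apply: cvgM; first exact: cvg_cst.
  apply: cvg_series_prod => // i.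
  by have [] := mehler (tnth x i) (tnth y i) (a2 i) (expR_lt01 t0).
by apply/funext => n; rewrite /series /= mulr_sumr; apply: eq_bigr => i _; rewrite heat_kernel_term.
Qed.

Lemma heat_kernelE (t : R) x y : 0 < t -> heat_kernel alpha t x y =
  \prod_i (expR (- (2 * t)) `^ (alpha i + 1) *
    limn (series (heat_term (alpha i) (expR (- (2 * t))) (tnth x i) (tnth y i)))).
Proof. by move=> t0; apply/cvg_lim => //; exact: heat_kernel_cvg. Qed.

(* It dominates the heat kernel and has its size, so that the positivity of the latter is not needed. *)
Definition heat_majorant (t : R) (x y : d.-tuple (measurableTypeR R)) : R :=
  \prod_i (5 / 2 * laguerre_kernel (alpha i) (expR (- (2 * t))) (tnth x i) (tnth y i)).

Lemma heat_majorant_ge0 t x y : 0 <= heat_majorant t x y.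
Proof. by apply: prodr_ge0 => i _; rewrite mulr_ge0// laguerre_kernel_ge0. Qed.

Lemma heat_majorantC t x y : heat_majorant t x y = heat_majorant t y x.
Proof. by apply: eq_bigr => i _; rewrite laguerre_kernelC. Qed.

Lemma norm_heat_kernel_le (t : R) x y : 0 < t -> `|heat_kernel alpha t x y| <= heat_majorant t x y.
Proof.
move=> t0; rewrite heat_kernelE// normr_prod; apply: ler_prod => i _; rewrite normr_ge0/=.
by have [] := mehler (tnth x i) (tnth y i) (a2 i) (expR_lt01 t0).
Qed.

Lemma measurable_heat_majorant : measurable_fun setT
  (fun z : (R * (d.-tuple (measurableTypeR R) * d.-tuple (measurableTypeR R))) => heat_majorant z.1 z.2.1 z.2.2).
Proof.
apply: measurable_prod => i _; apply: measurable_funM => //.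
apply: measurable_laguerre_kernel => //.
- by apply: measurable_fun_expR; apply: measurableT_comp => //; apply: measurable_funM.
- apply: (measurableT_comp (measurable_tnth i)).
  by apply: (measurableT_comp measurable_fst measurable_snd).
- apply: (measurableT_comp (measurable_tnth i)).
  by apply: (measurableT_comp measurable_snd measurable_snd).
Qed.

(** Restricted to t > 0, where the series converges and the [limn] in the definition is a genuine
    pointwise limit. *)
Lemma measurable_heat_kernel : measurable_fun [set z : measurableTypeR R * (d.-tuple (measurableTypeR R) * d.-tuple (measurableTypeR R)) | 0 < z.1]
  (fun z : (R * (d.-tuple (measurableTypeR R) * d.-tuple (measurableTypeR R))) => heat_kernel alpha z.1 z.2.1 z.2.2).
Proof.
apply: (@measurable_fun_cvg _ _ _ _ (fun n (z : measurableTypeR R * (d.-tuple (measurableTypeR R) * d.-tuple (measurableTypeR R))) =>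
  series (fun n : nat => expR (- z.1 * eigenvalue_of alpha n) *
    \sum_(k : {ffun 'I_d -> 'I_n.+1} | (\sum_(i < d) k i == n)%N)
      hermite alpha (fun i => k i) z.2.1 * hermite alpha (fun i => k i) z.2.2) n)).
  move=> n; apply: measurable_funTS; apply: measurable_sum => m.
  have mH k : measurable_fun setT (hermite alpha k).
    apply: measurable_prod => i _; apply: (measurableT_comp (measurable_hermite1 _ _)).
    exact: measurable_tnth.
  apply: measurable_funM.
    by apply: measurable_fun_expR; apply: measurable_funM => //; exact: measurableT_comp.
  under eq_fun do rewrite -big_filter.
  apply: measurable_sum => k; apply: measurable_funM.
    apply: (measurableT_comp (mH _)); exact: (measurableT_comp measurable_fst measurable_snd).
  apply: (measurableT_comp (mH _)); exact: (measurableT_comp measurable_snd measurable_snd).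
by move=> z /= z0; rewrite heat_kernelE//; exact: heat_kernel_cvg.
Qed.

End heat_kernel.

(** * Bounds for the heat majorant and its integrals *)

Section heat_bounds.
Context {R : realType}.
Local Notation lambda := (@lebesgue_measure R).

Lemma integrable_laguerre_kernel nu s (x : R) : - 2^-1 <= nu -> 0 < s < 1 ->
  lambda.-integrable setT (fun y => (laguerre_kernel nu s x y * `|y| `^ (2 * nu + 1))%:E).
Proof.
move=> nu2 s01; apply/integrableP; split.
  apply/measurable_EFinP; apply: measurable_funM.
    by apply: measurable_laguerre_kernel => //; exact: measurable_cst.
  by apply: measurable_fun_powR; exact: normr_measurable.
under eq_integral => y _ do rewrite gee0_abs ?lee_fin ?(mulr_ge0 (laguerre_kernel_ge0 _ _ _ nu2) (powR_ge0 _ _))//.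
by rewrite integral_laguerre_kernel ?ltry.
Qed.

(** The left side is 1 / (2 sinh(2t)). With e = exp(-t), the inequality e^t >= 1 + t gives e t <= 1
    - e <= 1 - e^4. Raised to the power D, the bound yields the singularity t^(-D) at 0 together
    with the decay e^(-Dt). *)
Lemma expR_ratio_le (t : R) : 0 < t ->
  expR (- (2 * t)) / (1 - expR (- (2 * t)) ^+ 2) <= expR (- t) / t.
Proof.
move=> t0; have e0 := expR_gt0 (- t).
have e2 : expR (- (2 * t)) = expR (- t) ^+ 2 by rewrite -expRM_natl; congr expR; ring.
have e1 : expR (- t) * (1 + t) <= 1.
  by rewrite -ler_pdivlMl// mulr1 -expRN opprK expR_ge1Dx.
rewrite e2; move: e0 e1; move: (expR (- t)) => e e0 e1.
have e4 : 0 < 1 - e ^+ 2 ^+ 2.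
  have : e < 1 by nra.
  by move=> ?; rewrite subr_gt0 expr_lt1 ?sqr_ge0// expr_lt1// ltW.
rewrite ler_pdivrMr// mulrAC ler_pdivlMr// expr2 -!mulrA ler_pM2l//.
have : e * t <= 1 - e by nra.
move=> h; apply: le_trans h _.
have e11 : e < 1 by nra.
have e2e : e ^+ 2 <= e by nra.
have : e ^+ 2 ^+ 2 <= e ^+ 2 by have := sqr_ge0 e; nra.
lra.
Qed.

Section dunkl.
Context {d : nat}.
Variable alpha : 'I_d -> R.
Hypotheses (d0 : (0 < d)%N) (a2 : forall i, - 2^-1 <= alpha i).
Local Notation D := (hom_dim alpha).
Local Notation mu := (dunkl_measure alpha).
Local Notation H := (heat_majorant alpha).

Lemma prod_powR (a : R) : 0 < a -> \prod_i a `^ (alpha i + 1) = a `^ D.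
Proof.
move=> a0; rewrite hom_dimE; elim/big_ind2 : _ => //; first by rewrite powRr0.
by move=> x1 x2 y1 y2 -> ->; rewrite powRD// (gt_eqF a0) implybT.
Qed.

Lemma powR_expR_ratio_le (t : R) : 0 < t ->
  (expR (- (2 * t)) / (1 - expR (- (2 * t)) ^+ 2)) `^ D <= t `^ (- D) * expR (- (D * t)).
Proof.
move=> t0; have D0 := hom_dim_gt0 d0 a2.
have /andP[s0 s1] := expR_lt01 t0.
have s2 : 0 < 1 - expR (- (2 * t)) ^+ 2 by rewrite subr_gt0 expr_lt1// ltW.
apply: le_trans (_ : (expR (- t) / t) `^ D <= _).
  by apply: ge0_ler_powR; rewrite ?nnegrE ?divr_ge0 ?expR_ge0 ?(ltW D0) ?(ltW s2) ?(ltW t0)// expR_ratio_le.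
rewrite powRM ?expR_ge0 ?invr_ge0 ?(ltW t0)// -(powR_inv1 (ltW t0)) -powRrM mulN1r.
by rewrite [leRHS]mulrC -expRM (mulrC D) mulNr.
Qed.

Lemma heat_majorant_le (t : R) x y : 0 < t ->
  H t x y <= (\prod_i (5 / 2 / Gamma (alpha i + 1))) * (t `^ (- D) * expR (- (D * t))).
Proof.
move=> t0; have s01 := expR_lt01 t0; have /andP[s0 s1] := s01.
have s2 : 0 < 1 - expR (- (2 * t)) ^+ 2 by rewrite subr_gt0 expr_lt1// ltW.
have r0 : 0 < expR (- (2 * t)) / (1 - expR (- (2 * t)) ^+ 2) by rewrite divr_gt0.
have G0 i : 0 < Gamma (alpha i + 1) by apply: Gamma_gt0; have := a2 i; lra.
apply: (@le_trans _ _ (\prod_i (5 / 2 / Gamma (alpha i + 1)) * (expR (- (2 * t)) / (1 - expR (- (2 * t)) ^+ 2)) `^ D)); last first.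
  rewrite ler_wpM2l ?powR_expR_ratio_le//.
  by apply: prodr_ge0 => i _; rewrite divr_ge0// ltW.
rewrite -prod_powR// -big_split /=; apply: ler_prod => i _; rewrite mulr_ge0 ?laguerre_kernel_ge0//=.
rewrite -[leRHS]mulrA ler_wpM2l//.
apply: le_trans (laguerre_kernel_le _ _ (a2 i) s01) _.
rewrite [leRHS]mulrC -[leRHS]mulr1 ler_wpM2l ?divr_ge0 ?powR_ge0 ?(ltW (G0 i))//.
rewrite -[leRHS]expR0 ler_expR oppr_le0 mulr_ge0 ?addr_ge0 ?sqr_ge0//.
by rewrite divr_ge0 ?sqr_ge0// mulr_ge0// ltW.
Qed.

Let F i s x : R := (2 * s / (1 + s ^+ 2)) `^ (alpha i + 1) * expR (- (x ^+ 2 / (4 * gauss_rate s))).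

Lemma integral_heat_majorant (t : R) x : 0 < t ->
  (\int[mu]_y (H t x y)%:E = (\prod_i (5 / 2 * F i (expR (- (2 * t))) (tnth x i)))%:E)%E.
Proof.
move=> t0; have s01 := expR_lt01 t0; rewrite /heat_majorant; move: (5 / 2) => c.
have [|i|_ ->] := @integral_dunkl_prod _ _ alpha (fun i y => c * laguerre_kernel (alpha i) (expR (- (2 * t))) (tnth x i) y).
- move=> i; apply: measurable_funM => //.
  by apply: measurable_laguerre_kernel => //; exact: measurable_cst.
- under eq_fun do rewrite -mulrA EFinM.
  by apply: integrableZl => //; exact: integrable_laguerre_kernel.
congr EFin; apply: eq_bigr => i _.
under eq_integral do rewrite -mulrA EFinM.
by rewrite integralZl ?integral_laguerre_kernel//; exact: integrable_laguerre_kernel.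
Qed.

Lemma integral_heat_majorant_le (t : R) x : 0 < t ->
  (\int[mu]_y (H t x y)%:E <= (\prod_(i < d) (5 / 2) * 2 `^ D * expR (- (D * t)))%:E)%E.
Proof.
move=> t0; have s01 := expR_lt01 t0; have /andP[s0 s1] := s01; have D0 := hom_dim_gt0 d0 a2.
rewrite integral_heat_majorant// lee_fin.
apply: (@le_trans _ _ (\prod_(i < d) (5 / 2 * (2 * expR (- (2 * t))) `^ (alpha i + 1)))).
  apply: ler_prod => i _; rewrite mulr_ge0/= ?mulr_ge0 ?powR_ge0 ?expR_ge0//.
  rewrite ler_wpM2l// -lee_fin -integral_laguerre_kernel//.
  exact: integral_laguerre_kernel_le.
rewrite big_split /= -mulrA ler_wpM2l//; first by apply: prodr_ge0.
rewrite prod_powR ?mulr_gt0// powRM ?(ltW s0)// ler_wpM2l ?powR_ge0//.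
(* The decay e^(-2Dt) is weakened to e^(-Dt), the rate of the other two bounds. *)
by rewrite -expRM ler_expR; nra.
Qed.

Lemma integral2_heat_majorant_le (t : R) : 0 < t ->
  (\int[mu]_x \int[mu]_y (H t x y)%:E <=
   (\prod_i (5 / 2 * Gamma (alpha i + 1)) * 4 `^ D * (t `^ (- D) * expR (- (D * t))))%:E)%E.
Proof.
move=> t0; have s01 := expR_lt01 t0; have /andP[s0 s1] := s01; have D0 := hom_dim_gt0 d0 a2.
have s2 : 0 < 1 - expR (- (2 * t)) ^+ 2 by rewrite subr_gt0 expr_lt1// ltW.
have G0 i : 0 < Gamma (alpha i + 1) by apply: Gamma_gt0; have := a2 i; lra.
have IF i : (\int[lambda]_x (F i (expR (- (2 * t))) x * `|x| `^ (2 * alpha i + 1))%:E =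
    (Gamma (alpha i + 1) * (4 * expR (- (2 * t)) / (1 - expR (- (2 * t)) ^+ 2)) `^ (alpha i + 1))%:E)%E.
  rewrite -integral2_laguerre_kernel//; apply: eq_integral => x _.
  by rewrite integral_laguerre_kernel// EFinM.
under eq_integral do rewrite integral_heat_majorant//.
have : (0 : R) <= 5 / 2 by []; move: (5 / 2) => c c0.
have mF i : measurable_fun setT (F i (expR (- (2 * t)))).
  apply: measurable_funM => //; apply: measurable_fun_expR.
  by apply: measurableT_comp => //; apply: measurable_funM => //; exact: measurable_funX.
have iF i : lambda.-integrable setT (fun x => (F i (expR (- (2 * t))) x * `|x| `^ (2 * alpha i + 1))%:E).
  apply/integrableP; split.
    apply/measurable_EFinP; apply: measurable_funM; first exact: mF.
    by apply: measurable_fun_powR; exact: normr_measurable.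
  under eq_integral do rewrite gee0_abs ?lee_fin ?mulr_ge0 ?powR_ge0 ?expR_ge0//.
  by rewrite IF ltry.
have [||_ ->] := @integral_dunkl_prod _ _ alpha (fun i x => c * F i (expR (- (2 * t))) x).
- by move=> i; apply: measurable_funM.
- move=> i; under eq_fun do rewrite -mulrA EFinM.
  exact: integrableZl.
rewrite lee_fin [leLHS](_ : _ = \prod_i (c * Gamma (alpha i + 1) *
    (4 * (expR (- (2 * t)) / (1 - expR (- (2 * t)) ^+ 2))) `^ (alpha i + 1))); last first.
  apply: eq_bigr => i _; under eq_integral do rewrite -mulrA EFinM.
  by rewrite integralZl// IF /= !mulrA.
have r0 := divr_gt0 s0 s2.
rewrite big_split /= (@prod_powR (4 * _)) ?(mulr_gt0 _ r0)//.
rewrite (@powRM _ 4) ?(ltW r0)//.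
rewrite !mulrA -!mulrA !ler_wpM2l ?powR_ge0 ?powR_expR_ratio_le//.
by apply: prodr_ge0 => i _; rewrite mulr_ge0// ltW.
Qed.

(** The interface with the abstract theory: ultracontractivity, the Schur bound and the total mass,
    with one constant. *)
Lemma heat_majorant_bounds : exists2 c, 0 < c & forall t, 0 < t ->
  [/\ forall x y, H t x y <= c * (t `^ (- D) * expR (- (D * t))),
      forall x, (\int[mu]_y (H t x y)%:E <= (c * expR (- (D * t)))%:E)%E &
      (\int[mu]_x \int[mu]_y (H t x y)%:E <= (c * (t `^ (- D) * expR (- (D * t))))%:E)%E].
Proof.
have G0 i : 0 < Gamma (alpha i + 1) by apply: Gamma_gt0; have := a2 i; lra.
set c1 := \prod_i (5 / 2 / Gamma (alpha i + 1)).
set c2 := \prod_(i < d) (5 / 2 : R) * 2 `^ D.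
set c3 := \prod_i (5 / 2 * Gamma (alpha i + 1)) * 4 `^ D.
have c10 : 0 < c1 by apply: prodr_gt0 => i _; rewrite divr_gt0.
have c20 : 0 < c2 by rewrite mulr_gt0 ?powR_gt0//; apply: prodr_gt0.
have c30 : 0 < c3 by rewrite mulr_gt0 ?powR_gt0//; apply: prodr_gt0 => i _; rewrite mulr_gt0.
exists (c1 + c2 + c3); first by rewrite !addr_gt0.
move=> t t0; split.
- move=> x y; apply: le_trans (heat_majorant_le _ _ t0) _.
  by rewrite ler_wpM2r ?mulr_ge0 ?powR_ge0 ?expR_ge0//; rewrite -/c1; lra.
- move=> x; apply: le_trans (integral_heat_majorant_le _ t0) _.
  by rewrite lee_fin ler_wpM2r ?expR_ge0//; rewrite -/c2; lra.
- apply: le_trans (integral2_heat_majorant_le t0) _.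
  by rewrite lee_fin ler_wpM2r ?mulr_ge0 ?powR_ge0 ?expR_ge0//; rewrite -/c3; lra.
Qed.

Lemma integral_heat_kernel_hermite (k : 'I_d -> nat) (t : R) y : 0 < t ->
  (\int[mu]_x (heat_kernel alpha t x y * hermite alpha k x)%:E =
   (expR (- (t * eigenvalue_of alpha (\sum_(i < d) k i))) * hermite alpha k y)%:E)%E.
Proof.
move=> t0; have s01 := expR_lt01 t0; have /andP[s0 s1] := s01.
set s := expR (- (2 * t)) in s01 s0 s1 *.
pose L i (x : measurableTypeR R) := limn (series (heat_term (alpha i) s x (tnth y i))).
pose f i x := s `^ (alpha i + 1) * L i x * hermite1 (alpha i) (k i) x.
have mL i : measurable_fun setT (L i).
  apply: (@measurable_fun_cvg _ _ _ _ (fun n (x : measurableTypeR R) => series (heat_term (alpha i) s x (tnth y i)) n)).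
    move=> n; apply: measurable_sum => m; apply: measurable_funM => //.
    by apply: measurable_funM => //; exact: measurable_hermite1.
  by move=> x _; have [/normed_cvg h _] := mehler x (tnth y i) (a2 i) s01.
have mf i : measurable_fun setT (f i).
  by apply: measurable_funM; [exact: measurable_funM|exact: measurable_hermite1].
have mw i : measurable_fun setT (fun x : measurableTypeR R => `|x| `^ (2 * alpha i + 1)).
  by apply: measurable_fun_powR; exact: normr_measurable.
have fi i : lambda.-integrable setT (fun x => (f i x * `|x| `^ (2 * alpha i + 1))%:E).
  have [C C0 hC] := hermite1_bound (k i) (a2 i).
  apply: (@le_integrable _ _ _ lambda setT measurableT _ (fun x =>
      (C * (5 / 2))%:E * (laguerre_kernel (alpha i) s (tnth y i) x * `|x| `^ (2 * alpha i + 1))%:E)%E).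
  - by apply/measurable_EFinP; exact: measurable_funM.
  - move=> x _; rewrite -EFinM !abse_EFin lee_fin.
    rewrite [leRHS]ger0_norm; last first.
      apply: mulr_ge0; first by rewrite mulr_ge0 ?(ltW C0).
      by apply: mulr_ge0; [exact: laguerre_kernel_ge0|exact: powR_ge0].
    rewrite [leRHS](_ : _ = (5 / 2 * laguerre_kernel (alpha i) s (tnth y i) x) * C * `|x| `^ (2 * alpha i + 1)); last first.
      by move: (laguerre_kernel _ _ _ _) (powR _ _) => ? ?; ring.
    rewrite normrM normrM (ger0_norm (powR_ge0 `|x| _)) ler_wpM2r ?powR_ge0// ler_pM ?mulr_ge0 ?powR_ge0//.
      have [_] := mehler x (tnth y i) (a2 i) s01.
      by rewrite normrM (ger0_norm (powR_ge0 _ _)) laguerre_kernelC.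
    apply: le_trans (hC x) _; rewrite -[leRHS]mulr1 ler_pM2l// -[leRHS]expR0 ler_expR oppr_le0.
    by rewrite mulr_ge0 ?sqr_ge0.
  - by apply: integrableZl => //; exact: integrable_laguerre_kernel.
have [_ E] := integral_dunkl_prod mf fi.
transitivity (\int[mu]_x (\prod_i f i (tnth x i))%:E)%E.
  apply: eq_integral => x _; rewrite heat_kernelE// /hermite -big_split /=.
  by [].
rewrite E; congr EFin.
transitivity (\prod_i (s `^ (alpha i + 1) * (s ^+ k i * hermite1 (alpha i) (k i) (tnth y i)))).
  apply: eq_bigr => i _; rewrite /f.
  under eq_integral do rewrite -!mulrA EFinM mulrA.
  rewrite integralZl//; first by rewrite heat_eigen.
  have h : lambda.-integrable setT (fun x => ((s `^ (alpha i + 1))^-1%:E * (f i x * `|x| `^ (2 * alpha i + 1))%:E)%E) by exact: integrableZl.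
  apply: eq_integrable h => // x _; rewrite -EFinM /f.
  have p0 : s `^ (alpha i + 1) != 0 by rewrite gt_eqF// powR_gt0.
  by rewrite -!mulrA mulKf.
rewrite big_split prod_powR_expR big_split /= mulrA; congr (_ * _).
rewrite prodrXr -expRM_natl -expRD /eigenvalue_of; congr expR.
by rewrite -mulr_natl; ring.
Qed.

End dunkl.
End heat_bounds.

(** * Integral operators with ultracontractive kernels *)

Section ge0_integral.
Context {d : measure_display} {T : measurableType d} {R : realType}.
Variable m : {measure set T -> \bar R}.
Local Open Scope ereal_scope.

Lemma measurable_fun_poweR (F : T -> \bar R) (r : R) :
  measurable_fun setT F -> measurable_fun setT (fun x => F x `^ r).
Proof.
move=> mF; apply: (@measurableT_comp _ _ _ _ _ _ (fun x : \bar R => x `^ r)) => //.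
exact: measurable_poweR.
Qed.

Lemma ge0_le_integralT (f g : T -> \bar R) : measurable_fun setT f -> measurable_fun setT g ->
  (forall x, 0 <= f x) -> (forall x, f x <= g x) -> \int[m]_x f x <= \int[m]_x g x.
Proof. by move=> mf mg f0 fg; apply: ge0_le_integral. Qed.

Lemma ge0_integralZT (k : R) (f : T -> \bar R) : (0 <= k)%R -> measurable_fun setT f ->
  (forall x, 0 <= f x) -> \int[m]_x (k%:E * f x) = k%:E * \int[m]_x f x.
Proof. by move=> k0 mf f0; rewrite ge0_integralZl. Qed.

Lemma ge0_integralDT (f g : T -> \bar R) : measurable_fun setT f -> measurable_fun setT g ->
  (forall x, 0 <= f x) -> (forall x, 0 <= g x) ->
  \int[m]_x (f x + g x) = \int[m]_x f x + \int[m]_x g x.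
Proof. by move=> mf mg f0 g0; rewrite ge0_integralD. Qed.

End ge0_integral.

(** * Jensen's inequality for powers *)

Section jensen.
Context {d : measure_display} {T : measurableType d} {R : realType}.
Variable m : {measure set T -> \bar R}.
Local Open Scope ereal_scope.

Lemma lee_poweR (x y : \bar R) (r : R) : (0 <= r)%R -> 0 <= x -> x <= y -> x `^ r <= y `^ r.
Proof.
move=> r0 x0 xy; have y0 := le_trans x0 xy.
by apply: gt0_ler_poweR => //; rewrite in_itv/= ?x0 ?y0 leey.
Qed.

(** Hoelder's inequality for the factorization of h w into h w^(1/p) and w^(1/q), with q conjugate
    to p: Jensen's inequality for a measure w dm of mass at most c. *)
Lemma hoelder_powR (h w : T -> R) (p c : R) : measurable_fun setT h -> measurable_fun setT w ->
  (forall x, 0 <= h x)%R -> (forall x, 0 <= w x)%R -> (1 <= p)%R -> (0 <= c)%R ->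
  \int[m]_x (w x)%:E <= c%:E ->
  (\int[m]_x (h x * w x)%:E) `^ p <= (c `^ (p - 1))%:E * \int[m]_x (h x `^ p * w x)%:E.
Proof.
move=> mh mw h0 w0; rewrite le_eqVlt => /orP[/eqP <- c0 wc|p1 c0 wc].
  rewrite subrr powRr0 mul1e poweRe1; last by apply: integral_ge0 => x _; rewrite lee_fin mulr_ge0.
  by under [leRHS]eq_integral do rewrite powRr1//.
have p0 : (0 < p)%R by exact: lt_trans p1.
have pn0 : p != 0%R by rewrite gt_eqF.
pose q := (p / (p - 1))%R.
have p10 : (0 < p - 1)%R by rewrite subr_gt0.
have q0 : (0 < q)%R by rewrite divr_gt0.
have pq : (p^-1 + q^-1 = 1)%R by rewrite /q invf_div; field.
have qn0 : q != 0%R by rewrite gt_eqF.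
pose f x : R := (h x * w x `^ p^-1)%R.
pose g x : R := (w x `^ q^-1)%R.
have mf : measurable_fun setT f.
  by apply: measurable_funM => //; apply: (@measurableT_comp _ _ _ _ _ _ (fun x : R => x `^ p^-1)%R).
have mg : measurable_fun setT g by apply: (@measurableT_comp _ _ _ _ _ _ (fun x : R => x `^ q^-1)%R).
have f0 x : (0 <= f x)%R by rewrite mulr_ge0 ?powR_ge0.
have g0 x : (0 <= g x)%R by rewrite powR_ge0.
have := hoelder m mf mg p0 q0 pq.
have -> : 'N[m]_1[(EFin \o (f \* g)%R)] = \int[m]_x (h x * w x)%:E.
  have fg x : (f x * g x = h x * w x)%R.
    rewrite /f /g -mulrA; congr (_ * _)%R.
    rewrite -powRD; first by rewrite pq powRr1.
    by rewrite pq oner_eq0.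
  rewrite Lnorm1; apply: eq_integral => x _; rewrite -fg -[LHS]/(`|f x * g x|%R%:E).
  by rewrite ger0_norm// mulr_ge0.
move=> hol.
have I0 : 0 <= \int[m]_x (h x * w x)%:E by apply: integral_ge0 => x _; rewrite lee_fin mulr_ge0.
have : (\int[m]_x (h x * w x)%:E) `^ p <= ('N[m]_p%:E[EFin \o f] * 'N[m]_q%:E[EFin \o g]) `^ p.
  by apply: lee_poweR => //; exact: ltW.
move=> /le_trans; apply.
rewrite poweRM ?Lnorm_ge0// poweR_Lnorm// muleC.
have -> : \int[m]_x `|(EFin \o f) x| `^ p = \int[m]_x (h x `^ p * w x)%:E.
  apply: eq_integral => x _; rewrite -[LHS]/((`|f x| `^ p)%R%:E) ger0_norm// /f powRM ?powR_ge0//.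
  by rewrite -powRrM mulVf// powRr1.
apply: lee_pmul => //; first exact: poweR_ge0.
  by apply: integral_ge0 => x _; rewrite lee_fin mulr_ge0 ?powR_ge0.
have -> : 'N[m]_q%:E[EFin \o g] `^ p = (\int[m]_x (w x)%:E) `^ (p - 1).
  have -> : 'N[m]_q%:E[EFin \o g] `^ p = ('N[m]_q%:E[EFin \o g] `^ q) `^ (p - 1).
    by rewrite -poweRrM /q divfK// gt_eqF.
  rewrite poweR_Lnorm//.
  congr (_ `^ _); apply: eq_integral => x _.
  by rewrite -[LHS]/((`|g x| `^ q)%R%:E) ger0_norm// /g -powRrM mulVf// powRr1.
rewrite -poweR_EFin; apply: lee_poweR => //; first exact: ltW.
by apply: integral_ge0 => x _; rewrite lee_fin.
Qed.

Lemma jensen_powR (S : set T) (h : T -> \bar R) (w : T -> R) (p c : R) : measurable S ->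
  measurable_fun S h -> measurable_fun S w -> (forall x, S x -> 0 <= h x < +oo) ->
  (forall x, S x -> 0 <= w x)%R -> (1 <= p)%R -> (0 <= c)%R ->
  \int[m]_(x in S) (w x)%:E <= c%:E ->
  (\int[m]_(x in S) (h x * (w x)%:E)) `^ p <=
    (c `^ (p - 1))%:E * \int[m]_(x in S) (h x `^ p * (w x)%:E).
Proof.
move=> mS mh mw h0 w0 p1 c0 wc.
pose h' := (fine \o h) \_ S; pose w' := w \_ S.
have E (F : T -> \bar R) (G : T -> R) : (forall x, S x -> F x = (G x)%:E) ->
    (forall x, ~ S x -> G x = 0%R) -> \int[m]_(x in S) F x = \int[m]_x (G x)%:E.
  move=> FG G0; rewrite integral_mkcond; apply: eq_integral => x _; rewrite patchE.
  by have [Sx|Sx] := pselect (S x); [rewrite mem_set// FG|rewrite memNset// G0].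
have h'E x : S x -> h' x = fine (h x) by move=> Sx; rewrite /h' patchE mem_set.
have w'E x : S x -> w' x = w x by move=> Sx; rewrite /w' patchE mem_set.
have w'N x : ~ S x -> w' x = 0%R by move=> Sx; rewrite /w' patchE memNset.
have hE x : S x -> h x = (h' x)%:E.
  by move=> Sx; rewrite h'E// fineK// ge0_fin_numE; have /andP[] := h0 x Sx.
have w'0 x : (0 <= w' x)%R by have [/[dup] Sx /w'E ->|/w'N ->//] := pselect (S x); exact: w0.
have h'0 x : (0 <= h' x)%R.
  rewrite /h' patchE; case: ifPn => // /[!inE] Sx /=; apply: fine_ge0.
  by have /andP[] := h0 x Sx.
have mh' : measurable_fun setT h'.
  by apply/(measurable_restrictT _ _).1 => //; apply: measurableT_comp => //; exact: measurable_fine.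
have mw' : measurable_fun setT w' by apply/(measurable_restrictT _ _).1.
rewrite (E _ (fun x => h' x * w' x)%R); last 2 first.
- by move=> x Sx; rewrite hE// w'E.
- by move=> x Sx; rewrite w'N// mulr0.
rewrite (E _ (fun x => h' x `^ p * w' x)%R); last 2 first.
- by move=> x Sx; rewrite hE// w'E.
- by move=> x Sx; rewrite w'N// mulr0.
apply: hoelder_powR => //; rewrite -(E (fun x => (w x)%:E))// => x Sx.
by rewrite w'E.
Qed.

End jensen.

Section tonelli_domain.
Context {d1 d2 : measure_display} {T1 : measurableType d1} {T2 : measurableType d2} {R : realType}.
Variables (m1 : {sigma_finite_measure set T1 -> \bar R}) (m2 : {sigma_finite_measure set T2 -> \bar R}).
Local Open Scope ereal_scope.

Lemma tonelli_domain (S : set T1) (F : T1 * T2 -> \bar R) : measurable S ->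
  measurable_fun setT F -> (forall z, 0 <= F z) ->
  \int[m2]_y \int[m1]_(x in S) F (x, y) = \int[m1]_(x in S) \int[m2]_y F (x, y).
Proof.
move=> mS mF F0.
pose G z := F z * (\1_S z.1)%:E.
have mG : measurable_fun setT G.
  apply: emeasurable_funM => //; apply/measurable_EFinP.
  by apply: measurableT_comp => //; exact: measurable_indic.
have G0 z : 0 <= G z by rewrite mule_ge0// lee_fin.
have GE y : \int[m1]_(x in S) F (x, y) = \int[m1]_x G (x, y).
  rewrite integral_mkcond; apply: eq_integral => x _; rewrite patchE /G /= indicE.
  by case: ifPn => _; rewrite ?mule1 ?mule0.
under eq_integral do rewrite GE.
rewrite -(@fubini_tonelli _ _ _ _ _ m1 m2 _ mG G0) [RHS]integral_mkcond; apply: eq_integral => x _.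
rewrite patchE /G; case: ifPn => xS.
  by apply: eq_integral => y _; rewrite indicE xS mule1.
by rewrite integral0_eq// => y _; rewrite indicE (negbTE xS) mule0.
Qed.

Lemma measurable_fun_integral_domain (S : set T1) (F : T1 * T2 -> \bar R) : measurable S ->
  measurable_fun setT F -> (forall z, 0 <= F z) ->
  measurable_fun setT (fun y => \int[m1]_(x in S) F (x, y)).
Proof.
move=> mS mF F0.
pose G z := F z * (\1_S z.1)%:E.
have mG : measurable_fun setT G.
  apply: emeasurable_funM => //; apply/measurable_EFinP.
  by apply: measurableT_comp => //; exact: measurable_indic.
have G0 z : 0 <= G z by rewrite mule_ge0// lee_fin.
rewrite (_ : (fun y => _) = (fun y => \int[m1]_x G (x, y))).
  exact: (@measurable_fun_fubini_tonelli_G _ _ _ _ _ m1 _ mG G0).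
apply/funext => y; rewrite integral_mkcond; apply: eq_integral => x _; rewrite patchE /G /= indicE.
by case: ifPn => _; rewrite ?mule1 ?mule0.
Qed.

End tonelli_domain.

(** * Layer-cake formula and level sets *)

Section layer_cake.
Context {d : measure_display} {T : measurableType d} {R : realType}.
Variable m : {sigma_finite_measure set T -> \bar R}.
Local Notation lambda := (@lebesgue_measure R).
Local Open Scope ereal_scope.

Lemma measurable_measure_level (F : T -> \bar R) : measurable_fun setT F ->
  measurable_fun setT (fun l : measurableTypeR R => m [set x | (l : R)%:E < F x]).
Proof.
move=> mF; pose A : set (measurableTypeR R * T) := [set z | z.1%:E < F z.2].
have mA : measurable A.
  rewrite -[A]setTI; apply: emeasurable_fun_lt => //.
  - by apply/measurable_EFinP; exact: measurable_fst.
  - by apply: measurableT_comp => //; exact: measurable_snd.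
rewrite (_ : (fun l => _) = m \o xsection A); first exact: measurable_fun_xsection.
by apply/funext => l /=; congr (m _); apply/seteqP; split => x /=; rewrite /xsection /= inE.
Qed.

(** Tonelli's theorem applied to F(x)^q as the integral of q l^(q-1) over 0 < l < F(x). *)
Lemma integral_layer_cake_le (F : T -> \bar R) (q : R) : measurable_fun setT F -> (forall x, 0 <= F x) ->
  (0 < q)%R ->
  \int[m]_x F x `^ q <= \int[lambda]_(l in `]0%R, +oo[) ((q * l `^ (q - 1))%:E * m [set x | l%:E < F x]).
Proof.
move=> mF F0 q0.
pose A : set (measurableTypeR R * T) := [set z | z.1%:E < F z.2].
have mA : measurable A.
  rewrite -[A]setTI; apply: emeasurable_fun_lt => //.
  - by apply/measurable_EFinP; exact: measurable_fst.
  - by apply: measurableT_comp => //; exact: measurable_snd.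
pose G z := (q * z.1 `^ (q - 1) * \1_A z)%:E.
have mG : measurable_fun setT G.
  apply/measurable_EFinP; apply: measurable_funM; last exact: measurable_indic.
  apply: measurable_funM => //.
  by apply: (@measurableT_comp _ _ _ _ _ _ (fun x : R => x `^ (q - 1))%R); [|exact: measurable_fst].
have G0 z : 0 <= G z by rewrite lee_fin !mulr_ge0 ?powR_ge0// ltW.
have GE (l : R) : \int[m]_x G (l, x) = (q * l `^ (q - 1))%:E * m [set x | l%:E < F x].
  have mAl : measurable [set x | l%:E < F x].
    rewrite -[X in measurable X]setTI; apply: emeasurable_fun_lt => //; exact: measurable_cst.
  set B := [set x | _] in mAl *.
  transitivity ((q * l `^ (q - 1))%:E * \int[m]_x (\1_B x)%:E).
    rewrite -ge0_integralZl//.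
    - by apply/measurable_EFinP; exact: (measurable_indic mAl).
    - by rewrite lee_fin mulr_ge0 ?powR_ge0// ltW.
  by rewrite integral_indic// setIT.
under [leRHS]eq_integral do rewrite -GE.
rewrite -(tonelli_domain lambda m (measurable_itv _) mG G0).
apply: ge0_le_integral => //.
- by move=> x _; exact: poweR_ge0.
- by apply: (@measurableT_comp _ _ _ _ _ _ (fun x : \bar R => x `^ q)) => //; exact: measurable_poweR.
- exact: measurable_fun_integral_domain.
move=> x _.
have key (r : R) : (0 <= r)%R -> r%:E <= F x ->
    (r `^ q)%:E <= \int[lambda]_(l in `]0%R, +oo[) G (l, x).
  rewrite le_eqVlt => /orP[/eqP <- _|r0 rF].
    by rewrite powR0 ?gt_eqF//; apply: integral_ge0.
  apply: (@le_trans _ _ (\int[lambda]_(l in `]0%R, r[) G (l, x))).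
    have -> : \int[lambda]_(l in `]0%R, r[) G (l, x) = \int[lambda]_(l in `]0%R, r[) (q%:E * (l `^ (q - 1))%:E).
      apply: eq_integral => l; rewrite inE/= in_itv/= => /andP[l0 lr].
      rewrite /G indicE mem_set ?mulr1//= /A /=; exact: lt_le_trans rF.
    rewrite ge0_integralZl// ?lee_fin ?(ltW q0)//; last 2 first.
      by apply/measurable_EFinP; apply: measurable_funTS; exact: measurable_powR.
      by move=> l _; rewrite lee_fin powR_ge0.
    by rewrite integral_powR_bounded ?(ltW r0)// -EFinM mulrC divfK// gt_eqF.
  apply: ge0_subset_integral => //.
    by apply: measurable_funTS; apply: (measurableT_comp mG); apply: measurable_fun_pair.
  by move=> l /=; rewrite !in_itv/= => /andP[->].
have := F0 x; case E : (F x) => [r| |]//.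
  by rewrite lee_fin => r0; rewrite poweR_EFin; apply: key; rewrite ?E.
(* Where F x is infinite, [key] with r = A0^(1/q) shows that the integral in l is at least any given
   A0. *)
move=> _; rewrite poweRyr ?gt_eqF// leye_eq; apply/eqP/eqyP => A0 A0p.
have := key (A0 `^ q^-1)%R (powR_ge0 _ _); rewrite E leey => /(_ isT).
by rewrite -powRrM mulVf ?gt_eqF// powRr1// ltW.
Qed.

End layer_cake.

Section level_sets.
Context {d : measure_display} {T : measurableType d} {R : realType}.
Variable m : {sigma_finite_measure set T -> \bar R}.
Local Notation lambda := (@lebesgue_measure R).
Local Open Scope ereal_scope.

Lemma markov_powR (G : T -> \bar R) (a r : R) : measurable_fun setT G -> (forall x, 0 <= G x) ->
  (0 < a)%R -> (0 < r)%R ->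
  m [set x | a%:E <= G x] <= ((a^-1 `^ r)%R)%:E * \int[m]_x (G x `^ r).
Proof.
move=> mG G0 a0 r0; have ar0 : (0 < a `^ r)%R by exact: powR_gt0.
have := le_integral_abse m measurableT (measurable_fun_poweR r mG) ar0.
under eq_integral do rewrite gee0_abs ?poweR_ge0//.
rewrite setTI => h.
have -> : (a^-1 `^ r = (a `^ r)^-1)%R by rewrite -powR_inv1 ?(ltW a0)// -powRrM mulN1r powRN.
rewrite -lee_pdivrMl ?invr_gt0// invrK; apply: le_trans h.
rewrite lee_wpmul2l ?lee_fin ?(ltW ar0)//; apply: le_measure; rewrite ?inE.
- rewrite -[X in measurable X]setTI; exact: emeasurable_fun_c_infty.
- rewrite -[X in measurable X]setTI; apply: emeasurable_fun_c_infty => //.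
  by apply: measurableT_comp => //; exact: measurable_fun_poweR.
move=> x /= aG; rewrite gee0_abs ?poweR_ge0// -poweR_EFin; apply: lee_poweR => //; first exact: ltW.
by rewrite lee_fin ltW.
Qed.

Lemma measurable_ltr_natr d' (T' : measurableType d') (f g : T' -> R) :
  measurable_fun setT f -> measurable_fun setT g -> measurable_fun setT (fun z => (f z < g z)%R%:R : R).
Proof.
move=> mf mg; rewrite (_ : (fun z => _) = \1_[set z | (f z < g z)%R]).
  by apply: measurable_indic; exact: measurable_ltr_set.
by apply/funext => z; rewrite indicE mem_setE.
Qed.

(** The condition l^k < u means l < u^(1/k). This integral and the next one are the inner integrals
    in l of the endpoint argument. *)
Lemma integral_level_above (e k u : R) : (0 < e)%R -> (0 < k)%R -> (0 <= u)%R ->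
  \int[lambda]_(l in `]0%R, +oo[) (l `^ (e - 1) * (l `^ k < u)%R%:R)%:E = (u `^ (e / k) / e)%:E.
Proof.
move=> e0 k0 u0.
have -> : (u `^ (e / k) = (u `^ k^-1) `^ e)%R by rewrite -powRrM mulrC.
rewrite -integral_powR_bounded// ?powR_ge0// integral_mkcond [RHS]integral_mkcond.
apply: eq_integral => l _; rewrite !patchE !mem_setE /= !in_itv/= andbT.
case: ltP => //= l0.
have -> : (l < u `^ k^-1)%R = (l `^ k < u)%R.
  have lk : ((l `^ k) `^ k^-1 = l)%R by rewrite -powRrM mulfV ?gt_eqF// powRr1// ltW.
  have uk : ((u `^ k^-1) `^ k = u)%R by rewrite -powRrM mulVf ?gt_eqF// powRr1.
  apply/idP/idP => h.
    rewrite -uk; apply: gt0_ltr_powR; rewrite ?nnegrE ?powR_ge0// ltW//.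
  by rewrite -lk; apply: gt0_ltr_powR; rewrite ?invr_gt0// nnegrE powR_ge0.
by case: ifPn; rewrite ?mulr1 ?mulr0.
Qed.

Lemma integral_level_below (e k u : R) : (0 < e)%R -> (0 < k)%R -> (0 < u)%R ->
  \int[lambda]_(l in `]0%R, +oo[) (l `^ (- e - 1) * (u <= l `^ k)%R%:R)%:E = (u `^ (- (e / k)) / e)%:E.
Proof.
move=> e0 k0 u0.
have -> : (u `^ (- (e / k)) = (u `^ k^-1) `^ (- e))%R by rewrite -powRrM mulrN [X in (- X)%R]mulrC.
have a0 : (0 < u `^ k^-1)%R by exact: powR_gt0.
rewrite -integral_powR_tail// integral_itv_obnd_cbnd; last first.
  by apply/measurable_EFinP; apply: measurable_funTS; exact: measurable_powR.
rewrite integral_mkcond [RHS]integral_mkcond.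
apply: eq_integral => l _; rewrite !patchE !mem_setE /= !in_itv/= !andbT.
case: ltP => l0; last by rewrite leNgt (le_lt_trans l0 a0).
have -> : (u `^ k^-1 <= l)%R = (u <= l `^ k)%R.
  have lk : ((l `^ k) `^ k^-1 = l)%R by rewrite -powRrM mulfV ?gt_eqF// powRr1// ltW.
  have uk : ((u `^ k^-1) `^ k = u)%R by rewrite -powRrM mulVf ?gt_eqF// powRr1// ltW.
  apply/idP/idP => h.
    by rewrite -uk; apply: ge0_ler_powR; rewrite ?nnegrE ?powR_ge0// ltW.
  by rewrite -lk; apply: ge0_ler_powR; rewrite ?invr_ge0 ?nnegrE ?powR_ge0// ltW.
by case: ifPn; rewrite ?mulr1 ?mulr0.
Qed.

End level_sets.

(** * L^p estimates for an abstract symmetric kernel with ultracontractive bounds *)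

Section ultracontractive.
Context {disp : measure_display} {T : measurableType disp} {R : realType}.
Variables (mu : {sigma_finite_measure set T -> \bar R}) (H : measurableTypeR R -> T -> T -> R) (c D : R).
Hypotheses (H0 : forall t x y, 0 <= H t x y) (HC : forall t x y, H t x y = H t y x).
Hypothesis mH : measurable_fun setT (fun z : measurableTypeR R * (T * T) => H z.1 z.2.1 z.2.2).
Hypotheses (c0 : 0 < c) (D0 : 0 < D).
Hypothesis H_le : forall t x y, 0 < t -> H t x y <= c * (t `^ (- D) * expR (- (D * t))).
Hypothesis integral_H_le : forall t x, 0 < t -> (\int[mu]_y (H t x y)%:E <= (c * expR (- (D * t)))%:E)%E.
Hypothesis integral2_H_le : forall t, 0 < t ->
  (\int[mu]_x \int[mu]_y (H t x y)%:E <= (c * (t `^ (- D) * expR (- (D * t))))%:E)%E.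
Local Open Scope ereal_scope.
Implicit Types (f g : T -> R) (p q s t : R).

Definition kernel_op f (t : measurableTypeR R) x : \bar R := \int[mu]_y (H t x y * f y)%:E.

Definition Lp_unit p f := [/\ measurable_fun setT f, (forall x, 0 <= f x)%R &
  \int[mu]_x (f x `^ p)%:E <= 1].

Lemma kernel_op_ge0 f t x : (forall x, 0 <= f x)%R -> 0 <= kernel_op f t x.
Proof. by move=> f0; apply: integral_ge0 => y _; rewrite lee_fin mulr_ge0. Qed.

Lemma measurable_kernel_section (t : measurableTypeR R) x : measurable_fun setT (H t x).
Proof.
have mp : measurable_fun setT (fun y : T => (t, (x, y))).
  by apply: measurable_fun_pair => //; exact: measurable_fun_pair.
exact: (measurableT_comp mH mp).
Qed.

Lemma measurable_kernel_pair (t : measurableTypeR R) : measurable_fun setT (fun z : T * T => H t z.1 z.2).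
Proof.
have mp : measurable_fun setT (fun z : T * T => (t, z)) by exact: measurable_fun_pair.
exact: (measurableT_comp mH mp).
Qed.

Lemma measurable_kernel_op f : measurable_fun setT f -> (forall x, 0 <= f x)%R ->
  measurable_fun setT (fun z : measurableTypeR R * T => kernel_op f z.1 z.2).
Proof.
move=> mf f0.
pose F (z : (measurableTypeR R * T) * T) := (H z.1.1 z.1.2 z.2 * f z.2)%:E.
have mF : measurable_fun setT F.
  apply/measurable_EFinP; apply: measurable_funM; last exact: measurableT_comp.
  have mp : measurable_fun setT (fun z : (measurableTypeR R * T) * T => (z.1.1, (z.1.2, z.2))).
    apply: measurable_fun_pair; first exact: (measurableT_comp measurable_fst measurable_fst).
    apply: measurable_fun_pair => //; exact: (measurableT_comp measurable_snd measurable_fst).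
  exact: (measurableT_comp mH mp).
have F0 z : 0 <= F z by rewrite lee_fin mulr_ge0.
rewrite (_ : (fun z => _) = (fun z => \int[mu]_y F (z, y))); last by apply/funext => -[].
exact: (@measurable_fun_fubini_tonelli_F _ _ _ _ _ mu _ mF F0).
Qed.

Lemma measurable_kernel_op1 f t : measurable_fun setT f -> (forall x, 0 <= f x)%R ->
  measurable_fun setT (kernel_op f t).
Proof.
move=> mf f0; have mK := measurable_kernel_op mf f0.
have mp : measurable_fun setT (fun x : T => (t : measurableTypeR R, x)) by exact: measurable_fun_pair.
exact: (measurableT_comp mK mp).
Qed.

Lemma kernel_op_le f g t x : measurable_fun setT f -> measurable_fun setT g ->
  (forall y, 0 <= f y <= g y)%R -> kernel_op f t x <= kernel_op g t x.
Proof.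
move=> mf mg fg; apply: ge0_le_integralT.
- by apply/measurable_EFinP; apply: measurable_funM => //; exact: measurable_kernel_section.
- by apply/measurable_EFinP; apply: measurable_funM => //; exact: measurable_kernel_section.
- by move=> y; rewrite lee_fin mulr_ge0//; have /andP[] := fg y.
- by move=> y; rewrite lee_fin ler_wpM2l//; have /andP[] := fg y.
Qed.

Lemma kernel_opD f g (a b : R) t x : measurable_fun setT f -> measurable_fun setT g ->
  (forall y, 0 <= f y)%R -> (forall y, 0 <= g y)%R -> (0 <= a)%R -> (0 <= b)%R ->
  kernel_op (fun y => a * f y + b * g y)%R t x = a%:E * kernel_op f t x + b%:E * kernel_op g t x.
Proof.
move=> mf mg f0 g0 a0 b0.
have mHs := measurable_kernel_section t x.
have mHf : measurable_fun setT (fun y => (H t x y * f y)%:E).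
  by apply/measurable_EFinP; exact: measurable_funM.
have mHg : measurable_fun setT (fun y => (H t x y * g y)%:E).
  by apply/measurable_EFinP; exact: measurable_funM.
have Hf0 y : 0 <= (H t x y * f y)%:E by rewrite lee_fin mulr_ge0.
have Hg0 y : 0 <= (H t x y * g y)%:E by rewrite lee_fin mulr_ge0.
rewrite /kernel_op -ge0_integralZT// -ge0_integralZT// -ge0_integralDT.
- by apply: eq_integral => y _; rewrite -!EFinM -EFinD; congr EFin; ring.
- exact: emeasurable_funM.
- exact: emeasurable_funM.
- by move=> y; rewrite mule_ge0// lee_fin.
- by move=> y; rewrite mule_ge0// lee_fin.
Qed.

Lemma kernel_op_powR_le f p t x : measurable_fun setT f -> (forall x, 0 <= f x)%R ->
  (1 <= p)%R -> (0 < t)%R ->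
  kernel_op f t x `^ p <= (((c * expR (- (D * t))) `^ (p - 1))%R)%:E * kernel_op (fun y => (f y `^ p)%R) t x.
Proof.
move=> mf f0 p1 t0.
have ct0 : (0 <= c * expR (- (D * t)))%R by rewrite mulr_ge0 ?expR_ge0 ?(ltW c0).
have := @hoelder_powR _ _ _ mu f (H t x) p _ mf (measurable_kernel_section t x) f0 (H0 t x) p1 ct0 (integral_H_le x t0).
rewrite /kernel_op => h; under eq_integral do rewrite mulrC.
by under [in leRHS]eq_integral do rewrite mulrC.
Qed.

Lemma integral_kernel_op_le f t : measurable_fun setT f -> (forall x, 0 <= f x)%R -> (0 < t)%R ->
  \int[mu]_x kernel_op f t x <= (c * expR (- (D * t)))%:E * \int[mu]_x (f x)%:E.
Proof.
move=> mf f0 t0.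
pose F (z : T * T) := (H t z.1 z.2 * f z.2)%:E.
have mF : measurable_fun setT F.
  apply/measurable_EFinP; apply: measurable_funM; last exact: measurableT_comp.
  exact: measurable_kernel_pair.
have F0 z : 0 <= F z by rewrite lee_fin mulr_ge0.
rewrite /kernel_op (@fubini_tonelli _ _ _ _ _ mu mu F mF F0) /F /=.
have mfE : measurable_fun setT (EFin \o f) by exact/measurable_EFinP.
have ct0 : (0 <= c * expR (- (D * t)))%R by rewrite mulr_ge0 ?expR_ge0 ?(ltW c0).
rewrite -ge0_integralZT//.
apply: ge0_le_integralT.
- exact: (@measurable_fun_fubini_tonelli_G _ _ _ _ _ mu _ mF F0).
- by apply: emeasurable_funM.
- by move=> y; apply: integral_ge0 => x _; exact: (F0 (x, y)).
move=> y; under eq_integral do rewrite EFinM muleC.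
rewrite ge0_integralZT//; last 2 first.
- have mp : measurable_fun setT (fun x : T => (x, y)) by exact: measurable_fun_pair.
  by apply/measurable_EFinP; exact: (measurableT_comp (measurable_kernel_pair t) mp).
- by move=> x; rewrite lee_fin.
rewrite muleC lee_wpmul2r ?lee_fin//; under eq_integral do rewrite HC.
exact: integral_H_le.
Qed.

Lemma powR_subr1K (a r : R) : (0 < a)%R -> (a `^ (r - 1) * a = a `^ r)%R.
Proof.
by move=> a0; rewrite -{2}(powRr1 (ltW a0)) -powRD ?subrK// (gt_eqF a0) implybT.
Qed.

Lemma integral_kernel_op_powR_le f p t : measurable_fun setT f -> (forall x, 0 <= f x)%R ->
  (1 <= p)%R -> (0 < t)%R ->
  \int[mu]_x (kernel_op f t x `^ p) <= (((c * expR (- (D * t))) `^ p)%R)%:E * \int[mu]_x ((f x `^ p)%R)%:E.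
Proof.
move=> mf f0 p1 t0.
have ct0 : (0 < c * expR (- (D * t)))%R by rewrite mulr_gt0 ?expR_gt0.
have mfp := measurable_fun_powR p mf.
have fp0 x : (0 <= f x `^ p)%R by exact: powR_ge0.
have mT := measurable_kernel_op1 t mf f0.
have mTp := measurable_kernel_op1 t mfp fp0.
apply: (@le_trans _ _ (\int[mu]_x ((((c * expR (- (D * t))) `^ (p - 1))%R)%:E * kernel_op (fun y => (f y `^ p)%R) t x))).
  apply: ge0_le_integralT.
  - exact: measurable_fun_poweR.
  - exact: emeasurable_funM.
  - by move=> x; exact: poweR_ge0.
  - by move=> x; exact: kernel_op_powR_le.
rewrite ge0_integralZT ?powR_ge0//; last by move=> x; exact: kernel_op_ge0.
apply: (@le_trans _ _ ((((c * expR (- (D * t))) `^ (p - 1))%R)%:E * ((c * expR (- (D * t)))%:E * \int[mu]_x ((f x `^ p)%R)%:E))).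
  by rewrite lee_wpmul2l ?lee_fin ?powR_ge0//; exact: integral_kernel_op_le.
by rewrite muleA -EFinM powR_subr1K.
Qed.

(** Jensen's inequality for the measure H_t(x, y) dmu(y), followed by the uniform bound of the
    kernel inside the integral of f^p. *)
Lemma kernel_op_sup f p t x : (1 <= p)%R -> Lp_unit p f -> (0 < t)%R ->
  kernel_op f t x <= (c * expR (- (D * t)) * t `^ (- (D / p)))%:E.
Proof.
move=> p1 [mf f0 fp] t0.
have p0 : (0 < p)%R by exact: lt_le_trans p1.
have ct0 : (0 < c * expR (- (D * t)))%R by rewrite mulr_gt0 ?expR_gt0.
have mfp := measurable_fun_powR p mf.
have h : kernel_op f t x `^ p <= (((c * expR (- (D * t))) `^ p * t `^ (- D))%R)%:E.
  apply: le_trans (kernel_op_powR_le x mf f0 p1 t0) _.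
  have -> : ((c * expR (- (D * t))) `^ p * t `^ (- D) = (c * expR (- (D * t))) `^ (p - 1) * (c * expR (- (D * t)) * t `^ (- D)))%R.
    by rewrite mulrA powR_subr1K.
  rewrite EFinM lee_wpmul2l ?lee_fin ?powR_ge0//.
  have k0 : (0 <= c * expR (- (D * t)) * t `^ (- D))%R by rewrite mulr_ge0 ?powR_ge0 ?(ltW ct0).
  apply: (@le_trans _ _ (\int[mu]_y ((c * expR (- (D * t)) * t `^ (- D))%:E * ((f y `^ p)%R)%:E))).
    apply: ge0_le_integralT.
    - by apply/measurable_EFinP; apply: measurable_funM => //; exact: measurable_kernel_section.
    - by apply: emeasurable_funM => //; exact/measurable_EFinP.
    - by move=> y; rewrite lee_fin mulr_ge0 ?powR_ge0.
    move=> y; rewrite -EFinM lee_fin ler_wpM2r ?powR_ge0//.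
    by apply: le_trans (H_le _ _ t0) _; rewrite -mulrA (mulrC (expR _)).
  rewrite ge0_integralZT//; last 2 first.
  - exact/measurable_EFinP.
  - by move=> y; rewrite lee_fin powR_ge0.
  by rewrite -[leRHS]mule1 lee_wpmul2l// lee_fin.
have K0 := kernel_op_ge0 t x f0.
have ip0 : (0 <= p^-1)%R by rewrite invr_ge0 ltW.
rewrite -[leLHS]poweRe1// -(@mulfV _ p) ?gt_eqF// poweRrM.
apply: le_trans (lee_poweR ip0 (poweR_ge0 _ _) h) _.
rewrite poweR_EFin lee_fin powRM ?powR_ge0// -!powRrM mulfV ?gt_eqF// powRr1 ?(ltW ct0)//.
by rewrite mulNr.
Qed.

(* Splitting u at the level L replaces an interpolation between L^1 and L^p. *)
Lemma powR_le_level (L u p q : R) : (0 < L)%R -> (0 <= u)%R -> (0 < q)%R -> (q <= p)%R ->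
  (u `^ q <= L `^ (q - p) * u `^ p + L `^ q)%R.
Proof.
move=> L0 u0 q0 qp; have [uL|Lu] := leP u L.
  rewrite -[leLHS]add0r lerD ?mulr_ge0 ?powR_ge0// ge0_ler_powR// ?nnegrE// ltW//.
have up : (0 < u)%R by exact: lt_trans Lu.
have pq0 : (0 <= p - q)%R by rewrite subr_ge0.
have Lu' : (L `^ (p - q) <= u `^ (p - q))%R by rewrite ge0_ler_powR ?nnegrE// ltW.
have -> : (u `^ p = u `^ (p - q) * u `^ q)%R by rewrite -powRD ?subrK// (gt_eqF up) implybT.
have -> : (L `^ (q - p) = (L `^ (p - q))^-1)%R by rewrite -powRN opprB.
rewrite mulrA -[leLHS]addr0 lerD ?powR_ge0//.
rewrite -[leLHS]mul1r ler_wpM2r ?powR_ge0// -ler_pdivrMl ?invr_gt0 ?powR_gt0//.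
by rewrite invrK mulr1.
Qed.

(** For p <= q the q-th power is at most the p-th power times the (q-p)-th power of the supremum
    from [kernel_op_sup]. For q < p, Jensen's inequality reduces to f^q, which [powR_le_level]
    bounds by f^p and a constant; the constant is integrated by the total mass bound. The weight in
    t normalizes the bound to be independent of t. *)
Lemma integral_kernel_op_unit f p q t : (1 <= p)%R -> (1 <= q)%R -> Lp_unit p f -> (0 < t)%R ->
  \int[mu]_x (kernel_op f t x * (t `^ (D * `|p^-1 - q^-1|) * expR (D * t))%:E) `^ q <= ((2 * c `^ q)%R)%:E.
Proof.
move=> p1 q1 uf t0; have [mf f0 fp] := uf.
have p0 : (0 < p)%R by exact: lt_le_trans p1.
have q0 : (0 < q)%R by exact: lt_le_trans q1.
have ct0 : (0 < c * expR (- (D * t)))%R by rewrite mulr_gt0 ?expR_gt0.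
have mT := measurable_kernel_op1 t mf f0.
have mfp := measurable_fun_powR p mf.
have mfq := measurable_fun_powR q mf.
have fp0 x : (0 <= f x `^ p)%R by exact: powR_ge0.
have fq0 x : (0 <= f x `^ q)%R by exact: powR_ge0.
set a := (D * `|p^-1 - q^-1|)%R.
suff h : \int[mu]_x (kernel_op f t x `^ q) <= ((2 * (c * expR (- (D * t))) `^ q * t `^ (- a * q))%R)%:E.
  have w0 : (0 <= t `^ a * expR (D * t))%R by rewrite mulr_ge0 ?powR_ge0 ?expR_ge0.
  under eq_integral do rewrite muleC poweRM ?kernel_op_ge0 ?lee_fin// poweR_EFin.
  rewrite ge0_integralZT ?powR_ge0//; last 2 first.
  - exact: measurable_fun_poweR.
  - by move=> x; exact: poweR_ge0.
  apply: le_trans (lee_wpmul2l _ h) _; first by rewrite lee_fin powR_ge0.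
  rewrite -EFinM lee_fin !powRM ?powR_ge0 ?expR_ge0 ?(ltW c0)// -powRrM mulNr powRN expRN.
  have e0 := expR_gt0 (D * t); have t1 : (0 < t `^ (a * q))%R by exact: powR_gt0.
  rewrite -[((expR (D * t))^-1)%R]powR_inv1 ?(ltW e0)// -powRrM mulN1r powRN.
  have e1 : (0 < expR (D * t) `^ q)%R by exact: powR_gt0.
  move: e1 t1; move: (_ `^ q)%R (_ `^ (a * q))%R (c `^ q)%R => u v w u0 v0.
  by rewrite [leLHS](_ : _ = 2 * w)%R//; field; rewrite !gt_eqF.
have [pq|qp] := leP p q.
  have aE : a = (D * (p^-1 - q^-1))%R.
    by rewrite /a ger0_norm// subr_ge0 lef_pV2 ?posrE.
  have pq0 : (0 <= q - p)%R by rewrite subr_ge0.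
  have mTp := measurable_fun_poweR p mT.
  apply: (@le_trans _ _ (\int[mu]_x ((((c * expR (- (D * t)) * t `^ (- (D / p))) `^ (q - p))%R)%:E * kernel_op f t x `^ p))).
    apply: ge0_le_integralT.
    - exact: measurable_fun_poweR.
    - exact: emeasurable_funM.
    - by move=> x; exact: poweR_ge0.
    move=> x; have K0 := kernel_op_ge0 t x f0.
    rewrite -[X in _ `^ X <= _](subrK p) poweRD.
      rewrite lee_wpmul2r ?poweR_ge0// -poweR_EFin; apply: lee_poweR => //.
      exact: kernel_op_sup.
    by rewrite poweRD_defE subrK gt_eqF// !implybT.
  rewrite ge0_integralZT ?powR_ge0//; last by move=> x; exact: poweR_ge0.
  apply: (@le_trans _ _ ((((c * expR (- (D * t)) * t `^ (- (D / p))) `^ (q - p))%R)%:E * (((c * expR (- (D * t))) `^ p)%R)%:E)).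
    rewrite lee_wpmul2l ?lee_fin ?powR_ge0//.
    apply: le_trans (integral_kernel_op_powR_le mf f0 p1 t0) _.
    by rewrite -[leRHS]mule1 lee_wpmul2l// lee_fin powR_ge0.
  rewrite -EFinM lee_fin powRM ?powR_ge0 ?(ltW ct0)// mulrAC -powRD ?subrK; last by rewrite (gt_eqF ct0) implybT.
  rewrite -powRrM (_ : (- (D / p) * (q - p) = - a * q)%R); last by rewrite aE; field; rewrite !gt_eqF.
  by rewrite ler_wpM2r ?powR_ge0// ler_peMl ?powR_ge0// ler1n.
have aE : a = (D * (q^-1 - p^-1))%R.
  by rewrite /a distrC ger0_norm// subr_ge0 lef_pV2 ?posrE ?(ltW qp)//.
(* This level balances the two contributions: both are of order t^(-aq). *)
pose L := (t `^ (D / p))%R; have L0 : (0 < L)%R by exact: powR_gt0.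
have mTp := measurable_kernel_op1 t mfp fp0.
have mTq := measurable_kernel_op1 t mfq fq0.
have m1 : measurable_fun setT (fun _ : T => 1%R : R) by exact: measurable_cst.
have mT1 := measurable_kernel_op1 t m1 (fun=> ler01).
have Tp0 x : 0 <= kernel_op (fun y => (f y `^ p)%R) t x by exact: kernel_op_ge0.
have T10 x : 0 <= kernel_op (fun=> 1%R) t x by apply: kernel_op_ge0 => _; exact: ler01.
apply: (@le_trans _ _ (\int[mu]_x ((((c * expR (- (D * t))) `^ (q - 1))%R)%:E * kernel_op (fun y => (f y `^ q)%R) t x))).
  apply: ge0_le_integralT.
  - exact: measurable_fun_poweR.
  - exact: emeasurable_funM.
  - by move=> x; exact: poweR_ge0.
  - by move=> x; exact: kernel_op_powR_le.
rewrite (ge0_integralZT mu (powR_ge0 _ _) mTq); last by move=> x; exact: kernel_op_ge0.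
have IK : \int[mu]_x kernel_op (fun y => (f y `^ q)%R) t x <=
    ((L `^ (q - p))%R)%:E * \int[mu]_x kernel_op (fun y => (f y `^ p)%R) t x +
    ((L `^ q)%R)%:E * \int[mu]_x kernel_op (fun=> 1%R) t x.
  rewrite -(ge0_integralZT mu (powR_ge0 _ _) mTp Tp0) -(ge0_integralZT mu (powR_ge0 _ _) mT1 T10).
  rewrite -ge0_integralDT; last 4 first.
  - by apply: emeasurable_funM mTp; exact: measurable_cst.
  - by apply: emeasurable_funM mT1; exact: measurable_cst.
  - by move=> x; rewrite mule_ge0 ?lee_fin ?powR_ge0.
  - by move=> x; rewrite mule_ge0 ?lee_fin ?powR_ge0.
  apply: ge0_le_integralT.
  - exact: mTq.
  - by apply: emeasurable_funD; [apply: emeasurable_funM mTp|apply: emeasurable_funM mT1]; exact: measurable_cst.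
  - by move=> x; exact: kernel_op_ge0.
  move=> x; rewrite -kernel_opD ?powR_ge0//.
  apply: kernel_op_le => //.
    by apply: measurable_funD; apply: measurable_funM.
  by move=> y; rewrite powR_ge0 mulr1/=; exact: powR_le_level (ltW qp).
have I1 : \int[mu]_x kernel_op (fun=> 1%R) t x = \int[mu]_x \int[mu]_y (H t x y)%:E.
  by apply: eq_integral => x _; rewrite /kernel_op; under eq_integral do rewrite mulr1.
apply: (@le_trans _ _ ((((c * expR (- (D * t))) `^ (q - 1))%R)%:E *
    ((L `^ (q - p) * (c * expR (- (D * t))))%:E + (L `^ q * (c * (t `^ (- D) * expR (- (D * t)))))%:E))).
  rewrite lee_wpmul2l ?lee_fin ?powR_ge0//; apply: le_trans IK _.
  rewrite !EFinM; apply: leeD; apply: lee_wpmul2l; rewrite ?lee_fin ?powR_ge0//.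
    apply: le_trans (integral_kernel_op_le mfp fp0 t0) _.
    by rewrite -[leRHS]mule1 -EFinM lee_wpmul2l// lee_fin ltW.
  by rewrite I1 -!EFinM; exact: integral2_H_le.
rewrite -EFinD -EFinM lee_fin.
have -> : (L `^ (q - p) = t `^ (- a * q))%R.
  by rewrite /L -powRrM aE; congr (_ `^ _)%R; field; rewrite !gt_eqF.
have -> : (L `^ q * (c * (t `^ (- D) * expR (- (D * t)))) = t `^ (- a * q) * (c * expR (- (D * t))))%R.
  have -> : (t `^ (- a * q) = L `^ q * t `^ (- D))%R.
    rewrite /L -powRrM -powRD; last by rewrite (gt_eqF t0) implybT.
    by rewrite aE; congr (_ `^ _)%R; field; rewrite !gt_eqF.
  by move: (_ `^ _)%R (_ `^ _)%R (expR _) => *; ring.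
rewrite -(powR_subr1K q ct0); move: (c * _)%R (t `^ _)%R ((c * _) `^ (q - 1))%R => *.
by rewrite le_eqVlt; apply/orP; left; apply/eqP; ring.
Qed.

Local Notation lambda := (@lebesgue_measure R).

Definition potential_op (s : R) f x : \bar R :=
  \int[lambda]_(t in `]0%R, +oo[) (kernel_op f t x * (t `^ (s - 1))%:E).

Lemma measurable_kernel_op_weight f (w : R -> R) : measurable_fun setT f -> (forall x, 0 <= f x)%R ->
  measurable_fun setT w ->
  measurable_fun setT (fun z : measurableTypeR R * T => kernel_op f z.1 z.2 * (w z.1)%:E).
Proof.
move=> mf f0 mw; apply: emeasurable_funM; first exact: measurable_kernel_op.
by apply/measurable_EFinP; exact: (measurableT_comp mw measurable_fst).
Qed.

Lemma measurable_kernel_op_time f x : measurable_fun setT f -> (forall x, 0 <= f x)%R ->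
  measurable_fun setT (fun t : measurableTypeR R => kernel_op f t x).
Proof.
move=> mf f0; have mK := measurable_kernel_op mf f0.
have mp : measurable_fun setT (fun t : measurableTypeR R => (t, x)) by exact: measurable_fun_pair.
exact: (measurableT_comp mK mp).
Qed.

Lemma measurable_potential_op s f : measurable_fun setT f -> (forall x, 0 <= f x)%R ->
  measurable_fun setT (potential_op s f).
Proof.
move=> mf f0; apply: (@measurable_fun_integral_domain _ _ _ _ _ lambda _ (fun z => kernel_op f z.1 z.2 * (z.1 `^ (s - 1))%:E)) => //.
  apply: (@measurable_kernel_op_weight _ (fun t => t `^ (s - 1))%R) => //.
by move=> z; rewrite mule_ge0 ?kernel_op_ge0// lee_fin powR_ge0.
Qed.

Lemma potential_op_ge0 s f x : (forall x, 0 <= f x)%R -> 0 <= potential_op s f x.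
Proof. by move=> f0; apply: integral_ge0 => t _; rewrite mule_ge0 ?kernel_op_ge0// lee_fin powR_ge0. Qed.

(** Jensen's inequality in time for the weight w, then Tonelli's theorem; this takes the place of
    Minkowski's integral inequality. The factor v normalizes the operator at time t so that its
    estimate B is uniform on S. *)
Lemma integral_time_average (S : set R) (v w : R -> R) f q (W : R) (B : \bar R) : measurable S ->
  measurable_fun setT v -> measurable_fun setT w -> (forall t, 0 <= v t)%R -> (forall t, 0 <= w t)%R ->
  measurable_fun setT f -> (forall x, 0 <= f x)%R ->
  (forall t x, S t -> kernel_op f t x < +oo) -> (1 <= q)%R -> (0 <= W)%R ->
  \int[lambda]_(t in S) (w t)%:E <= W%:E -> 0 <= B ->
  (forall t, S t -> \int[mu]_x (kernel_op f t x * (v t)%:E) `^ q <= B) ->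
  \int[mu]_x ((\int[lambda]_(t in S) (kernel_op f t x * (v t * w t)%:E)) `^ q) <= ((W `^ q)%R)%:E * B.
Proof.
move=> mS mv mw v0 w0 mf f0 Koo q1 W0 IW B0 hB.
pose F (z : measurableTypeR R * T) := (kernel_op f z.1 z.2 * (v z.1)%:E) `^ q * (w z.1)%:E.
have F0 z : 0 <= F z by rewrite mule_ge0 ?poweR_ge0 ?lee_fin.
have mF : measurable_fun setT F.
  apply: emeasurable_funM; last by apply/measurable_EFinP; exact: (measurableT_comp mw measurable_fst).
  apply: measurable_fun_poweR; exact: measurable_kernel_op_weight.
have mIF := @measurable_fun_integral_domain _ _ _ _ _ lambda _ F mS mF F0.
have mvw : measurable_fun setT (fun t => v t * w t)%R by exact: measurable_funM.
have J x : (\int[lambda]_(t in S) (kernel_op f t x * (v t * w t)%:E)) `^ q <=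
    ((W `^ (q - 1))%R)%:E * \int[lambda]_(t in S) F (t, x).
  have -> : \int[lambda]_(t in S) (kernel_op f t x * (v t * w t)%:E) =
      \int[lambda]_(t in S) ((kernel_op f t x * (v t)%:E) * (w t)%:E).
    by apply: eq_integral => t _; rewrite EFinM muleA.
  apply: jensen_powR => //.
  - apply: measurable_funTS; apply: emeasurable_funM; first exact: measurable_kernel_op_time.
    exact/measurable_EFinP.
  - exact: measurable_funTS.
  - move=> t St; rewrite mule_ge0 ?kernel_op_ge0 ?lee_fin//=.
    by rewrite lte_mul_pinfty ?kernel_op_ge0 ?ltry ?ge0_fin_numE ?kernel_op_ge0 ?Koo.
apply: (@le_trans _ _ (\int[mu]_x (((W `^ (q - 1))%R)%:E * \int[lambda]_(t in S) F (t, x)))).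
  apply: ge0_le_integralT => //.
  - apply: measurable_fun_poweR.
    apply: (@measurable_fun_integral_domain _ _ _ _ _ lambda _ (fun z => kernel_op f z.1 z.2 * (v z.1 * w z.1)%:E)) => //.
      exact: (measurable_kernel_op_weight mf f0 mvw).
    by move=> z; rewrite mule_ge0 ?kernel_op_ge0// lee_fin mulr_ge0.
  - by apply: emeasurable_funM; first exact: measurable_cst.
  - by move=> x; exact: poweR_ge0.
rewrite ge0_integralZT ?powR_ge0//; last by move=> x; exact: integral_ge0.
apply: (@le_trans _ _ (((W `^ (q - 1))%R)%:E * (W%:E * B))).
  rewrite lee_wpmul2l ?lee_fin ?powR_ge0//.
  rewrite (tonelli_domain lambda mu mS mF F0).
  apply: (@le_trans _ _ (\int[lambda]_(t in S) (B * (w t)%:E))).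
    apply: ge0_le_integral => //.
    - by move=> t _; exact: integral_ge0.
    - apply: measurable_funTS; exact: (@measurable_fun_fubini_tonelli_F _ _ _ _ _ mu _ mF F0).
    - by apply: measurable_funTS; apply: emeasurable_funM; [exact: measurable_cst|exact/measurable_EFinP].
    move=> t St; rewrite /F /=; have mKt := measurable_kernel_op1 t mf f0.
    under eq_integral do rewrite muleC.
    rewrite ge0_integralZT//; last 2 first.
    - by apply: measurable_fun_poweR; apply: emeasurable_funM => //; exact: measurable_cst.
    - by move=> x; exact: poweR_ge0.
    by rewrite muleC lee_wpmul2r ?lee_fin//; exact: hB.
  rewrite ge0_integralZl//; last 2 first.
  - by apply/measurable_EFinP; exact: measurable_funTS.
  - by move=> t _; rewrite lee_fin.
  by rewrite [leRHS]muleC lee_wpmul2l.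
move: W0; rewrite le_eqVlt => /orP[/eqP <-|W0].
  by rewrite mul0e mule0 mule_ge0// lee_fin powR_ge0.
by rewrite muleA -EFinM powR_subr1K.
Qed.

(* Jensen's inequality in time, with the integrable weight t^(s-a-1) e^(-Dt) that remains once the *)
(* bound t^(-a) e^(-Dt) of integral_kernel_op_unit has been divided out. *)
Lemma integral_potential_op_strict p q s : (1 <= p)%R -> (1 <= q)%R -> (D * `|p^-1 - q^-1| < s)%R ->
  exists2 C, (0 <= C)%R & forall f, Lp_unit p f -> \int[mu]_x (potential_op s f x `^ q) <= C%:E.
Proof.
move=> p1 q1; set a := (D * _)%R => as_.
have sa : (0 < s - a)%R by rewrite subr_gt0.
pose w (t : R) := (t `^ (s - a - 1) * expR (- (D * t)))%R.
have w0 t : (0 <= w t)%R by rewrite mulr_ge0 ?powR_ge0 ?expR_ge0.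
have mw : measurable_fun setT w.
  apply: measurable_funM; first exact: measurable_powR.
  by apply: measurable_fun_expR; apply: measurableT_comp => //; exact: measurable_funM.
pose v (t : R) := (t `^ a * expR (D * t))%R.
have v0 t : (0 <= v t)%R by rewrite mulr_ge0 ?powR_ge0 ?expR_ge0.
have mv : measurable_fun setT v.
  apply: measurable_funM; first exact: measurable_powR.
  by apply: measurable_fun_expR; exact: measurable_funM.
pose W := (Gamma (s - a) * D `^ (- (s - a)))%R.
have W0 : (0 <= W)%R by rewrite mulr_ge0 ?powR_ge0// ltW// Gamma_gt0.
have IW : \int[lambda]_(t in `]0%R, +oo[) (w t)%:E = W%:E by exact: integral_gamma_scale.
exists (W `^ q * (2 * c `^ q))%R.
  by apply: mulr_ge0; rewrite ?mulr_ge0 ?powR_ge0.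
move=> f uf; have [mf f0 fp] := uf.
have E x : potential_op s f x = \int[lambda]_(t in `]0%R, +oo[) (kernel_op f t x * (v t * w t)%:E).
  apply: eq_integral => t; rewrite inE/= in_itv/= andbT => t0.
  congr (_ * _%:E); rewrite /v /w mulrACA -powRD; last by rewrite (gt_eqF t0) implybT.
  by rewrite -expRD subrr expR0 mulr1; congr (_ `^ _)%R; ring.
under eq_integral do rewrite E.
rewrite EFinM; apply: integral_time_average => //.
- move=> t x /=; rewrite in_itv/= andbT => t0.
  by apply: le_lt_trans (kernel_op_sup x p1 uf t0) _; rewrite ltry.
- by rewrite IW.
- by rewrite lee_fin mulr_ge0 ?powR_ge0.
- by move=> t /=; rewrite in_itv/= andbT => t0; exact: integral_kernel_op_unit.
Qed.

(** The case v = 1, w = t^(s-1) of [integral_time_average], the weight having mass r^s / s. The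
    function f in the unit ball of L^p dominates g and so makes [kernel_op g] finite, while q is
    free: it is 1 or 2p in the endpoint argument. *)
Lemma integral_short_time_le p q s r f g : (1 <= p)%R -> (1 <= q)%R -> (0 < s)%R -> (0 < r)%R ->
  Lp_unit p f -> measurable_fun setT g -> (forall x, 0 <= g x <= f x)%R ->
  \int[mu]_x ((\int[lambda]_(t in `]0%R, r]) (kernel_op g t x * (t `^ (s - 1))%:E)) `^ q) <=
  (((c * r `^ s / s) `^ q)%R)%:E * \int[mu]_x ((g x `^ q)%R)%:E.
Proof.
move=> p1 q1 s0 r0 uf mg gf; have [mf f0 fp] := uf.
have g0 x : (0 <= g x)%R by have /andP[] := gf x.
have E x : \int[lambda]_(t in `]0%R, r]) (kernel_op g t x * (t `^ (s - 1))%:E) =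
    \int[lambda]_(t in `]0%R, r]) (kernel_op g t x * (1 * t `^ (s - 1))%:E).
  by apply: eq_integral => t _; rewrite mul1r.
under eq_integral do rewrite E.
have rs0 : (0 <= r `^ s / s)%R by rewrite divr_ge0 ?powR_ge0// ltW.
have I0 : 0 <= \int[mu]_x ((g x `^ q)%R)%:E by apply: integral_ge0 => x _; rewrite lee_fin powR_ge0.
rewrite -mulrA (mulrC c) powRM ?(ltW c0)// EFinM -muleA.
have mw : measurable_fun setT (fun t : R => t `^ (s - 1))%R by exact: measurable_powR.
apply: (@integral_time_average _ (fun=> 1%R) (fun t => t `^ (s - 1))%R) => //.
- by move=> t; exact: powR_ge0.
- move=> t x /=; rewrite in_itv/= => /andP[t0 _].
  apply: le_lt_trans (kernel_op_le t x mg mf gf) _.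
  by apply: le_lt_trans (kernel_op_sup x p1 uf t0) _; rewrite ltry.
- rewrite -integral_itv_bndo_bndc; last by apply/measurable_EFinP; exact: measurable_funTS.
  by rewrite integral_powR_bounded// ltW.
- by rewrite mule_ge0// lee_fin powR_ge0.
- move=> t /=; rewrite in_itv/= => /andP[t0 _]; under eq_integral do rewrite mule1.
  apply: le_trans (integral_kernel_op_powR_le mg g0 q1 t0) _.
  apply: lee_wpmul2r => //.
  rewrite lee_fin ge0_ler_powR ?nnegrE ?mulr_ge0 ?expR_ge0 ?(ltW c0)//.
    exact: le_trans q1.
  rewrite -[leRHS]mulr1 ler_wpM2l ?(ltW c0)// -[leRHS]expR0 ler_expR oppr_le0 mulr_ge0// ltW//.
Qed.

(** For t > r the supremum bound leaves t^(s - D/p - 1), integrable at infinity because s < D/p. *)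
Lemma potential_op_split p s r f x : (1 <= p)%R -> (s < D / p)%R -> (0 < r)%R -> Lp_unit p f ->
  potential_op s f x <= \int[lambda]_(t in `]0%R, r]) (kernel_op f t x * (t `^ (s - 1))%:E) +
    (c * (r `^ (- (D / p - s)) / (D / p - s)))%:E.
Proof.
move=> p1 sD r0 uf; have [mf f0 fp] := uf.
have b0 : (0 < D / p - s)%R by rewrite subr_gt0.
have mk : measurable_fun setT (fun t : measurableTypeR R => kernel_op f t x * (t `^ (s - 1))%:E).
  apply: emeasurable_funM; first exact: measurable_kernel_op_time.
  by apply/measurable_EFinP; exact: measurable_powR.
have k0 t : 0 <= kernel_op f t x * (t `^ (s - 1))%:E.
  by rewrite mule_ge0 ?kernel_op_ge0// lee_fin powR_ge0.
have -> : potential_op s f x = \int[lambda]_(t in `]0%R, r]) (kernel_op f t x * (t `^ (s - 1))%:E) +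
    \int[lambda]_(t in `]r, +oo[) (kernel_op f t x * (t `^ (s - 1))%:E).
  rewrite /potential_op (@itv_bndbnd_setU _ _ _ (BRight r))// ?bnd_simp ?ltW//.
  rewrite ge0_integral_setU//.
  - by apply: measurable_funTS.
  - apply/disj_setPS => t [] /=; rewrite !in_itv/= andbT => /andP[_ tr] rt.
    by move: (lt_le_trans rt tr); rewrite ltxx.
rewrite leeD2l// EFinM -(integral_powR_tail b0 r0).
rewrite -ge0_integralZl//; last 3 first.
- by apply/measurable_EFinP; apply: measurable_funTS; exact: measurable_powR.
- by move=> t _; rewrite lee_fin powR_ge0.
- by rewrite lee_fin ltW.
apply: ge0_le_integral => //.
- exact: measurable_funTS.
- apply: measurable_funTS; apply: emeasurable_funM => //.
  by apply/measurable_EFinP; exact: measurable_powR.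
move=> t /=; rewrite in_itv/= andbT => rt; have t0 : (0 < t)%R by exact: lt_trans rt.
apply: (le_trans (lee_wpmul2r _ (kernel_op_sup x p1 uf t0))); first by rewrite lee_fin powR_ge0.
rewrite -!EFinM lee_fin -[leLHS]mulrA -powRD; last by rewrite (gt_eqF t0) implybT.
rewrite (_ : (- (D / p) + (s - 1) = - (D / p - s) - 1)%R); last by ring.
rewrite ler_wpM2r ?powR_ge0// -[leRHS]mulr1 ler_wpM2l ?(ltW c0)//.
by rewrite -[leRHS]expR0 ler_expR oppr_le0 mulr_ge0// ltW.
Qed.

(** * The endpoint 1/q = 1/p - s/D *)

Section endpoint.
Variables (p q s : R).
Hypotheses (p1 : (1 < p)%R) (q1 : (1 <= q)%R) (s0 : (0 < s)%R) (sE : (s = D * (p^-1 - q^-1))%R).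

Let p0 : (0 < p)%R. Proof. exact: lt_trans p1. Qed.
Let q0 : (0 < q)%R. Proof. exact: lt_le_trans q1. Qed.
(** At level l the function f is cut at height l^k. The number b = D/q equals D/p - s, the decay
    exponent of the tail in time; kappa calibrates the splitting time (l kappa)^(-1/b) so that the
    tail is l/2; K is the constant left by Chebyshev's inequality at height l/4. *)
Let k := (q / p)%R.
Let k0 : (0 < k)%R. Proof. by rewrite divr_gt0. Qed.
Let b := (D / q)%R.
Let b0 : (0 < b)%R. Proof. by rewrite divr_gt0. Qed.
Let kappa := (b / (2 * c))%R.
Let kappa0 : (0 < kappa)%R. Proof. by rewrite divr_gt0// mulr_gt0. Qed.
Let K := (4 * (c * kappa `^ (1 - k) / s))%R.
Let K0 : (0 < K)%R. Proof. by rewrite mulr_gt0// divr_gt0// mulr_gt0// powR_gt0. Qed.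

(* The time r splitting the potential at level l is chosen so that the part t > r *)
(* is at most l / 2. *)
Lemma measure_potential_op_level f (l : R) : Lp_unit p f -> (0 < l)%R ->
  mu [set x | l%:E < potential_op s f x] <=
  (K * l `^ (- k))%:E * \int[mu]_x ((l `^ k < f x)%R%:R * f x)%:E +
  ((K * l `^ (- k)) `^ (2 * p))%:E * \int[mu]_x ((f x <= l `^ k)%R%:R * f x `^ (2 * p))%:E.
Proof.
move=> uf l0; have [mf f0 fp] := uf.
pose g1 x : R := ((l `^ k < f x)%R%:R * f x)%R.
pose g2 x : R := ((f x <= l `^ k)%R%:R * f x)%R.
have lk0 : (0 < l * kappa)%R by rewrite mulr_gt0.
pose r := ((l * kappa) `^ (- b^-1))%R.
have r0 : (0 < r)%R by exact: powR_gt0.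
have bE : (D / p - s = b)%R by rewrite sE /b; field; rewrite !gt_eqF.
have sD : (s < D / p)%R by rewrite -subr_gt0 bE.
have tail : (c * (r `^ (- (D / p - s)) / (D / p - s)) = l / 2)%R.
  rewrite bE /r -powRrM mulrNN mulVf ?gt_eqF// powRr1 ?(ltW lk0)// /kappa.
  by field; rewrite !gt_eqF.
have short : (c * r `^ s / s = K * l `^ (1 - k) / 4)%R.
  have -> : (r `^ s = l `^ (1 - k) * kappa `^ (1 - k))%R.
    rewrite /r -powRrM -powRM ?(ltW l0) ?(ltW kappa0)//; congr (_ `^ _)%R.
    by rewrite sE /b /k; field; rewrite !gt_eqF.
  by rewrite /K; move: (kappa `^ _)%R (l `^ _)%R => *; field; rewrite gt_eqF.
pose S g x := \int[lambda]_(t in `]0%R, r]) (kernel_op g t x * (t `^ (s - 1))%:E).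
have mg1 : measurable_fun setT g1 by apply: measurable_funM => //; exact: measurable_ltr_natr.
have g2E : g2 = (fun x => (1 - (l `^ k < f x)%R%:R) * f x)%R.
  by apply/funext => x; rewrite /g2 leNgt; case: (_ < _)%R; rewrite ?subrr ?subr0.
have mg2 : measurable_fun setT g2.
  rewrite g2E; apply: measurable_funM => //; apply: measurable_funB => //; exact: measurable_ltr_natr.
have g1f x : (0 <= g1 x <= f x)%R by rewrite /g1; case: (_ < _)%R; rewrite ?mul1r ?mul0r ?f0 ?lexx.
have g2f x : (0 <= g2 x <= f x)%R by rewrite /g2; case: (f x <= _)%R; rewrite ?mul1r ?mul0r ?f0 ?lexx.
have g10 x : (0 <= g1 x)%R by have /andP[] := g1f x.
have g20 x : (0 <= g2 x)%R by have /andP[] := g2f x.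
have k0' g t x : (forall y, 0 <= g y)%R -> 0 <= kernel_op g t x * (t `^ (s - 1))%:E.
  by move=> g0; rewrite mule_ge0 ?kernel_op_ge0// lee_fin powR_ge0.
have S0 g x : (forall y, 0 <= g y)%R -> 0 <= S g x.
  by move=> g0; apply: integral_ge0 => t _; exact: k0'.
have mS g : measurable_fun setT g -> (forall y, 0 <= g y)%R -> measurable_fun setT (S g).
  move=> mg g0; apply: (@measurable_fun_integral_domain _ _ _ _ _ lambda _ (fun z => kernel_op g z.1 z.2 * (z.1 `^ (s - 1))%:E)) => //.
    by apply: (@measurable_kernel_op_weight _ (fun t => t `^ (s - 1))%R).
  by move=> z; exact: k0'.
have fS x : S f x = S g1 x + S g2 x.
  have mk g : measurable_fun setT g -> (forall y, 0 <= g y)%R ->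
      measurable_fun `]0%R, r]%classic (fun t : measurableTypeR R => kernel_op g t x * (t `^ (s - 1))%:E).
    move=> mg g0; apply: measurable_funTS; apply: emeasurable_funM; first exact: measurable_kernel_op_time.
    by apply/measurable_EFinP; exact: measurable_powR.
  rewrite /S -ge0_integralD//; last 4 first.
  - by move=> t _; exact: k0'.
  - exact: mk.
  - by move=> t _; exact: k0'.
  - exact: mk.
  apply: eq_integral => t _; rewrite -ge0_muleDl ?kernel_op_ge0//; congr (_ * _).
  rewrite -[X in X + _]mul1e -[X in _ + X]mul1e -kernel_opD//; congr kernel_op; apply/funext => y.
  by rewrite !mul1r g2E /g1 -mulrDl addrCA subrr addr0 mul1r.
have l4 : (0 < l / 4)%R by rewrite divr_gt0.
(* If the potential exceeds l while its tail is at most l/2, one of the two short-time pieces is at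
   least l/4. The large values of f are tested in L^1 and the small ones in L^(2p), exponents on
   either side of p. *)
have m1 := markov_powR mu (mS _ mg1 g10) (fun x => S0 _ x g10) l4 (ltr01 : (0 < 1 :> R)%R).
have p20 : (0 < 2 * p)%R by rewrite mulr_gt0.
have m2 := markov_powR mu (mS _ mg2 g20) (fun x => S0 _ x g20) l4 p20.
have p11 : (1 <= p)%R by exact: ltW.
have p21 : (1 <= 2 * p)%R by have := p1; lra.
have i1 := integral_short_time_le p11 (lexx 1%R) s0 r0 uf mg1 g1f.
have i2 := integral_short_time_le p11 p21 s0 r0 uf mg2 g2f.
have mE g : measurable_fun setT g -> (forall y, 0 <= g y)%R -> measurable [set x | (l / 4)%:E <= S g x].
  by move=> mg g0; rewrite -[X in measurable X]setTI; apply: emeasurable_fun_c_infty => //; exact: mS.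
apply: (@le_trans _ _ (mu ([set x | (l / 4)%:E <= S g1 x] `|` [set x | (l / 4)%:E <= S g2 x]))).
  apply: le_measure; rewrite ?inE.
  - rewrite -[X in measurable X]setTI; apply: emeasurable_fun_lt => //.
    exact: measurable_potential_op.
  - by apply: measurableU; exact: mE.
  move=> x /= lF.
  have /orP[h1|h1] : ((l / 4)%:E <= S g1 x) || (S g1 x < (l / 4)%:E) by rewrite leNgt orNb.
    by left.
  have /orP[h2|h2] : ((l / 4)%:E <= S g2 x) || (S g2 x < (l / 4)%:E) by rewrite leNgt orNb.
    by right.
  have := lt_le_trans lF (potential_op_split x p11 sD r0 uf); rewrite tail -/(S f x) fS.
  move=> h; exfalso; move: h; apply/negP; rewrite -leNgt.
  apply: (@le_trans _ _ ((l / 4)%:E + (l / 4)%:E + (l / 2)%:E)).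
    exact: (leeD (leeD (ltW h1) (ltW h2)) (lexx _)).
  by rewrite -!EFinD lee_fin; lra.
apply: (le_trans (measureU2 mu (mE _ mg1 g10) (mE _ mg2 g20))).
have ck : ((l / 4)^-1 * (c * r `^ s / s) = K * l `^ (- k))%R.
  rewrite short powRB ?(gt_eqF l0) ?implybT// powRr1 ?(ltW l0)// powRN.
  have : (l `^ k != 0)%R by rewrite gt_eqF// powR_gt0.
  by move: (l `^ k)%R K => u v u0; field; rewrite u0 gt_eqF.
have cr0 : (0 <= c * r `^ s / s)%R by rewrite divr_ge0 ?mulr_ge0 ?powR_ge0// ltW.
have il0 : (0 <= (l / 4)^-1)%R by rewrite invr_ge0 ltW.
apply: leeD.
  apply: le_trans m1 _.
  apply: le_trans (lee_wpmul2l _ i1) _; first by rewrite lee_fin powR_ge0.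
  rewrite muleA -EFinM !powRr1// ck lee_wpmul2l//.
    by rewrite lee_fin mulr_ge0 ?powR_ge0// ltW.
  by under eq_integral do rewrite powRr1//.
apply: le_trans m2 _.
apply: le_trans (lee_wpmul2l _ i2) _; first by rewrite lee_fin powR_ge0.
rewrite muleA -EFinM -powRM// ck lee_wpmul2l ?lee_fin ?powR_ge0//.
apply: ge0_le_integralT.
- by apply/measurable_EFinP; exact: measurable_fun_powR.
- apply/measurable_EFinP; rewrite (_ : (fun x => _) = (fun x => (1 - (l `^ k < f x)%R%:R) * f x `^ (2 * p))%R).
    apply: measurable_funM; last exact: measurable_fun_powR.
    by apply: measurable_funB => //; exact: measurable_ltr_natr.
  by apply/funext => x; rewrite leNgt; case: (_ < _)%R; rewrite ?subrr ?subr0.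
- by move=> x; rewrite lee_fin powR_ge0.
- move=> x; rewrite lee_fin /g2; case: (f x <= _)%R; first by rewrite !mul1r.
  by rewrite !mul0r powR0 ?gt_eqF.
Qed.

(** The level estimate is inserted in the layer-cake formula and Tonelli's theorem integrates in l
    first. For fixed x the large part gives f f^(p-1) / (q-k) and the small part f^(2p) f^(-p) / q,
    both multiples of f^p. The first integral converges at 0 because q - k > 0, which is p > 1. *)
Lemma integral_potential_op_endpoint :
  exists2 C, (0 <= C)%R & forall f, Lp_unit p f -> \int[mu]_x (potential_op s f x `^ q) <= C%:E.
Proof.
have pk : ((q - k) / k = p - 1)%R by rewrite /k; field; rewrite !gt_eqF.
have e0 : (0 < q - k)%R.
  by rewrite subr_gt0 /k ltr_pdivrMr// -[X in (X < _)%R]mulr1 ltr_pM2l.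
pose a1 := (q * K)%R; pose a2 := (q * K `^ (2 * p))%R.
have a10 : (0 <= a1)%R by apply: mulr_ge0; exact: ltW.
have a20 : (0 <= a2)%R by rewrite mulr_ge0 ?powR_ge0// ltW.
exists (a1 / (q - k) + a2 / q)%R.
  by apply: addr_ge0; apply: divr_ge0 => //; exact: ltW.
move=> f uf; have [mf f0 fp] := uf.
apply: le_trans (integral_layer_cake_le mu (measurable_potential_op s mf f0) (fun x => potential_op_ge0 s x f0) q0) _.
have m2 : measurable_fun setT (fun z : measurableTypeR R * T => (z.1 : R)) by exact: measurable_fst.
have mf2 : measurable_fun setT (fun z : measurableTypeR R * T => f z.2) by exact: (measurableT_comp mf measurable_snd).
pose G1 (z : measurableTypeR R * T) : \bar R := (f z.2 * (z.1 `^ (q - k - 1) * (z.1 `^ k < f z.2)%R%:R))%:E.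
pose G2 (z : measurableTypeR R * T) : \bar R := (f z.2 `^ (2 * p) * (z.1 `^ (- q - 1) * (f z.2 <= z.1 `^ k)%R%:R))%:E.
have mG1 : measurable_fun setT G1.
  apply/measurable_EFinP; apply: measurable_funM => //; apply: measurable_funM; first exact: measurable_fun_powR.
  by apply: measurable_ltr_natr => //; exact: measurable_fun_powR.
have mG2 : measurable_fun setT G2.
  apply/measurable_EFinP; apply: measurable_funM; first exact: measurable_fun_powR.
  apply: measurable_funM; first exact: measurable_fun_powR.
  rewrite (_ : (fun z => _) = (fun z => 1 - (z.1 `^ k < f z.2)%R%:R)%R).
    by apply: measurable_funB => //; apply: measurable_ltr_natr => //; exact: measurable_fun_powR.
  by apply/funext => z; rewrite leNgt; case: (_ < _)%R; rewrite ?subrr ?subr0.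
have G10 z : 0 <= G1 z by rewrite lee_fin !mulr_ge0 ?powR_ge0.
have G20 z : 0 <= G2 z by rewrite lee_fin !mulr_ge0 ?powR_ge0.
have mS : measurable (`]0%R, +oo[ : set R) by exact: measurable_itv.
have mI1 := @measurable_fun_fubini_tonelli_F _ _ _ _ _ mu _ mG1 G10.
have mI2 := @measurable_fun_fubini_tonelli_F _ _ _ _ _ mu _ mG2 G20.
have I10 l : 0 <= \int[mu]_x G1 (l, x) by exact: integral_ge0.
have I20 l : 0 <= \int[mu]_x G2 (l, x) by exact: integral_ge0.
apply: (@le_trans _ _ (\int[lambda]_(l in `]0%R, +oo[) (a1%:E * \int[mu]_x G1 (l, x) + a2%:E * \int[mu]_x G2 (l, x)))).
  apply: ge0_le_integral => //.
  - by move=> l _; rewrite mule_ge0// lee_fin mulr_ge0 ?powR_ge0// ltW.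
  - apply: measurable_funTS; apply: emeasurable_funM.
      by apply/measurable_EFinP; apply: measurable_funM => //; exact: measurable_powR.
    exact: (measurable_measure_level mu (measurable_potential_op s mf f0)).
  - by apply: measurable_funTS; apply: emeasurable_funD; apply: emeasurable_funM.
  move=> l /=; rewrite in_itv/= andbT => l0.
  apply: (le_trans (lee_wpmul2l _ (measure_potential_op_level uf l0))).
    by rewrite lee_fin mulr_ge0 ?powR_ge0// ltW.
  have lq0 : (0 <= q * l `^ (q - 1))%R by rewrite mulr_ge0 ?powR_ge0// ltW.
  have A1 : 0 <= (K * l `^ (- k))%:E * \int[mu]_x ((l `^ k < f x)%R%:R * f x)%:E.
    apply: mule_ge0; first by rewrite lee_fin mulr_ge0 ?powR_ge0// ltW.
    by apply: integral_ge0 => x _; rewrite lee_fin mulr_ge0.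
  have A2 : 0 <= ((K * l `^ (- k)) `^ (2 * p))%:E * \int[mu]_x ((f x <= l `^ k)%R%:R * f x `^ (2 * p))%:E.
    apply: mule_ge0; first by rewrite lee_fin powR_ge0.
    by apply: integral_ge0 => x _; rewrite lee_fin mulr_ge0 ?powR_ge0.
  rewrite ge0_muleDr// le_eqVlt; apply/orP; left; apply/eqP; congr (_ + _).
    rewrite muleA -EFinM.
    have -> : (q * l `^ (q - 1) * (K * l `^ (- k)) = a1 * l `^ (q - k - 1))%R.
      rewrite mulrACA -powRD; last by rewrite (gt_eqF l0) implybT.
      by congr (_ * _ `^ _)%R; ring.
    rewrite EFinM -muleA -ge0_integralZT ?powR_ge0//; last 2 first.
    - apply/measurable_EFinP; apply: measurable_funM => //.
      by apply: measurable_ltr_natr => //; exact: measurable_cst.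
    - by move=> x; rewrite lee_fin mulr_ge0.
    by congr (_ * _); apply: eq_integral => x _; rewrite -EFinM /G1; congr EFin; ring.
  rewrite muleA -EFinM.
  have -> : (q * l `^ (q - 1) * (K * l `^ (- k)) `^ (2 * p) = a2 * l `^ (- q - 1))%R.
    rewrite powRM ?powR_ge0 ?(ltW K0)// mulrACA -powRrM -powRD; last by rewrite (gt_eqF l0) implybT.
    by congr (_ * _ `^ _)%R; rewrite /k; field; rewrite gt_eqF.
  rewrite EFinM -muleA -ge0_integralZT ?powR_ge0//; last 2 first.
  - apply/measurable_EFinP; apply: measurable_funM; last exact: measurable_fun_powR.
    rewrite (_ : (fun x => _) = (fun x => 1 - (l `^ k < f x)%R%:R)%R).
      by apply: measurable_funB => //; apply: measurable_ltr_natr => //; exact: measurable_cst.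
    by apply/funext => x; rewrite leNgt; case: (_ < _)%R; rewrite ?subrr ?subr0.
  - by move=> x; rewrite lee_fin mulr_ge0 ?powR_ge0.
  by congr (_ * _); apply: eq_integral => x _; rewrite -EFinM /G2; congr EFin; move: (f x `^ _)%R (l `^ _)%R => *; ring.
rewrite ge0_integralD//; last 4 first.
- by move=> l _; rewrite mule_ge0// lee_fin.
- by apply: measurable_funTS; apply: emeasurable_funM.
- by move=> l _; rewrite mule_ge0// lee_fin.
- by apply: measurable_funTS; apply: emeasurable_funM.
rewrite !ge0_integralZl//; last 2 first.
- exact: measurable_funTS.
- exact: measurable_funTS.
rewrite -(tonelli_domain lambda mu mS mG1 G10) -(tonelli_domain lambda mu mS mG2 G20).
have J1 x : \int[lambda]_(l in `]0%R, +oo[) G1 (l, x) = (q - k)^-1%:E * ((f x `^ p)%R)%:E.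
  rewrite /G1 /=; under eq_integral do rewrite EFinM.
  rewrite ge0_integralZl//; last 3 first.
  - apply/measurable_EFinP; apply: measurable_funTS; apply: measurable_funM; first exact: measurable_powR.
    by apply: measurable_ltr_natr => //; exact: measurable_powR.
  - by move=> l _; rewrite lee_fin mulr_ge0 ?powR_ge0.
  - by rewrite lee_fin.
  rewrite integral_level_above// pk -!EFinM; congr EFin.
  have := f0 x; rewrite le_eqVlt => /orP[/eqP <-|fx0].
    by rewrite mul0r powR0 ?mulr0// gt_eqF.
  by rewrite mulrA [(f x * _)%R]mulrC powR_subr1K// mulrC.
have J2 x : \int[lambda]_(l in `]0%R, +oo[) G2 (l, x) = q^-1%:E * ((f x `^ p)%R)%:E.
  rewrite /G2 /=; under eq_integral do rewrite EFinM.
  rewrite ge0_integralZl//; last 3 first.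
  - apply/measurable_EFinP; apply: measurable_funTS; apply: measurable_funM; first exact: measurable_powR.
    rewrite (_ : (fun l => _) = (fun l : R => 1 - (l `^ k < f x)%R%:R)%R).
      by apply: measurable_funB => //; apply: measurable_ltr_natr => //; exact: measurable_powR.
    by apply/funext => l; rewrite leNgt; case: (_ < _)%R; rewrite ?subrr ?subr0.
  - by move=> l _; rewrite lee_fin mulr_ge0 ?powR_ge0.
  - by rewrite lee_fin powR_ge0.
  have := f0 x; rewrite le_eqVlt => /orP[/eqP <-|fx0].
    by rewrite !powR0 ?mul0e ?mule0// gt_eqF// mulr_gt0.
  rewrite integral_level_below// -!EFinM mulrA -powRD; last by rewrite (gt_eqF fx0) implybT.
  by rewrite mulrC; congr (_ * _ `^ _)%:E; rewrite /k; field; rewrite !gt_eqF.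
under eq_integral do rewrite J1.
under [X in _ + _ * X <= _]eq_integral do rewrite J2.
have mfp : measurable_fun setT (fun x => ((f x `^ p)%R)%:E) by apply/measurable_EFinP; exact: measurable_fun_powR.
rewrite !ge0_integralZT//; last 4 first.
- by rewrite invr_ge0 ltW.
- by move=> x; rewrite lee_fin powR_ge0.
- by rewrite invr_ge0 ltW.
- by move=> x; rewrite lee_fin powR_ge0.
rewrite EFinD !muleA -!EFinM; apply: leeD.
  by rewrite -[leRHS]mule1 lee_wpmul2l// lee_fin divr_ge0// ltW.
by rewrite -[leRHS]mule1 lee_wpmul2l// lee_fin divr_ge0// ltW.
Qed.

End endpoint.

(** Outside the strict case, s <= D |1/p - 1/q| < D, since 1/p and 1/q lie in ]0, 1]. The
    admissibility inequalities then force 1/q = 1/p - s/D: this is the endpoint if p > 1 and the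
    excluded pair if p = 1. *)
Lemma integral_potential_op_unit p q s : (1 <= p)%R -> (1 <= q)%R -> (0 < s)%R ->
  (D <= s)%R \/ [/\ (p^-1 - s / D <= q^-1)%R, (q^-1 < p^-1 + s / D)%R & ~ (p = 1 /\ q = D / (D - s))%R] ->
  exists2 C, (0 <= C)%R & forall f, Lp_unit p f -> \int[mu]_x (potential_op s f x `^ q) <= C%:E.
Proof.
move=> p1 q1 s0 h.
have p0 : (0 < p)%R by exact: lt_le_trans p1.
have q0 : (0 < q)%R by exact: lt_le_trans q1.
have ip1 : (0 < p^-1 <= 1)%R by rewrite invr_gt0 p0 invf_le1.
have iq1 : (0 < q^-1 <= 1)%R by rewrite invr_gt0 q0 invf_le1.
have [lt|ge] := ltP (D * `|p^-1 - q^-1|)%R s; first exact: integral_potential_op_strict.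
have {h}[Ds|[pq1 pq2 pq3]] := h.
  have : (`|p^-1 - q^-1| < 1)%R.
    by move: ip1 iq1 => /andP[? ?] /andP[? ?]; rewrite ltr_norml; apply/andP; split; lra.
  by rewrite -(ltr_pM2l D0) mulr1 => /(le_lt_trans ge)/(le_lt_trans Ds); rewrite ltxx.
have sE : (s = D * (p^-1 - q^-1))%R.
  have sD : (s / D <= `|p^-1 - q^-1|)%R by rewrite ler_pdivrMr// mulrC.
  have : (p^-1 - q^-1 = s / D)%R.
    by move: sD; case: (ler0P (p^-1 - q^-1)%R) => ? ?; have := divr_gt0 s0 D0; lra.
  by move=> ->; field; rewrite gt_eqF.
move: p1; rewrite le_eqVlt => /orP[/eqP p1|p1]; last exact: integral_potential_op_endpoint.
exfalso; apply: pq3; split => //.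
have qD : (D - s = D / q)%R by rewrite sE -p1; field; rewrite !gt_eqF.
by rewrite qD; field; rewrite !gt_eqF.
Qed.

(** By homogeneity. The radius r is any positive bound of the norm of f, so that f can be divided by
    it even when it vanishes almost everywhere. *)
Lemma integral_potential_op_le p q s : (1 <= p)%R -> (1 <= q)%R -> (0 < s)%R ->
  (D <= s)%R \/ [/\ (p^-1 - s / D <= q^-1)%R, (q^-1 < p^-1 + s / D)%R & ~ (p = 1 /\ q = D / (D - s))%R] ->
  exists2 C, (0 <= C)%R & forall f r, measurable_fun setT f -> (forall x, 0 <= f x)%R -> (0 < r)%R ->
    \int[mu]_x ((f x `^ p)%R)%:E <= ((r `^ p)%R)%:E ->
    \int[mu]_x (potential_op s f x `^ q) <= ((C * r `^ q)%R)%:E.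
Proof.
move=> p1 q1 s0 h; have [C C0 hC] := integral_potential_op_unit p1 q1 s0 h.
exists C => // f r mf f0 r0 fr.
have r10 : (0 <= r^-1)%R by rewrite invr_ge0 ltW.
have rp0 : (0 < r `^ p)%R by exact: powR_gt0.
pose g x := (r^-1 * f x)%R.
have mg : measurable_fun setT g by exact: measurable_funM.
have g0 x : (0 <= g x)%R by rewrite mulr_ge0.
have ug : Lp_unit p g.
  split => //.
  have E x : ((g x `^ p)%R)%:E = ((r^-1 `^ p)%R)%:E * ((f x `^ p)%R)%:E by rewrite /g powRM.
  under eq_integral do rewrite E.
  rewrite ge0_integralZT ?powR_ge0//; last 2 first.
  - by apply/measurable_EFinP; exact: measurable_fun_powR.
  - by move=> x; rewrite lee_fin powR_ge0.
  apply: le_trans (lee_wpmul2l _ fr) _; first by rewrite lee_fin powR_ge0.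
  by rewrite -EFinM -powRM ?(ltW r0)// mulVf ?gt_eqF// powR1.
have fg t x : kernel_op f t x = r%:E * kernel_op g t x.
  have h0 : measurable_fun setT (fun _ : T => 0%R : R) by exact: measurable_cst.
  have := kernel_opD t x mg h0 g0 (fun=> lexx 0%R) (ltW r0) (lexx 0%R).
  rewrite mul0e adde0 => <-; congr kernel_op; apply/funext => y.
  by rewrite mulr0 addr0 /g mulVKf// gt_eqF.
have Pfg x : potential_op s f x = r%:E * potential_op s g x.
  rewrite /potential_op -ge0_integralZl//.
  - by apply: eq_integral => t _; rewrite fg muleA.
  - apply: measurable_funTS; apply: emeasurable_funM; first exact: measurable_kernel_op_time.
    by apply/measurable_EFinP; exact: measurable_powR.
  - by move=> t _; rewrite mule_ge0 ?kernel_op_ge0// lee_fin powR_ge0.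
  - by rewrite lee_fin ltW.
under eq_integral => x _.
  rewrite Pfg poweRM ?potential_op_ge0 ?lee_fin ?(ltW r0)// poweR_EFin.
  over.
rewrite ge0_integralZT ?powR_ge0//; last 2 first.
- by apply: measurable_fun_poweR; exact: measurable_potential_op.
- by move=> x; exact: poweR_ge0.
by rewrite mulrC EFinM lee_wpmul2l ?lee_fin ?powR_ge0//; exact: hC.
Qed.

End ultracontractive.

(** * Potentials *)

Section measurable_integral.
Context {d1 d2 : measure_display} {T1 : measurableType d1} {T2 : measurableType d2} {R : realType}.
Variable m1 : {sigma_finite_measure set T1 -> \bar R}.
Local Open Scope ereal_scope.

Lemma measurable_fun_integral_fst (F : T1 * T2 -> \bar R) : measurable_fun setT F ->
  measurable_fun setT (fun y => \int[m1]_x F (x, y)).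
Proof.
move=> mF.
rewrite (_ : (fun y => _) = (fun y => \int[m1]_x F^\+ (x, y) - \int[m1]_x F^\- (x, y))).
  apply: emeasurable_funB.
    apply: (@measurable_fun_fubini_tonelli_G _ _ _ _ _ m1) => //; exact: measurable_funepos.
  apply: (@measurable_fun_fubini_tonelli_G _ _ _ _ _ m1) => //; exact: measurable_funeneg.
apply/funext => y; rewrite integralE; congr (_ - _); apply: eq_integral => x _.
  by rewrite !funeposE.
by rewrite !funenegE.
Qed.

End measurable_integral.

(** * The potential kernel and its majorant *)

Section potential_kernel.
Context {R : realType} {d : nat}.
Variables (alpha : 'I_d -> R) (sigma : R).
Hypotheses (d0 : (0 < d)%N) (a2 : forall i, (- 2^-1 <= alpha i)%R) (sigma0 : (0 < sigma)%R).
Local Notation X := (d.-tuple (measurableTypeR R)).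
Local Notation mu := (dunkl_measure alpha).
Local Notation D := (hom_dim alpha).
Local Notation H := (heat_majorant alpha).
Local Notation lambda := (@lebesgue_measure R).
Local Open Scope ereal_scope.

(** The integrand of the potential kernel, extended by 0 to t <= 0 so as to be measurable on the
    whole product space. *)
Definition heat_weight (z : measurableTypeR R * (X * X)) : R :=
  if (0 < z.1)%R then (heat_kernel alpha z.1 z.2.1 z.2.2 * z.1 `^ (sigma - 1))%R else 0%R.

Lemma measurable_heat_weight : measurable_fun setT heat_weight.
Proof.
have mP : measurable [set z : measurableTypeR R * (X * X) | (0 < z.1)%R].
  by apply: measurable_ltr_set; [exact: measurable_cst|exact: measurable_fst].
rewrite (_ : heat_weight = (fun z : measurableTypeR R * (X * X) => (heat_kernel alpha z.1 z.2.1 z.2.2 * z.1 `^ (sigma - 1))%R) \_ [set z | (0 < z.1)%R]).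
  apply/(measurable_restrictT _ _).1 => //; apply: measurable_funM.
    exact: measurable_heat_kernel.
  by apply: measurable_funTS; apply: measurable_fun_powR; exact: measurable_fst.
by apply/funext => z; rewrite /heat_weight patchE mem_setE.
Qed.

Lemma potential_kernelE x y :
  potential_kernel alpha sigma x y = (Gamma sigma)^-1%:E * \int[lambda]_t (heat_weight (t, (x, y)))%:E.
Proof.
congr (_ * _); rewrite integral_mkcond; apply: eq_integral => t _.
by rewrite patchE /heat_weight mem_setE /= in_itv/= andbT; case: ifPn.
Qed.

Lemma measurable_potential_kernel :
  measurable_fun setT (fun z : X * X => potential_kernel alpha sigma z.1 z.2).
Proof.
under eq_fun do rewrite potential_kernelE.
apply: emeasurable_funM; first exact: measurable_cst.
have := @measurable_fun_integral_fst _ _ _ _ _ lambda (EFin \o heat_weight).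
have -> : (fun x : X * X => \int[lambda]_t (heat_weight (t, (x.1, x.2)))%:E) =
    (fun y => \int[lambda]_x (EFin \o heat_weight) (x, y)).
  by apply/funext => -[].
by apply; apply/measurable_EFinP; exact: measurable_heat_weight.
Qed.

Definition kernel_majorant (x y : X) : \bar R :=
  \int[lambda]_(t in `]0%R, +oo[) (H t x y * t `^ (sigma - 1))%:E.

Lemma measurable_majorant_weight : measurable_fun setT
  (fun z : measurableTypeR R * (X * X) => (H z.1 z.2.1 z.2.2 * z.1 `^ (sigma - 1))%:E).
Proof.
apply/measurable_EFinP; apply: measurable_funM; first exact: measurable_heat_majorant.
by apply: measurable_fun_powR; exact: measurable_fst.
Qed.

Lemma majorant_weight_ge0 (t : R) x y : 0 <= (H t x y * t `^ (sigma - 1))%:E.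
Proof. by rewrite lee_fin mulr_ge0 ?powR_ge0 ?heat_majorant_ge0. Qed.

Lemma measurable_kernel_majorant : measurable_fun setT (fun z : X * X => kernel_majorant z.1 z.2).
Proof.
apply: (@measurable_fun_integral_domain _ _ _ _ _ lambda _
  (fun w : measurableTypeR R * (X * X) => (H w.1 w.2.1 w.2.2 * w.1 `^ (sigma - 1))%:E)) => //.
  exact: measurable_majorant_weight.
by move=> z; exact: majorant_weight_ge0.
Qed.

Lemma kernel_majorant_ge0 x y : 0 <= kernel_majorant x y.
Proof. by apply: integral_ge0 => t _; exact: majorant_weight_ge0. Qed.

Lemma integral_abs_heat_weight_le x y :
  \int[lambda]_t `|(heat_weight (t, (x, y)))%:E| <= kernel_majorant x y.
Proof.
rewrite /kernel_majorant [leRHS]integral_mkcond; apply: ge0_le_integralT.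
- apply/measurable_EFinP; apply: measurableT_comp; first exact: normr_measurable.
  have mp : measurable_fun setT (fun t : measurableTypeR R => (t, (x, y))) by exact: measurable_fun_pair.
  exact: (measurableT_comp measurable_heat_weight mp).
- apply/(measurable_restrictT _ _).1 => //; apply: measurable_funTS.
  have mp : measurable_fun setT (fun t : measurableTypeR R => (t, (x, y))) by exact: measurable_fun_pair.
  exact: (measurableT_comp measurable_majorant_weight mp).
- by move=> t; exact: abse_ge0.
move=> t; rewrite patchE /heat_weight mem_setE /= in_itv/= andbT; case: ifPn => t0; last by rewrite normr0.
rewrite lee_fin normrM (ger0_norm (powR_ge0 _ _)) ler_wpM2r ?powR_ge0//.
exact: norm_heat_kernel_le.
Qed.

Lemma Gamma_inv_ge0 : (0 <= (Gamma sigma)^-1)%R.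
Proof. by rewrite invr_ge0 ltW// Gamma_gt0. Qed.

Lemma measurable_heat_weight_section x y : measurable_fun setT (fun t : measurableTypeR R => (heat_weight (t, (x, y)))%:E).
Proof.
have mp : measurable_fun setT (fun t : measurableTypeR R => (t, (x, y))) by exact: measurable_fun_pair.
apply/measurable_EFinP; exact: (measurableT_comp measurable_heat_weight mp).
Qed.

Lemma abse_potential_kernel_le x y :
  `|potential_kernel alpha sigma x y| <= (Gamma sigma)^-1%:E * kernel_majorant x y.
Proof.
rewrite potential_kernelE abseM gee0_abs ?lee_fin ?Gamma_inv_ge0//.
rewrite lee_wpmul2l ?lee_fin ?Gamma_inv_ge0//.
apply: le_trans (integral_abs_heat_weight_le x y).
by apply: le_abse_integral => //; exact: measurable_heat_weight_section.
Qed.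

(** Tonelli's theorem in (t, y) links the kernel to the time integral of operators studied in the
    abstract part. *)
Lemma integral_kernel_majorantM (u : X -> R) x : measurable_fun setT u -> (forall y, 0 <= u y)%R ->
  \int[mu]_y (kernel_majorant x y * (u y)%:E) = potential_op mu H sigma u x.
Proof.
move=> mu_ u0.
pose F (z : measurableTypeR R * X) : \bar R := (H z.1 x z.2 * u z.2 * z.1 `^ (sigma - 1))%:E.
have mp : measurable_fun setT (fun z : measurableTypeR R * X => (z.1, (x, z.2))).
  by apply: measurable_fun_pair => //; apply: measurable_fun_pair.
have mHp : measurable_fun setT (fun z : measurableTypeR R * X => H z.1 x z.2).
  exact: (measurableT_comp (measurable_heat_majorant a2) mp).
have mF : measurable_fun setT F.
  apply/measurable_EFinP; apply: measurable_funM.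
    by apply: measurable_funM => //; exact: (measurableT_comp mu_ measurable_snd).
  by apply: measurable_fun_powR; exact: measurable_fst.
have F0 z : 0 <= F z by rewrite lee_fin !mulr_ge0 ?powR_ge0 ?heat_majorant_ge0.
have mS : measurable (`]0%R, +oo[ : set R) by exact: measurable_itv.
transitivity (\int[mu]_y \int[lambda]_(t in `]0%R, +oo[) F (t, y)).
  apply: eq_integral => y _; rewrite /kernel_majorant muleC -ge0_integralZl//.
  - by apply: eq_integral => t _; rewrite -EFinM; congr EFin; rewrite /= mulrCA mulrA mulrC; ring.
  - apply: measurable_funTS.
    have mq : measurable_fun setT (fun t : measurableTypeR R => (t, (x, y))) by exact: measurable_fun_pair.
    exact: (measurableT_comp measurable_majorant_weight mq).
  - by move=> t _; exact: majorant_weight_ge0.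
  - by rewrite lee_fin.
rewrite (tonelli_domain lambda mu mS mF F0); apply: eq_integral => t _.
rewrite /kernel_op /F /= muleC -ge0_integralZl//.
- by apply: eq_integral => y _; rewrite -EFinM mulrC.
- apply/measurable_EFinP; apply: measurable_funM => //.
  have mq : measurable_fun setT (fun y : X => (t : measurableTypeR R, y)) by exact: measurable_fun_pair.
  exact: (measurableT_comp mHp mq).
- by move=> y _; rewrite lee_fin mulr_ge0 ?heat_majorant_ge0.
- by rewrite lee_fin powR_ge0.
Qed.

Lemma kernel_majorant_bounds : exists2 c, (0 < c)%R & [/\ forall (t : measurableTypeR R) (x y : X), (0 <= H t x y)%R,
  forall (t : measurableTypeR R) x y, H t x y = H t y x,
  measurable_fun setT (fun z : measurableTypeR R * (X * X) => H z.1 z.2.1 z.2.2) &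
  forall t : R, (0 < t)%R ->
  [/\ forall x y, (H t x y <= c * (t `^ (- D) * expR (- (D * t))))%R,
      forall x, \int[mu]_y (H t x y)%:E <= (c * expR (- (D * t)))%:E &
      \int[mu]_x \int[mu]_y (H t x y)%:E <= (c * (t `^ (- D) * expR (- (D * t))))%:E]].
Proof.
have [c c0 h] := heat_majorant_bounds d0 a2; exists c => //; split => //.
- by move=> t x y; exact: heat_majorant_ge0.
- by move=> t x y; exact: heat_majorantC.
- exact: measurable_heat_majorant.
Qed.

Lemma integral_heat_potential_le p q : (1 <= p)%R -> (1 <= q)%R ->
  (D <= sigma)%R \/ admissible_exponents alpha sigma p q ->
  exists2 C, (0 <= C)%R & forall (f : X -> R) (r : R), measurable_fun setT f -> (forall x, 0 <= f x)%R -> (0 < r)%R ->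
    \int[mu]_x ((f x `^ p)%R)%:E <= ((r `^ p)%R)%:E ->
    \int[mu]_x (potential_op mu H sigma f x `^ q) <= ((C * r `^ q)%R)%:E.
Proof.
move=> p1 q1 h; have [c c0 [h0 hC mh hB]] := kernel_majorant_bounds.
have D0 := hom_dim_gt0 d0 a2.
apply: (@integral_potential_op_le _ _ _ mu _ c D h0 hC mh c0 D0) => //.
- by move=> t x y t0; have [+ _ _] := hB t t0; exact.
- by move=> t x t0; have [_ + _] := hB t t0; exact.
- by move=> t t0; have [_ _] := hB t t0.
Qed.

Lemma measurable_heat_potential (u : X -> R) : measurable_fun setT u -> (forall x, 0 <= u x)%R ->
  measurable_fun setT (potential_op mu H sigma u).
Proof.
move=> mu_ u0; have [c c0 [h0 hC mh hB]] := kernel_majorant_bounds.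
exact: (measurable_potential_op mu h0 mh).
Qed.

Lemma heat_potential_ge0 (u : X -> R) x : (forall x, 0 <= u x)%R -> 0 <= potential_op mu H sigma u x.
Proof.
move=> u0; have [c c0 [h0 hC mh hB]] := kernel_majorant_bounds.
exact: (potential_op_ge0 mu h0).
Qed.

(** One real component of [potential], before [fine] is applied. *)
Definition real_potential (u : X -> R) x : \bar R := \int[mu]_y (potential_kernel alpha sigma x y * (u y)%:E).

Lemma measurable_potential_kernelM (u : X -> R) x : measurable_fun setT u ->
  measurable_fun setT (fun y => potential_kernel alpha sigma x y * (u y)%:E).
Proof.
move=> mu_; apply: emeasurable_funM; last exact/measurable_EFinP.
have mp : measurable_fun setT (fun y : X => (x, y)) by exact: measurable_fun_pair.
exact: (measurableT_comp measurable_potential_kernel mp).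
Qed.

Lemma integral_abs_potential_kernel_le (u v : X -> R) x : measurable_fun setT u -> measurable_fun setT v ->
  (forall y, `|u y| <= v y)%R ->
  \int[mu]_y `|potential_kernel alpha sigma x y * (u y)%:E| <=
  (Gamma sigma)^-1%:E * potential_op mu H sigma v x.
Proof.
move=> mu_ mv uv; have v0 y : (0 <= v y)%R by exact: le_trans (uv y).
have mK : measurable_fun setT (fun y : X => kernel_majorant x y).
  have mp : measurable_fun setT (fun y : X => (x, y)) by exact: measurable_fun_pair.
  exact: (measurableT_comp measurable_kernel_majorant mp).
have mKv : measurable_fun setT (fun y : X => kernel_majorant x y * (v y)%:E).
  by apply: emeasurable_funM => //; exact/measurable_EFinP.
have Kv0 y : 0 <= kernel_majorant x y * (v y)%:E.
  by rewrite mule_ge0 ?kernel_majorant_ge0// lee_fin.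
rewrite -integral_kernel_majorantM// -ge0_integralZT ?Gamma_inv_ge0//.
apply: ge0_le_integralT.
- by apply: measurableT_comp => //; exact: measurable_potential_kernelM.
- by apply: emeasurable_funM => //; exact: measurable_cst.
- by move=> y; exact: abse_ge0.
move=> y; rewrite abseM muleA; apply: lee_pmul => //; first exact: abse_potential_kernel_le.
by rewrite lee_fin.
Qed.

Lemma measurable_real_potential (u : X -> R) : measurable_fun setT u ->
  measurable_fun setT (real_potential u).
Proof.
move=> mu_.
apply: (@measurable_fun_integral_fst _ _ _ _ _ mu (fun z : X * X => potential_kernel alpha sigma z.2 z.1 * (u z.1)%:E)).
apply: emeasurable_funM; last by apply/measurable_EFinP; exact: (measurableT_comp mu_ measurable_fst).
have mp : measurable_fun setT (fun z : X * X => (z.2, z.1)) by exact: measurable_fun_pair.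
exact: (measurableT_comp measurable_potential_kernel mp).
Qed.

(** This holds at every x: [fine] sends infinite values to 0, and the right side may be infinite. *)
Lemma abs_real_potential_le (u v : X -> R) x : measurable_fun setT u -> measurable_fun setT v ->
  (forall y, `|u y| <= v y)%R ->
  (`|fine (real_potential u x)|)%:E <= (Gamma sigma)^-1%:E * potential_op mu H sigma v x.
Proof.
move=> mu_ mv uv; apply: le_trans (integral_abs_potential_kernel_le x mu_ mv uv).
have := le_abse_integral mu measurableT (measurable_potential_kernelM x mu_).
by rewrite -/(real_potential u x); apply: le_trans; case: (real_potential u x) => [r| |] //=; rewrite normr0 leey.
Qed.

Lemma potential_kernelM_integrable (u v : X -> R) x : measurable_fun setT u -> measurable_fun setT v ->
  (forall y, `|u y| <= v y)%R -> potential_op mu H sigma v x < +oo ->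
  mu.-integrable setT (fun y => potential_kernel alpha sigma x y * (u y)%:E).
Proof.
move=> mu_ mv uv fin; apply/integrableP; split; first exact: measurable_potential_kernelM.
apply: le_lt_trans (integral_abs_potential_kernel_le x mu_ mv uv) _.
have v0 y : (0 <= v y)%R by exact: le_trans (uv y).
by rewrite lte_mul_pinfty ?lee_fin ?Gamma_inv_ge0.
Qed.

Lemma ae_heat_potential_lty (v : X -> R) q : measurable_fun setT v -> (forall y, 0 <= v y)%R -> (0 < q)%R ->
  \int[mu]_x (potential_op mu H sigma v x `^ q) < +oo ->
  {ae mu, forall x, potential_op mu H sigma v x < +oo}.
Proof.
move=> mv v0 q0 fin.
have mI := measurable_heat_potential mv v0.
have : mu.-integrable setT (fun x => potential_op mu H sigma v x `^ q).
  apply/integrableP; split; first exact: measurable_fun_poweR.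
  by under eq_integral do rewrite gee0_abs ?poweR_ge0//.
move=> /(integrable_ae measurableT); apply: filterS => x /(_ I).
rewrite ltey; apply: contraPneq => ->; rewrite poweRyr ?gt_eqF//.
Qed.

End potential_kernel.

(** * Boundedness from L^p to L^q for complex functions *)

Section Lp_Lq.
Context {R : realType} {d : nat}.
Variables (alpha : 'I_d -> R) (sigma : R).
Hypotheses (d0 : (0 < d)%N) (a2 : forall i, (- 2^-1 <= alpha i)%R) (sigma0 : (0 < sigma)%R).
Local Notation X := (d.-tuple (measurableTypeR R)).
Local Notation mu := (dunkl_measure alpha).
Local Notation D := (hom_dim alpha).
Local Notation normc := (@Normc.normc R).
Local Open Scope ereal_scope.
Implicit Types (f : X -> R[i]).

Local Notation I f := (potential_op mu (heat_majorant alpha) sigma f).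

Lemma normc_ge0 (z : R[i]) : (0 <= normc z)%R.
Proof. by case: z => a b; exact: sqrtr_ge0. Qed.

Lemma normc_Re (z : R[i]) : (`|complex.Re z| <= normc z)%R.
Proof. by case: z => a b /=; rewrite -sqrtr_sqr ler_wsqrtr// lerDl sqr_ge0. Qed.

Lemma normc_Im (z : R[i]) : (`|complex.Im z| <= normc z)%R.
Proof. by case: z => a b /=; rewrite -sqrtr_sqr ler_wsqrtr// lerDr sqr_ge0. Qed.

Lemma normc_le (z : R[i]) : (normc z <= `|complex.Re z| + `|complex.Im z|)%R.
Proof.
case: z => a b /=; rewrite -[leRHS]ger0_norm ?addr_ge0// -[leRHS]sqrtr_sqr ler_wsqrtr//.
by rewrite sqrrD !real_normK ?num_real// -addrA lerD2l lerDr mulrn_wge0// mulr_ge0.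
Qed.

Lemma measurable_normc f : cmeasurable f -> measurable_fun setT (fun x => normc (f x)).
Proof.
move=> [mr mi].
rewrite (_ : (fun x => _) = (fun x => (complex.Re (f x) ^+ 2 + complex.Im (f x) ^+ 2) `^ 2^-1)%R).
  by apply: measurable_fun_powR; apply: measurable_funD; exact: measurable_funX.
by apply/funext => x; rewrite powR12_sqrt ?addr_ge0 ?sqr_ge0//; case: (f x).
Qed.

Lemma integral_normc_powR (p : R) f : (0 < p)%R ->
  \int[mu]_x ((normc (f x) `^ p)%R)%:E = cLnorm mu p f `^ p.
Proof.
move=> p0; have pn0 : p != 0%R by rewrite gt_eqF.
have -> := @poweR_Lnorm _ _ _ mu (fun x => (normc (f x))%:E) p pn0; apply: eq_integral => x _.
by rewrite gee0_abs ?lee_fin ?normc_ge0.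
Qed.

Lemma natural_domain_potential f q : (0 < q)%R -> cmeasurable f ->
  \int[mu]_x (I (fun x => normc (f x)) x `^ q) < +oo -> natural_domain alpha sigma f.
Proof.
move=> q0 mf fin; have mn := measurable_normc mf; have [mr mi] := mf.
have := ae_heat_potential_lty d0 a2 mn (fun x => normc_ge0 (f x)) q0 fin.
apply: filterS => x xoo; split.
  apply: (potential_kernelM_integrable d0 a2 sigma0 mr mn _ xoo) => y; exact: normc_Re.
apply: (potential_kernelM_integrable d0 a2 sigma0 mi mn _ xoo) => y; exact: normc_Im.
Qed.

Lemma cmeasurable_potential f : cmeasurable f -> cmeasurable (potential alpha sigma f).
Proof.
move=> [mr mi]; split.
  apply: (measurableT_comp (fine_measurable measurableT)).
  exact: (@measurable_real_potential R d alpha sigma d0 a2 (fun y => complex.Re (f y)) mr).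
apply: (measurableT_comp (fine_measurable measurableT)).
exact: (@measurable_real_potential R d alpha sigma d0 a2 (fun y => complex.Im (f y)) mi).
Qed.

Lemma normc_potential_le f x : cmeasurable f ->
  (normc (potential alpha sigma f x))%:E <= (2 * (Gamma sigma)^-1)%:E * I (fun x => normc (f x)) x.
Proof.
move=> mf; have mn := measurable_normc mf; have [mr mi] := mf.
have hr := abs_real_potential_le d0 a2 sigma0 x mr mn (fun y => normc_Re (f y)).
have hi := abs_real_potential_le d0 a2 sigma0 x mi mn (fun y => normc_Im (f y)).
apply: (@le_trans _ _ (`|fine (real_potential alpha sigma (fun y => complex.Re (f y)) x)|%R%:E +
    `|fine (real_potential alpha sigma (fun y => complex.Im (f y)) x)|%R%:E)).
  by rewrite -EFinD lee_fin; exact: normc_le.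
apply: le_trans (leeD hr hi) _.
rewrite -ge0_muleDl ?lee_fin ?Gamma_inv_ge0// ?mule_ge0//.
by rewrite mulr2n mulrDl !mul1r.
Qed.

Lemma potential_boundedP p q : (1 <= p)%R -> (1 <= q)%R ->
  (D <= sigma)%R \/ admissible_exponents alpha sigma p q -> potential_Lp_Lq alpha sigma p q.
Proof.
move=> p1 q1 h; have [C C0 hC] := integral_heat_potential_le d0 a2 sigma0 p1 q1 h.
have p0 : (0 < p)%R by exact: lt_le_trans p1.
have q0 : (0 < q)%R by exact: lt_le_trans q1.
have G0 := Gamma_inv_ge0 sigma0.
pose K : R := (2 * (Gamma sigma)^-1 * C `^ q^-1)%R.
have K0 : (0 <= K)%R by rewrite !mulr_ge0 ?powR_ge0.
exists K => f [mf fin]; have mn := measurable_normc mf.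
have n0 x : (0 <= normc (f x))%R by exact: normc_ge0.
have N0 : 0 <= cLnorm mu p f by exact: Lnorm_ge0.
have [N NE] : exists N : R, cLnorm mu p f = N%:E.
  by exists (fine (cLnorm mu p f)); rewrite fineK// ge0_fin_numE.
rewrite NE lee_fin in N0.
(* The norm N may be 0, whereas the estimate needs a positive radius: it is proved for every
   positive r >= N, and r is taken arbitrarily close to N at the end. *)
have bnd r : (0 < r)%R -> (N <= r)%R ->
    \int[mu]_x (I (fun x => normc (f x)) x `^ q) <= ((C * r `^ q)%R)%:E.
  move=> r0 Nr; apply: hC => //.
  by rewrite integral_normc_powR// NE poweR_EFin lee_fin ge0_ler_powR ?nnegrE// ltW.
have N10 : (0 < N + 1)%R by rewrite ltr_wpDl.
have lty : \int[mu]_x (I (fun x => normc (f x)) x `^ q) < +oo.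
  by apply: le_lt_trans (bnd _ N10 _) _; rewrite ?lerDl// ltry.
have mI : measurable_fun setT (I (fun x => normc (f x))) by exact: measurable_heat_potential.
have I0 x : 0 <= I (fun x => normc (f x)) x by exact: heat_potential_ge0.
have mP := cmeasurable_potential mf.
have mnP := measurable_normc mP.
have bnd2 r : (0 < r)%R -> (N <= r)%R -> cLnorm mu q (potential alpha sigma f) <= (K * r)%:E.
  move=> r0 Nr.
  have qi0 : (0 <= q^-1)%R by rewrite invr_ge0 ltW.
  have : cLnorm mu q (potential alpha sigma f) `^ q <= (((2 * (Gamma sigma)^-1) `^ q * (C * r `^ q))%R)%:E.
    rewrite -integral_normc_powR//.
    apply: (@le_trans _ _ (\int[mu]_x (((2 * (Gamma sigma)^-1) `^ q)%R%:E * I (fun x => normc (f x)) x `^ q))).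
      apply: ge0_le_integralT.
      - by apply/measurable_EFinP; exact: measurable_fun_powR.
      - by apply: emeasurable_funM; [exact: measurable_cst|exact: measurable_fun_poweR].
      - by move=> x; rewrite lee_fin powR_ge0.
      move=> x; rewrite -poweR_EFin -(poweR_EFin (2 * _)) -poweRM ?lee_fin ?mulr_ge0//.
      by apply: lee_poweR; rewrite ?(ltW q0) ?lee_fin ?normc_ge0//; exact: normc_potential_le.
    rewrite ge0_integralZT ?powR_ge0//; last 2 first.
    - exact: measurable_fun_poweR.
    - by move=> x; exact: poweR_ge0.
    by rewrite EFinM lee_wpmul2l ?lee_fin ?powR_ge0//; exact: bnd.
  move=> /(lee_poweR qi0 (poweR_ge0 _ _)).
  rewrite -poweRrM mulfV ?gt_eqF// poweRe1 ?Lnorm_ge0// poweR_EFin => /le_trans; apply.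
  rewrite lee_fin !powRM ?mulr_ge0 ?powR_ge0// -!powRrM mulfV ?gt_eqF// !powRr1 ?mulr_ge0 ?(ltW r0)//.
  by rewrite /K !mulrA.
split.
- exact: (natural_domain_potential q0 mf lty).
- split; first exact: mP.
  by apply: le_lt_trans (bnd2 _ N10 _) _; rewrite ?lerDl// ltry.
rewrite NE -EFinM; apply/lee_addgt0Pr => e e0.
have K1 : (0 < K + 1)%R by rewrite ltr_wpDl.
have e1 : (0 < e / (K + 1))%R by rewrite divr_gt0.
apply: le_trans (bnd2 (N + e / (K + 1))%R _ _) _; rewrite ?ltr_wpDl ?lerDl ?(ltW e1)//.
rewrite -EFinD lee_fin mulrDr lerD2l mulrCA ler_piMr ?(ltW e0)//.
by rewrite ler_pdivrMr// mul1r lerDl.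
Qed.

End Lp_Lq.

(** * The spectral identity *)

Section spectral.
Context {R : realType} {d : nat}.
Variables (alpha : 'I_d -> R) (sigma : R).
Hypotheses (d0 : (0 < d)%N) (a2 : forall i, (- 2^-1 <= alpha i)%R) (sigma0 : (0 < sigma)%R).
Local Notation X := (d.-tuple (measurableTypeR R)).
Local Notation mu := (dunkl_measure alpha).
Local Notation D := (hom_dim alpha).
Local Notation H := (heat_majorant alpha).
Local Notation lambda := (@lebesgue_measure R).
Local Notation pk := (potential_kernel alpha sigma).
Local Notation km := (kernel_majorant alpha sigma).
Variable k : 'I_d -> nat.
Local Notation h := (hermite alpha k).
Local Notation ev := (eigenvalue_of alpha (\sum_(i < d) k i)).
Local Open Scope ereal_scope.

Lemma measurable_hermite : measurable_fun setT h.
Proof.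
apply: measurable_prod => i _; apply: (measurableT_comp (measurable_hermite1 _ _)).
exact: measurable_tnth.
Qed.

Lemma hermite_bounded : exists2 M, (0 <= M)%R & forall x, (`|h x| <= M)%R.
Proof.
have /fin_all_exists2[C C0 hC] : forall i, exists2 C, (0 < C)%R & forall y, (`|hermite1 (alpha i) (k i) y| <= C * expR (- (6^-1 * y ^+ 2)))%R.
  by move=> i; exact: hermite1_bound.
exists (\prod_i C i)%R; first by apply: prodr_ge0 => i _; exact: ltW.
move=> x; rewrite normr_prod; apply: ler_prod => i _; rewrite normr_ge0/=.
apply: le_trans (hC i _) _; rewrite -[leRHS]mulr1 ler_wpM2l ?(ltW (C0 i))//.
by rewrite -[leRHS]expR0 ler_expR oppr_le0 mulr_ge0 ?sqr_ge0.
Qed.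

Lemma integrable_hermite : mu.-integrable setT (fun x => (h x)%:E).
Proof.
have [i|i|//] := @integral_dunkl_prod R d alpha (fun i => hermite1 (alpha i) (k i)).
  exact: measurable_hermite1.
have [C C0 hC] := hermite1_bound (k i) (a2 i).
have mw : measurable_fun setT (fun y : measurableTypeR R => (`|y| `^ (2 * alpha i + 1))%R).
  by apply: measurable_fun_powR; exact: normr_measurable.
have me : measurable_fun setT (fun y : measurableTypeR R => expR (- (6^-1 * y ^+ 2))%R).
  by apply: measurable_fun_expR; apply: measurableT_comp => //; apply: measurable_funM => //; exact: measurable_funX.
apply: (@le_integrable _ _ _ lambda setT measurableT _
   (fun y => C%:E * (`|y| `^ (2 * (alpha i + 1) - 1) * expR (- (6^-1 * y ^+ 2)))%:E)).
- by apply/measurable_EFinP; apply: measurable_funM => //; exact: measurable_hermite1.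
- move=> y _; rewrite -EFinM !abse_EFin lee_fin [leRHS]ger0_norm; last first.
    by rewrite !mulr_ge0 ?powR_ge0 ?expR_ge0// ltW.
  rewrite normrM (ger0_norm (powR_ge0 _ _)) (_ : (2 * (alpha i + 1) - 1 = 2 * alpha i + 1)%R); last by ring.
  by rewrite mulrCA [leRHS]mulrC ler_wpM2r ?powR_ge0.
- apply: integrableZl => //; apply/integrableP; split.
    apply/measurable_EFinP; apply: measurable_funM => //.
    by apply: measurable_fun_powR; exact: normr_measurable.
  under eq_integral => y _ do rewrite gee0_abs ?lee_fin ?(mulr_ge0 (powR_ge0 _ _) (expR_ge0 _))//.
  by rewrite integral_gauss_moment ?ltry//; have := a2 i; lra.
Qed.

Lemma kernel_majorantC x y : km x y = km y x.
Proof. by rewrite /kernel_majorant; under eq_integral do rewrite heat_majorantC. Qed.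

(** This is the potential of the constant 1: the Schur bound c e^(-Dt) against t^(sigma-1) is a
    Gamma integral. *)
Lemma integral_kernel_majorant_lty x : \int[mu]_y km x y < +oo.
Proof.
have [c c0 [h0 hC mh hB]] := kernel_majorant_bounds d0 a2.
have D0 := hom_dim_gt0 d0 a2.
have E y : km x y = km x y * (1%R)%:E by rewrite mule1.
under eq_integral do rewrite E.
rewrite integral_kernel_majorantM//.
have m1 : measurable_fun setT (fun _ : X => 1%R : R) by exact: measurable_cst.
apply: (@le_lt_trans _ _ (\int[lambda]_(t in `]0%R, +oo[) (c%:E * (t `^ (sigma - 1) * expR (- (D * t)))%:E))).
  apply: ge0_le_integral => //.
  - by move=> t _; rewrite mule_ge0 ?lee_fin ?powR_ge0//; apply: kernel_op_ge0 => // ? .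
  - apply: measurable_funTS; apply: emeasurable_funM.
      by apply: (measurable_kernel_op_time mu h0 mh x m1) => _; exact: ler01.
    by apply/measurable_EFinP; exact: measurable_powR.
  - apply: measurable_funTS; apply: emeasurable_funM; first exact: measurable_cst.
    apply/measurable_EFinP; apply: measurable_funM; first exact: measurable_powR.
    by apply: measurable_fun_expR; apply: measurableT_comp => //; exact: measurable_funM.
  move=> t /=; rewrite in_itv/= andbT => t0; have [_ + _] := hB t t0.
  move=> /(_ x) hx; rewrite -EFinM [(t `^ _ * _)%R]mulrC mulrA EFinM.
  rewrite lee_wpmul2r ?lee_fin ?powR_ge0// /kernel_op.
  by under eq_integral do rewrite mulr1.
rewrite ge0_integralZl//.
- by rewrite integral_gamma_scale// -EFinM ltry.
- apply/measurable_EFinP; apply: measurable_funTS; apply: measurable_funM; first exact: measurable_powR.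
  by apply: measurable_fun_expR; apply: measurableT_comp => //; exact: measurable_funM.
- by move=> t _; rewrite lee_fin mulr_ge0 ?powR_ge0 ?expR_ge0.
- by rewrite lee_fin ltW.
Qed.

Lemma measurable_kernel_majorant_fst y : measurable_fun setT (fun x => km x y).
Proof.
have mp : measurable_fun setT (fun x : X => (x, y)) by exact: measurable_fun_pair.
have mk := @measurable_kernel_majorant R d alpha sigma a2.
exact: (measurableT_comp mk mp).
Qed.

Lemma ae_kernel_majorant_lty y : {ae mu, forall x, km x y < +oo}.
Proof.
have : mu.-integrable setT (fun x => km x y).
  apply/integrableP; split; first exact: measurable_kernel_majorant_fst.
  under eq_integral do rewrite gee0_abs ?kernel_majorant_ge0// kernel_majorantC.
  exact: integral_kernel_majorant_lty.
move=> /(integrable_ae measurableT); apply: filterS => x /(_ Logic.I).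
by rewrite ge0_fin_numE// kernel_majorant_ge0.
Qed.

Lemma eigenvalue_gt0 n : (0 < eigenvalue_of alpha n)%R.
Proof.
have D0 := hom_dim_gt0 d0 a2.
by rewrite /eigenvalue_of ltr_wpDl// ?mulr_ge0// mulr_gt0.
Qed.

Lemma integrable_potential_kernel_hermite y : mu.-integrable setT (fun x => pk x y * (h x)%:E).
Proof.
have [M M0 hM] := hermite_bounded.
have mpk : measurable_fun setT (fun x => pk x y).
  have mp : measurable_fun setT (fun x : X => (x, y)) by exact: measurable_fun_pair.
  exact: (measurableT_comp (@measurable_potential_kernel R d alpha sigma d0 a2) mp).
apply/integrableP; split.
  by apply: emeasurable_funM => //; apply/measurable_EFinP; exact: measurable_hermite.
have G0 := Gamma_inv_ge0 sigma0.
apply: (@le_lt_trans _ _ (\int[mu]_x ((M * (Gamma sigma)^-1)%:E * km x y))).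
  apply: ge0_le_integralT.
  - apply: measurableT_comp => //; apply: emeasurable_funM => //.
    by apply/measurable_EFinP; exact: measurable_hermite.
  - by apply: emeasurable_funM; [exact: measurable_cst|exact: measurable_kernel_majorant_fst].
  - by move=> x; exact: abse_ge0.
  move=> x; rewrite abseM muleC EFinM -muleA; apply: lee_pmul => //; first by rewrite lee_fin.
  exact: abse_potential_kernel_le.
rewrite ge0_integralZT ?mulr_ge0//.
- rewrite lte_mul_pinfty ?lee_fin ?mulr_ge0//.
  by under eq_integral do rewrite kernel_majorantC; exact: integral_kernel_majorant_lty.
- exact: measurable_kernel_majorant_fst.
- by move=> x; exact: kernel_majorant_ge0.
Qed.

Lemma integral_heat_weight_hermite (t : R) y :
  \int[mu]_x (heat_weight alpha sigma (t, (x, y)) * h x)%:E =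
  if (0 < t)%R then (t `^ (sigma - 1) * expR (- (ev * t)) * h y)%:E else 0.
Proof.
rewrite /heat_weight /=; case: ifPn => t0; last first.
  by rewrite integral0_eq// => x _; rewrite mul0r.
have [M M0 hM] := hermite_bounded.
have [c c0 [h0 hC mh hB]] := kernel_majorant_bounds d0 a2.
have [_ hI _] := hB t t0.
have mHt : measurable_fun setT (fun x => H t x y).
  have mp : measurable_fun setT (fun x : X => (t : measurableTypeR R, (x, y))).
    by apply: measurable_fun_pair => //; exact: measurable_fun_pair.
  exact: (measurableT_comp mh mp).
have mP : measurable_fun setT (fun x => heat_kernel alpha t x y * h x)%R.
  apply: measurable_funM; last exact: measurable_hermite.
  have mp : measurable_fun setT (fun x : X => (t : measurableTypeR R, (x, y))).
    by apply: measurable_fun_pair => //; exact: measurable_fun_pair.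
  have mS : measurable [set z : measurableTypeR R * (X * X) | (0 < z.1)%R].
    by apply: measurable_ltr_set; [exact: measurable_cst|exact: measurable_fst].
  apply: (measurable_comp mS _ (measurable_heat_kernel d0 a2) mp).
  by move=> z [x _ <-].
have int : mu.-integrable setT (fun x => (heat_kernel alpha t x y * h x)%:E).
  apply: (@le_integrable _ _ _ mu setT measurableT _ (fun x => M%:E * (H t x y)%:E)).
  - exact/measurable_EFinP.
  - move=> x _; rewrite -EFinM !abse_EFin lee_fin !normrM mulrC; apply: ler_pM => //.
      by rewrite (ger0_norm M0).
    by rewrite (ger0_norm (h0 t x y)) norm_heat_kernel_le.
  - apply: integrableZl => //; apply/integrableP; split; first exact/measurable_EFinP.
    under eq_integral do rewrite gee0_abs ?lee_fin// hC.
    by apply: le_lt_trans (hI y) _; rewrite ltry.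
have E x : (heat_kernel alpha t x y * t `^ (sigma - 1) * h x)%:E =
    (t `^ (sigma - 1))%:E * (heat_kernel alpha t x y * h x)%:E.
  by rewrite -EFinM; congr EFin; rewrite mulrAC mulrC.
under eq_integral do rewrite E.
by rewrite integralZl// integral_heat_kernel_hermite// -EFinM mulrA (mulrC t).
Qed.

(** Fubini's theorem in (x, t), justified by the boundedness of the Hermite function and the
    integrability of the majorant. Integrating in x first gives e^(-ev t) times the Hermite function
    at y, and the remaining time integral is Gamma(sigma) ev^(-sigma). *)
Lemma integral_potential_kernel_hermite y :
  \int[mu]_x (pk x y * (h x)%:E) = (ev `^ (- sigma) * h y)%:E.
Proof.
have [M M0 hM] := hermite_bounded.
have G0 := Gamma_inv_ge0 sigma0.
pose G (z : X * measurableTypeR R) : \bar R := (heat_weight alpha sigma (z.2, (z.1, y)) * h z.1)%:E.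
have mp : measurable_fun setT (fun z : X * measurableTypeR R => (z.2, (z.1, y))).
  by apply: measurable_fun_pair => //; exact: measurable_fun_pair.
have mG : measurable_fun setT G.
  apply/measurable_EFinP; apply: measurable_funM.
    exact: (measurableT_comp (@measurable_heat_weight R d alpha sigma d0 a2) mp).
  exact: (measurableT_comp measurable_hermite measurable_fst).
have msec x : measurable_fun setT (fun t : measurableTypeR R => (heat_weight alpha sigma (t, (x, y)))%:E).
  exact: measurable_heat_weight_section.
have absG x : \int[lambda]_t `|G (x, t)| <= M%:E * km x y.
  have E t : `|G (x, t)| = (`|h x|)%:E * `|(heat_weight alpha sigma (t, (x, y)))%:E|.
    by rewrite /G EFinM abseM muleC.
  under eq_integral do rewrite E.
  rewrite ge0_integralZT//; last by apply: measurableT_comp.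
  apply: lee_pmul => //; first by apply: integral_ge0 => t _; exact: abse_ge0.
    by rewrite lee_fin.
  exact: integral_abs_heat_weight_le.
have iG : (mu \x lambda).-integrable setT G.
  apply/integrable12ltyP => //.
  apply: (@le_lt_trans _ _ (\int[mu]_x (M%:E * km x y))).
    apply: ge0_le_integralT => //.
    - apply: (@measurable_fun_fubini_tonelli_F _ _ _ _ _ lambda (abse \o G)).
        exact: measurableT_comp.
      by move=> z; exact: abse_ge0.
    - by apply: emeasurable_funM; [exact: measurable_cst|exact: measurable_kernel_majorant_fst].
    - by move=> x; apply: integral_ge0.
  rewrite ge0_integralZT//.
  - rewrite lte_mul_pinfty ?lee_fin//.
    by under eq_integral do rewrite kernel_majorantC; exact: integral_kernel_majorant_lty.
  - exact: measurable_kernel_majorant_fst.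
  - by move=> x; exact: kernel_majorant_ge0.
have iGG := @integrable_fubini_F _ _ _ _ _ mu lambda G iG.
transitivity (\int[mu]_x ((Gamma sigma)^-1%:E * \int[lambda]_t G (x, t))).
  apply: ae_eq_integral => //.
  - by have /integrableP[] := integrable_potential_kernel_hermite y.
  - by apply: emeasurable_funM; [exact: measurable_cst|have /integrableP[] := iGG].
  (* Taking the factor [h x] inside the time integral requires integrability in t, which holds where
     the majorant is finite, hence for almost every x. *)
  have := ae_kernel_majorant_lty y; apply: filterS => x xoo _.
  rewrite potential_kernelE -muleA; congr (_ * _); rewrite muleC /G /= -integralZl//.
  - by apply: eq_integral => t _; rewrite -EFinM mulrC.
  - apply/integrableP; split; first exact: msec.
    by apply: le_lt_trans xoo; exact: integral_abs_heat_weight_le.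
rewrite integralZl//.
rewrite (Fubini iG).
have E t : \int[mu]_x G (x, t) = ((fun t => (h y)%:E * (t `^ (sigma - 1) * expR (- (ev * t)))%:E) \_ `]0%R, +oo[) t.
  rewrite /G /= integral_heat_weight_hermite patchE mem_setE /= in_itv/= andbT.
  by case: ifPn => // _; rewrite -EFinM mulrC.
under eq_integral do rewrite E.
rewrite -integral_mkcond.
have e0 := eigenvalue_gt0 (\sum_(i < d) k i)%N.
rewrite integralZl//.
- rewrite integral_gamma_scale// -!EFinM; congr EFin.
  have GG := Gamma_gt0 sigma0.
  by rewrite mulrCA mulKf ?gt_eqF// mulrC.
- apply/integrableP; split.
    apply/measurable_EFinP; apply: measurable_funTS; apply: measurable_funM; first exact: measurable_powR.
    by apply: measurable_fun_expR; apply: measurableT_comp => //; exact: measurable_funM.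
  under eq_integral => t _ do rewrite gee0_abs ?lee_fin ?(mulr_ge0 (powR_ge0 _ _) (expR_ge0 _))//.
  by rewrite integral_gamma_scale// ltry.
Qed.

(** For q = p both inequalities reduce to sigma / D > 0, and the excluded pair with p = q = 1 would
    force sigma = 0. *)
Lemma exponents_self p : (1 <= p)%R -> (D <= sigma)%R \/ admissible_exponents alpha sigma p p.
Proof.
move=> p1; have D0 := hom_dim_gt0 d0 a2; have sD := divr_gt0 sigma0 D0.
have [Ds|sD'] := leP D sigma; first by left.
right; split; [lra|lra|move=> [-> h1]].
have Ds0 : (0 < D - sigma)%R by rewrite subr_gt0.
have : (D = D - sigma)%R by rewrite -[RHS]mul1r [in RHS]h1 divfK// gt_eqF.
by move=> h2; have := sigma0; rewrite -[X in (0 < X)%R](subKr D) -h2 subrr ltxx.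
Qed.

Section real_function.
Variables (p : R) (u v : X -> R).
Hypotheses (p1 : (1 <= p)%R) (mu_ : measurable_fun setT u) (mv : measurable_fun setT v).
Hypotheses (uv : forall x, (`|u x| <= v x)%R) (vp : \int[mu]_x ((v x `^ p)%R)%:E < +oo).
Local Notation I := (potential_op mu H sigma v).

Let v0 x : (0 <= v x)%R. Proof. exact: le_trans (uv x). Qed.
Let p0 : (0 < p)%R. Proof. exact: lt_le_trans p1. Qed.

Lemma le_powRD1 (a : R) : (0 <= a)%R -> (a <= a `^ p + 1)%R.
Proof.
move=> a0; have [a1|a1] := leP a 1%R; first by rewrite ler_wpDl ?powR_ge0.
by rewrite ler_wpDr// -[leLHS]powRr1// ler_powR// ltW.
Qed.

Lemma le_poweRD1 (a : \bar R) : 0 <= a -> a <= a `^ p + 1.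
Proof.
case: a => [a| |]//; first by rewrite lee_fin poweR_EFin -EFinD lee_fin; exact: le_powRD1.
by rewrite poweRyr ?gt_eqF.
Qed.

(** Since F <= F^p + 1 and |h| <= M, the product F |h| is at most M F^p + |h|, and h is
    integrable. *)
Lemma integral_mul_hermite_lty (F : X -> \bar R) : measurable_fun setT F -> (forall x, 0 <= F x) ->
  \int[mu]_x (F x `^ p) < +oo -> \int[mu]_x (F x * (`|h x|)%:E) < +oo.
Proof.
move=> mF F0 Fp; have [M M0 hM] := hermite_bounded.
have mh : measurable_fun setT (fun x => (`|h x|)%:E).
  by apply/measurable_EFinP; apply: measurableT_comp; [exact: normr_measurable|exact: measurable_hermite].
have mFp := measurable_fun_poweR p mF.
have mMF : measurable_fun setT (fun x => M%:E * F x `^ p).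
  by apply: emeasurable_funM => //; exact: measurable_cst.
apply: (@le_lt_trans _ _ (\int[mu]_x (M%:E * F x `^ p + (`|h x|)%:E))).
  apply: ge0_le_integralT.
  - exact: emeasurable_funM.
  - exact: emeasurable_funD.
  - by move=> x; rewrite mule_ge0 ?lee_fin.
  move=> x; apply: (@le_trans _ _ ((F x `^ p + 1) * (`|h x|)%:E)).
    by rewrite lee_wpmul2r ?lee_fin//; exact: le_poweRD1.
  rewrite ge0_muleDl ?poweR_ge0// mul1e leeD2r// muleC lee_wpmul2r ?poweR_ge0// lee_fin.
  exact: hM.
rewrite ge0_integralDT//; last by move=> x; rewrite mule_ge0 ?lee_fin ?poweR_ge0.
rewrite ge0_integralZT//; last by move=> x; exact: poweR_ge0.
apply: lte_add_pinfty.
  by rewrite lte_mul_pinfty ?lee_fin.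
by have /integrableP[_] := integrable_hermite.
Qed.

Lemma integrable_mul_hermite : mu.-integrable setT (fun x => (u x * h x)%:E).
Proof.
apply/integrableP; split.
  by apply/measurable_EFinP; apply: measurable_funM => //; exact: measurable_hermite.
have mvE : measurable_fun setT (fun x => (v x)%:E) by exact/measurable_EFinP.
have mh : measurable_fun setT (fun x => (`|h x|)%:E).
  by apply/measurable_EFinP; apply: measurableT_comp; [exact: normr_measurable|exact: measurable_hermite].
apply: (@le_lt_trans _ _ (\int[mu]_x ((v x)%:E * (`|h x|)%:E))).
  apply: ge0_le_integralT.
  - apply: measurableT_comp => //; apply/measurable_EFinP; apply: measurable_funM => //.
    exact: measurable_hermite.
  - exact: emeasurable_funM.
  - by move=> x; exact: abse_ge0.
  - by move=> x; rewrite -EFinM abse_EFin lee_fin normrM ler_wpM2r.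
by apply: integral_mul_hermite_lty => // x; rewrite lee_fin.
Qed.

Lemma integral_heat_potential_powR_lty : \int[mu]_x (I x `^ p) < +oo.
Proof.
have [C C0 hC] := integral_heat_potential_le d0 a2 sigma0 p1 p1 (exponents_self p1).
pose N := \int[mu]_x ((v x `^ p)%R)%:E.
have N0 : 0 <= N by apply: integral_ge0 => x _; rewrite lee_fin powR_ge0.
have Nf : N \is a fin_num by rewrite ge0_fin_numE.
have f0 : (0 <= fine N)%R by exact: fine_ge0.
have r0 : (0 < fine N + 1)%R by rewrite ltr_wpDl.
have := hC v (fine N + 1)%R mv v0 r0 _.
move=> /(_ _)/le_lt_trans; apply; last exact: ltry.
rewrite -/N -(fineK Nf) lee_fin; apply: (@le_trans _ _ (fine N + 1)%R); first by rewrite lerDl.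
by rewrite -[leLHS]powRr1 ?(ltW r0)// ler_powR// lerDr.
Qed.

Let mI : measurable_fun setT I. Proof. exact: measurable_heat_potential. Qed.
Let I0 x : 0 <= I x. Proof. exact: heat_potential_ge0. Qed.

Lemma integral_heat_potential_hermite_lty :
  \int[mu]_x ((Gamma sigma)^-1%:E * I x * (`|h x|)%:E) < +oo.
Proof.
have G0 := Gamma_inv_ge0 sigma0.
have E x : (Gamma sigma)^-1%:E * I x * (`|h x|)%:E = (Gamma sigma)^-1%:E * (I x * (`|h x|)%:E) by rewrite muleA.
under eq_integral do rewrite E.
rewrite ge0_integralZT//.
- by rewrite lte_mul_pinfty ?lee_fin//; apply: integral_mul_hermite_lty => //; exact: integral_heat_potential_powR_lty.
- apply: emeasurable_funM => //; apply/measurable_EFinP; apply: measurableT_comp; first exact: normr_measurable.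
  exact: measurable_hermite.
- by move=> x; rewrite mule_ge0 ?lee_fin.
Qed.

Let mbound : measurable_fun setT (fun x => (Gamma sigma)^-1%:E * I x * (`|h x|)%:E).
Proof.
apply: emeasurable_funM.
  by apply: emeasurable_funM => //; exact: measurable_cst.
by apply/measurable_EFinP; apply: measurableT_comp; [exact: normr_measurable|exact: measurable_hermite].
Qed.

Lemma integrable_real_potential_hermite :
  mu.-integrable setT (fun x => (fine (real_potential alpha sigma u x) * h x)%:E).
Proof.
have mr := @measurable_real_potential R d alpha sigma d0 a2 u mu_.
have mf : measurable_fun setT (fun x => (fine (real_potential alpha sigma u x) * h x)%:E).
  apply/measurable_EFinP; apply: measurable_funM; last exact: measurable_hermite.
  exact: (measurableT_comp (fine_measurable measurableT) mr).
apply/integrableP; split => //.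
apply: le_lt_trans integral_heat_potential_hermite_lty.
apply: ge0_le_integralT => //.
- exact: measurableT_comp.
move=> x; rewrite abse_EFin normrM EFinM lee_wpmul2r ?lee_fin//.
exact: abs_real_potential_le.
Qed.

(** Fubini's theorem on the product space, where absolute integrability comes from the potential of
    v being in L^p. The potential of u is finite almost everywhere, so [fine] does not change the
    integral. Then [integral_potential_kernel_hermite] evaluates the integral in x. *)
Lemma integral_real_potential_hermite :
  \int[mu]_x (fine (real_potential alpha sigma u x) * h x)%:E =
  (ev `^ (- sigma))%:E * \int[mu]_x (u x * h x)%:E.
Proof.
pose P (z : X * X) : \bar R := pk z.1 z.2 * (u z.2)%:E * (h z.1)%:E.
have mpk := @measurable_potential_kernel R d alpha sigma d0 a2.
have mP : measurable_fun setT P.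
  apply: emeasurable_funM.
    by apply: emeasurable_funM => //; apply/measurable_EFinP; exact: (measurableT_comp mu_ measurable_snd).
  by apply/measurable_EFinP; exact: (measurableT_comp measurable_hermite measurable_fst).
have mpu x : measurable_fun setT (fun y => pk x y * (u y)%:E) by exact: measurable_potential_kernelM.
have iP : (mu \x mu).-integrable setT P.
  apply/integrable12ltyP => //.
  apply: le_lt_trans integral_heat_potential_hermite_lty.
  apply: ge0_le_integralT => //.
  - apply: (@measurable_fun_fubini_tonelli_F _ _ _ _ _ mu (abse \o P)).
      exact: measurableT_comp.
    by move=> z; exact: abse_ge0.
  - by move=> x; apply: integral_ge0.
  move=> x.
  have E y : `|P (x, y)| = (`|h x|)%:E * `|pk x y * (u y)%:E| by rewrite /P abseM muleC.
  under eq_integral do rewrite E.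
  rewrite ge0_integralZT//; last by apply: measurableT_comp.
  by rewrite muleC lee_wpmul2r ?lee_fin//; exact: integral_abs_potential_kernel_le.
have iF := @integrable_fubini_F _ _ _ _ _ mu mu P iP.
transitivity (\int[mu]_x \int[mu]_y P (x, y)).
  apply: ae_eq_integral => //.
  - by have /integrableP[] := integrable_real_potential_hermite.
  - by have /integrableP[] := iF.
  have := ae_heat_potential_lty d0 a2 mv v0 p0 integral_heat_potential_powR_lty.
  apply: filterS => x xoo _.
  have ipu := potential_kernelM_integrable d0 a2 sigma0 mu_ mv uv xoo.
  rewrite /P /= integralZr// EFinM fineK//.
  exact: (integrable_fin_num measurableT ipu).
rewrite (Fubini iP).
have E y : \int[mu]_x P (x, y) = (ev `^ (- sigma))%:E * (u y * h y)%:E.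
  have E1 x : P (x, y) = (u y)%:E * (pk x y * (h x)%:E) by rewrite muleA [(u y)%:E * _]muleC.
  under eq_integral do rewrite E1.
  rewrite integralZl//; last exact: integrable_potential_kernel_hermite.
  by rewrite integral_potential_kernel_hermite -!EFinM; congr EFin; ring.
under eq_integral do rewrite E.
by rewrite integralZl//; exact: integrable_mul_hermite.
Qed.

End real_function.

End spectral.

Section spectral_complex.
Context {R : realType} {d : nat}.
Variables (alpha : 'I_d -> R) (sigma p : R).
Hypotheses (d0 : (0 < d)%N) (a2 : forall i, (- 2^-1 <= alpha i)%R) (sigma0 : (0 < sigma)%R).
Hypothesis p1 : 1 <= p.
Local Notation mu := (dunkl_measure alpha).

Lemma Re_mul_conj_real (z : R[i]) (r : R) : complex.Re (z * conjc (r%:C)%C) = complex.Re z * r.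
Proof. by case: z => a b /=; rewrite oppr0 mulr0 subr0. Qed.

Lemma Im_mul_conj_real (z : R[i]) (r : R) : complex.Im (z * conjc (r%:C)%C) = complex.Im z * r.
Proof. by case: z => a b /=; rewrite oppr0 mulr0 add0r. Qed.

(** The Hermite functions are real, so the pairing acts separately on the real and imaginary parts
    of f, both dominated by |f|. *)
Lemma potential_spectralP : potential_spectral alpha sigma p.
Proof.
move=> k f [mf fin] h; have [mr mi] := mf.
have p0 : 0 < p by exact: lt_le_trans p1.
have mn := measurable_normc mf.
have np : (\int[mu]_x ((Normc.normc (f x) `^ p)%R)%:E < +oo)%E.
  by rewrite integral_normc_powR//; exact: poweR_lty.
have nr x := normc_Re (f x); have ni x := normc_Im (f x).
pose u x := complex.Re (f x); pose v x := complex.Im (f x).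
have Ru := @integrable_real_potential_hermite _ _ alpha sigma d0 a2 sigma0 k p u _ p1 mr mn nr np.
have Rv := @integrable_real_potential_hermite _ _ alpha sigma d0 a2 sigma0 k p v _ p1 mi mn ni np.
have Iu := @integrable_mul_hermite _ _ alpha a2 k p u _ p1 mr mn nr np.
have Iv := @integrable_mul_hermite _ _ alpha a2 k p v _ p1 mi mn ni np.
have Eu := @integral_real_potential_hermite _ _ alpha sigma d0 a2 sigma0 k p u _ p1 mr mn nr np.
have Ev := @integral_real_potential_hermite _ _ alpha sigma d0 a2 sigma0 k p v _ p1 mi mn ni np.
have RE g x : complex.Re (g x * conjc (h x)) = complex.Re (g x) * hermite alpha k x by exact: Re_mul_conj_real.
have IE g x : complex.Im (g x * conjc (h x)) = complex.Im (g x) * hermite alpha k x by exact: Im_mul_conj_real.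
split.
- split; under eq_fun do rewrite ?RE ?IE; [exact: Ru|exact: Rv].
- split; under eq_fun do rewrite ?RE ?IE; [exact: Iu|exact: Iv].
have pE g : pairing mu g h = Complex (fine (\int[mu]_x (complex.Re (g x) * hermite alpha k x)%:E))
    (fine (\int[mu]_x (complex.Im (g x) * hermite alpha k x)%:E)).
  by congr Complex; congr fine; apply: eq_integral => x _; rewrite ?RE ?IE.
rewrite !pE [X in Complex (fine X) _]Eu [X in Complex _ (fine X) = _]Ev.
have fu := integrable_fin_num measurableT Iu; have fv := integrable_fin_num measurableT Iv.
rewrite (fineM _ fu)// (fineM _ fv)//=.
by apply/eqP; rewrite eq_complex /= !mul0r subr0 addr0 !eqxx.
Qed.

End spectral_complex.

Theorem theorem6p1 (R : realType) (d : nat) (alpha : 'I_d -> R) (sigma p q : R) :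
  (1 <= d)%N ->
  (forall i, - 2^-1 <= alpha i) ->
  0 < sigma -> 1 <= p -> 1 <= q ->
  [/\ hom_dim alpha <= sigma -> potential_Lp_Lq alpha sigma p q,
      sigma < hom_dim alpha -> admissible_exponents alpha sigma p q ->
        potential_Lp_Lq alpha sigma p q &
      hom_dim alpha <= sigma \/
        (sigma < hom_dim alpha /\ admissible_exponents alpha sigma p q) ->
        potential_spectral alpha sigma p].
Proof.
move=> d0 a2 sigma0 p1 q1; split.
- by move=> h; apply: potential_boundedP => //; left.
- by move=> _ h; apply: potential_boundedP => //; right.
- by move=> _; exact: potential_spectralP.
Qed.
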